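(* Let $q>0$ and let $Q$ be the external field on $\mathbb S^2$ generated by a positive point charge of magnitude $q$ located at $(0,0,h)$, $h>0$: $$Q(x)=\frac{q}{|x-hp|},\qquad p=(0,0,1),\quad x\in\mathbb S^2.$$ Let $h_+$ be the unique real zero in $(1,\infty)$ of the equation $\frac1q=\frac{h+1}{(h-1)^2}-\frac1h$, and let $h_-$ be the unique real zero in $(0,1)$ of the equation $\frac1q=\frac{h+1}{(1-h)^2}-1$. Suppose that $h_-<h<h_+$. Then the support $S_Q$ of the extremal measure $\mu_Q$ is a spherical cap $C_{S,\alpha}$ centered at the South Pole, with $\alpha=\alpha_0\in(0,\pi)$, where $\alpha_0$ is the unique solution in $(0,\pi)$ of the transcendental equation $$\frac{\pi}{\pi-\alpha+\sin\alpha}\left\{1+\frac{q(h+1)}{2h}\left(1-\frac{\alpha}{\pi}\right)-\frac{q(h-1)}{\pi h}\tan^{-1}\!\left(\cot\!\left(\frac{\alpha}{2}\right)\frac{h-1}{h+1}\right)\right\}=q\,\frac{h+1}{h^2+1-2h\cos\alpha}.$$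
   Context: $\mathbb S^2=\{x\in\mathbb R^3:|x|=1\}$, with $|\cdot|$ the Euclidean norm. Spherical coordinates are $(r,\theta,\varphi)$ with $0\le\varphi\le\pi$ the polar angle measured from the positive $x_3$-axis and $0\le\theta\le2\pi$ the azimuthal angle. For $0<\alpha\le\pi$, $C_{S,\alpha}=\{(r,\theta,\varphi): r=1,\ \alpha\le\varphi\le\pi,\ 0\le\theta\le2\pi\}$. For a unit positive Borel measure $\mu$ on $\mathbb S^2$ put $I(\mu)=\iint\frac{1}{|x-y|}\,d\mu(x)\,d\mu(y)$ and $I_Q(\mu)=I(\mu)+2\int Q\,d\mu$. Let $V_Q$ be the infimum of $I_Q(\mu)$ over all unit positive Borel measures $\mu$ on $\mathbb S^2$. The extremal (equilibrium) measure $\mu_Q$ is the unit positive Borel measure on $\mathbb S^2$ with $I_Q(\mu_Q)=V_Q$, and $S_Q=\operatorname{supp}\mu_Q$. *)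

(* Defs.v *)
From HB Require Import structures.
From mathcomp Require Import all_boot all_order all_algebra.
From mathcomp Require Import all_classical all_reals all_analysis.

Set Implicit Arguments.
Unset Strict Implicit.
Unset Printing Implicit Defensive.

Import Order.TTheory GRing.Theory Num.Theory.
Import numFieldNormedType.Exports.

Local Open Scope classical_set_scope.
Local Open Scope ring_scope.

(* Three-dimensional Euclidean space is the triple product R * R * R, with its
   product topology and its product sigma-algebra (which is the Borel
   sigma-algebra).  The norm that the library puts on a product is the sup
   norm, hence the explicit Euclidean norm below. *)
Notation R3 R := (R * R * R)%type.

Section Sphere.
Context {R : realType}.
Implicit Types (x y : R3 R) (r theta phi alpha h q : R).

Definition enorm x : R :=
  Num.sqrt (x.1.1 ^+ 2 + x.1.2 ^+ 2 + x.2 ^+ 2).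

Definition sphere : set (R3 R) := [set x | enorm x = 1].

Definition spherical r theta phi : R3 R :=
  (r * (sin phi * cos theta), r * (sin phi * sin theta), r * cos phi).

Definition south_cap alpha : set (R3 R) :=
  [set x | exists theta phi,
     [/\ alpha <= phi <= pi, 0 <= theta <= 2 * pi & x = spherical 1 theta phi]].

(* The inverse is that of \bar R, for which 0^-1 = +oo: the kernel 1 / |x - y|
   is infinite on the diagonal, and for h = 1 the field Q is infinite at the
   North Pole. *)
Definition coulomb x y : \bar R := ((enorm (x - y))%:E^-1)%E.

Definition field_of_charge q h x : \bar R :=
  (q%:E / (enorm (x - (0, 0, h)))%:E)%E.

(* A unit positive Borel measure on the sphere is a Borel probability measure
   on R3 R that gives the sphere full mass. *)
Definition on_sphere (mu : probability (R3 R) R) : Prop :=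
  mu sphere = 1%E.

Local Open Scope ereal_scope.

Definition energy (mu : probability (R3 R) R) : \bar R :=
  \int[mu]_(x in sphere) \int[mu]_(y in sphere) coulomb x y.

Definition weighted_energy (Q : R3 R -> \bar R)
    (mu : probability (R3 R) R) : \bar R :=
  energy mu + 2%:E * \int[mu]_(x in sphere) Q x.

Definition min_energy (Q : R3 R -> \bar R) : \bar R :=
  ereal_inf [set weighted_energy Q mu | mu in on_sphere].

Definition extremal (Q : R3 R -> \bar R) (mu : probability (R3 R) R) :=
  on_sphere mu /\ weighted_energy Q mu = min_energy Q.

Definition msupport (mu : probability (R3 R) R) : set (R3 R) :=
  [set x | forall U : set (R3 R), open U -> U x -> 0 < mu U].

Local Close Scope ereal_scope.

Definition cot (t : R) : R := cos t / sin t.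

Definition zero_hplus q h : Prop :=
  1 < h /\ 1 / q = (h + 1) / (h - 1) ^+ 2 - 1 / h.

Definition zero_hminus q h : Prop :=
  0 < h < 1 /\ 1 / q = (h + 1) / (1 - h) ^+ 2 - 1.

Definition cap_equation q h alpha : Prop :=
  pi / (pi - alpha + sin alpha) *
    (1 + q * (h + 1) / (2 * h) * (1 - alpha / pi)
       - q * (h - 1) / (pi * h) * atan (cot (alpha / 2) * ((h - 1) / (h + 1))))
  = q * ((h + 1) / (h ^+ 2 + 1 - 2 * h * cos alpha)).

End Sphere.

(* Main.v *)
Require Import Defs.
From HB Require Import structures.
From mathcomp Require Import all_boot all_order all_algebra.
From mathcomp Require Import all_classical all_reals all_analysis.
From mathcomp Require Import measurable_realfun.
From mathcomp Require Import ring lra.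

(** In the chart given by stereographic projection from the north pole, the distance
    of two points of the sphere is [2 |z - z'| / (r(z) r(z'))] with
    [r(z) = sqrt (1 + |z|^2)], and the distance to the charge is
    [sqrt ((1 + h)^2 + (1 - h)^2 |z|^2) / r(z)].  A cap around the south pole becomes
    a disk of radius [c = cot (alpha / 2)], and the condition that the potential of
    a measure and the external field add up to a constant [a] on the cap becomes an
    integral equation for the planar kernel [1 / |z - z'|] on this disk.

    This equation can be solved explicitly.  Written in polar coordinates around a
    point, the planar potential is an average of integrals over the lines through
    the point ([slope_coordinates]).  A superposition with weight [w] of the densities
    [1 / sqrt (s - |z|^2)] of the disks of squared radius [s] has, on a line at squared
    distance [d] from the origin, an integral that only depends on the tail of [w]
    beyond [d] ([disk_mixture_line]).  Since [a] and the external field are also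
    averages over lines, it suffices that this tail be an explicit function of [d],
    [edge_profile].  The tail vanishes at the edge of the disk, which forces the value
    of [a]; then [w] is nonnegative, and outside of the disk the sum of the potential
    and of the field is at least [a].  Therefore [equilibrium_measure] yields a measure
    eta as soon as the total mass is one, which is the transcendental equation
    ([cap_equation_mass]).  The mass is an increasing function of [c] which starts at
    [0], and its limit at infinity exceeds [1] when [h] lies between the critical
    heights ([cap_mass_gt1]), so that there is exactly one solution.

    It remains to see that an extremal measure mu has the support of eta.
    On the sphere [1 / |x - y|] is a power series with positive coefficients in
    [(1 + x . y) / 2], and each power is a finite sum of products [word f x * word f y].
    So the energy of mu - eta is a sum of squares with positive coefficients.  The
    equilibrium condition for eta and the minimality of mu make this energy
    nonpositive, hence the two measures have the same moments
    ([energy_rigidity], [extremal_power_potential]).  The powers of [(1 + x . y) / 2] peak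
    at [x], so their integrals determine the support ([msupport_power_potential]), and
    the support of eta is the whole cap because eta charges each open set that
    meets it. *)

Import Order.TTheory GRing.Theory Num.Theory.
Import numFieldNormedType.Exports.

Local Open Scope classical_set_scope.
Local Open Scope ring_scope.

Set Implicit Arguments.
Unset Strict Implicit.

(** * Integrals over lines *)

Section LineIntegrals.
Context {R : realType}.
Notation leb := (@lebesgue_measure R).
Implicit Types (f F : R -> R) (a b c : R).

Lemma measurable_inv : measurable_fun [set: R] (@GRing.inv R).
Proof.
have -> : [set: R] = [set 0] `|` ~` [set 0] by rewrite setUv.
apply/measurable_funU => //; first exact: measurableC.
split; first exact: measurable_fun_set1.
apply: open_continuous_measurable_fun; first exact/closed_openC/closed_eq.
by move=> x /[!inE] /eqP x0; exact: inv_continuous.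
Qed.

Lemma eq_is_derive1 (f g : R -> R) (x df dg : R) :
  is_derive x 1 f df -> f =1 g -> df = dg -> is_derive x 1 g dg.
Proof. by move=> fx /funext <- <-. Qed.

Lemma measurable_sqrt : measurable_fun [set: R] (@Num.sqrt R).
Proof. by apply: continuous_measurable_fun; exact: sqrt_continuous. Qed.

(** Exhausting [D] by compact intervals lets the integrand blow up at the ends:
    monotone convergence carries the fundamental theorem to the limit. *)
Lemma ge0_FTC_bigcup f F (u v : R^nat) (D : set R) (l : R) :
  (forall n, u n < v n) ->
  {homo u : m n / (m <= n)%N >-> n <= m} ->
  {homo v : m n / (m <= n)%N >-> m <= n} ->
  D = \bigcup_n `[u n, v n]%classic ->
  (forall x, D x -> 0 <= f x) ->
  (forall x, D x -> {for x, continuous f}) ->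
  (forall x, D x -> is_derive x 1 F (f x)) ->
  F (v n) - F (u n) @[n --> \oo] --> l ->
  (\int[leb]_(x in D) (f x)%:E = l%:E)%E.
Proof.
move=> uv du iv DE f0 cf dF Fl.
have DI n x : x \in `[u n, v n] -> D x by move=> xuv; rewrite DE; exists n.
have mono : nondecreasing_seq (fun n => `[u n, v n]%classic).
  move=> m n mn; apply/subsetPset => x /=; rewrite !in_itv/= => /andP[ux xv].
  by rewrite (le_trans (du _ _ mn) ux) (le_trans xv (iv _ _ mn)).
have cfn n : {within `[u n, v n], continuous f}.
  by apply: continuous_in_subspaceT => x /[!inE] xuv; exact/cf/(DI n).
have mfn n : measurable_fun `[u n, v n] (EFin \o f).
  by apply/measurable_EFinP; apply: subspace_continuous_measurable_fun.
have cFx x : D x -> {for x, continuous F}.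
  move=> Dx; apply: differentiable_continuous; apply/derivable1_diffP.
  by have [] := dF _ Dx.
have cvg_int : (\int[leb]_(x in `[u n, v n]) (f x)%:E)%E @[n --> \oo] -->
    (\int[leb]_(x in D) (f x)%:E)%E.
  rewrite DE; apply: ge0_nondecreasing_set_cvg_integral => //.
  by move=> i x xi; rewrite lee_fin f0//; exact: (DI i).
have intE n : (\int[leb]_(x in `[u n, v n]) (f x)%:E = (F (v n) - F (u n))%:E)%E.
  rewrite EFinB; apply: continuous_FTC2 => //.
    have uI : u n \in `[u n, v n] by rewrite in_itv/= lexx ltW.
    have vI : v n \in `[u n, v n] by rewrite in_itv/= lexx ltW.
    split.
    - move=> x /subset_itv_oo_cc xI; have [] := dF x (DI n _ xI).
      by [].
    - exact/cvg_at_right_filter/cFx/(DI n).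
    - exact/cvg_at_left_filter/cFx/(DI n).
  move=> x /subset_itv_oo_cc xI; rewrite derive1E.
  by have dFx := dF x (DI n _ xI); rewrite derive_val.
move: cvg_int; rewrite (funext intE) => cvg_int.
apply: (cvg_unique _ cvg_int); first exact: ereal_hausdorff.
by apply: cvg_EFin; first exact: nearW.
Qed.

Lemma ge0_FTC_itvoo f F a b : a < b ->
  (forall x, a < x < b -> 0 <= f x) ->
  (forall x, a < x < b -> {for x, continuous f}) ->
  (forall x, a < x < b -> is_derive x 1 F (f x)) ->
  {for a, continuous F} -> {for b, continuous F} ->
  (\int[leb]_(x in `]a, b[) (f x)%:E = (F b - F a)%:E)%E.
Proof.
move=> ab f0 cf dF cFa cFb.
have ba0 : 0 < b - a by rewrite subr_gt0.
pose e n : R := (b - a) * harmonic n.+2.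
have e0 n : 0 < e n by rewrite mulr_gt0// invr_gt0.
have e3 n : e n * 2 < b - a.
  rewrite -[ltRHS]mulr1 /e -mulrA ltr_pM2l// mulrC ltr_pdivrMr//.
  by rewrite mul1r ltr_nat.
have elim m n : (m <= n)%N -> e n <= e m.
  by move=> mn; rewrite ler_pM2l// lef_pV2 ?posrE// ler_nat !ltnS.
have ecvg : e n @[n --> \oo] --> (0 : R).
  rewrite -(mulr0 (b - a)); apply: cvgM; first exact: cvg_cst.
  have := @cvg_harmonic R; rewrite -(cvg_shiftn 2 (harmonic : R^nat)).
  by under eq_fun do rewrite addn2.
apply: (@ge0_FTC_bigcup f F (fun n => a + e n) (fun n => b - e n)).
- by move=> n; have := e3 n; lra.
- by move=> m n mn; rewrite lerD2l elim.
- by move=> m n mn; rewrite lerD2l lerN2 elim.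
- apply/seteqP; split => x /=; last first.
    move=> [n _]; rewrite /= !in_itv/= => /andP[ux xv].
    by have en := e0 n; apply/andP; split; lra.
  rewrite in_itv/= => /andP[ax xb].
  pose d := Num.min (x - a) (b - x).
  have d0 : 0 < d by rewrite lt_min !subr_gt0 ax.
  have [n _ nd] : \forall n \near \oo, e n < d by exact: cvgr_lt ecvg _ d0.
  exists n => //=; have := nd n (leqnn n); rewrite lt_min => /andP[h1 h2].
  by rewrite in_itv/=; apply/andP; split; lra.
- by move=> x /=; rewrite in_itv; exact: f0.
- by move=> x /=; rewrite in_itv; exact: cf.
- apply: cvgB.
    apply: continuous_cvg => //; rewrite -[X in _ --> X]subr0.
    by apply: cvgB => //; exact: cvg_cst.
  apply: continuous_cvg => //; rewrite -[X in _ --> X]addr0.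
  by apply: cvgD => //; exact: cvg_cst.
Qed.

Lemma integral_oneDsqrV : (\int[leb]_x (1 + x ^+ 2)^-1%:E = pi%:E :> \bar R)%E.
Proof.
apply: (@ge0_FTC_bigcup _ (@atan R) (fun n => - n.+1%:R) (fun n => n.+1%:R)).
- by move=> n; rewrite (@lt_trans _ _ 0)// ltr0n.
- by move=> m n mn; rewrite lerN2 ler_nat.
- by move=> m n mn; rewrite ler_nat.
- apply/seteqP; split => x //= _; exists (Num.bound `|x|) => //=.
  rewrite in_itv/= -ler_norml (le_trans (ltW (archi_boundP (normr_ge0 x))))//.
  by rewrite ler_nat.
- by move=> x _; rewrite invr_ge0 addr_ge0// sqr_ge0.
- by move=> x _; exact: (@continuous_oneDsqrV R).
- under eq_fun do rewrite atanN opprK.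
  have h : atan (n.+1%:R : R) @[n --> \oo] --> (pi / 2 : R).
    have := @cvgy_atan R; apply: cvg_comp.
    by rewrite (cvg_shiftS (fun n => n%:R : R)); exact: cvgr_idn.
  by have -> : (pi : R) = pi / 2 + pi / 2; [lra|exact: cvgD].
Qed.

(** The real square root vanishes on negative numbers and [0^-1 = 0], so the
    integrand vanishes outside of ]-1, 1[. *)
Lemma integral_sqrt_oneBsqrV :
  (\int[leb]_x (Num.sqrt (1 - x ^+ 2))^-1%:E = pi%:E :> \bar R)%E.
Proof.
have s1 (x : R) : 0 < 1 + Num.sqrt (1 - x ^+ 2) by rewrite ltr_pwDl// sqrtr_ge0.
have cs : continuous (fun x : R => Num.sqrt (1 - x ^+ 2)).
  move=> x; apply: continuous_comp; last exact: sqrt_continuous.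
  apply: cvgB; first exact: cvg_cst.
  by apply: cvgM; exact: cvg_id.
(* the arcsine, in a form that is visibly continuous up to 1 and -1 *)
pose F (x : R) := 2 * atan (x / (1 + Num.sqrt (1 - x ^+ 2))).
have cF : continuous F.
  move=> x; apply: cvgM; first exact: cvg_cst.
  apply: continuous_comp; last exact: continuous_atan.
  apply: cvgM; first exact: cvg_id.
  apply: cvgV; first by rewrite gt_eqF.
  by apply: cvgD; [exact: cvg_cst|exact: cs].
transitivity ((F 1 - F (- 1))%:E); last first.
  congr EFin; rewrite /F sqrrN expr1n subrr sqrtr0 addr0 !divr1 atanN atan1; lra.
transitivity (\int[leb]_(x in `](- 1)%R, 1%R[) (Num.sqrt (1 - x ^+ 2))^-1%:E)%E.
  rewrite [RHS]integral_mkcond; apply: eq_integral => x _; rewrite patchE.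
  case: ifPn => // /negP; rewrite inE/= in_itv/= => /negP.
  rewrite -ltr_norml -leNgt => x1.
  by rewrite ler0_sqrtr ?invr0// subr_le0 -(real_normK (num_real x)) expr_ge1.
apply: ge0_FTC_itvoo; [lra| | | |exact: cF|exact: cF].
- by move=> x _; rewrite invr_ge0 sqrtr_ge0.
- move=> x x1; apply: cvgV; last exact: cs.
  by rewrite gt_eqF// sqrtr_gt0; nra.
- move=> x x1.
  have x0 : 0 < 1 - x ^+ 2 by nra.
  pose w := Num.sqrt (1 - x ^+ 2).
  have w0 : 0 < w by rewrite sqrtr_gt0.
  have w2 : w ^+ 2 = 1 - x ^+ 2 by rewrite sqr_sqrtr// ltW.
  have dd : is_derive x 1 (fun x : R => 1 - x ^+ 2) (- 2 * x).
    apply: is_derive_eq; rewrite scaler1 /GRing.scale/=; ring.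
  have dw := is_derive1_sqrt x0.
  have dws := @is_derive1_comp R Num.sqrt (fun x : R => 1 - x ^+ 2) x _ _ dw dd.
  have nz : 1 + w != 0 by rewrite gt_eqF// s1.
  have dden : is_derive x 1 (fun x : R => 1 + Num.sqrt (1 - x ^+ 2)) (- x / w).
    apply: eq_is_derive1 (is_deriveD (is_derive_cst (1 : R) x 1) dws) _ _ => //.
    by rewrite -/w; field; rewrite gt_eqF.
  have dinv := @is_deriveV R (fun x : R => 1 + Num.sqrt (1 - x ^+ 2)) x _ _ nz dden.
  have dq := is_deriveM (is_derive_id x 1) dinv.
  have da := is_derive1_comp (is_derive1_atan _) dq.
  apply: eq_is_derive1 (is_deriveZ 2 da) _ _ => //.
  rewrite /GRing.scale/= -/w; clear dd dw dws dden dinv dq da.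
  have w1 : w != 0 by rewrite gt_eqF.
  have -> : (id * (fun y : R => (1 + Num.sqrt (1 - y ^+ 2))^-1)) x = x / (1 + w).
    by [].
  clearbody w.
  have w1' : 1 + w != 0 by [].
  have x2 : x ^+ 2 = 1 - w ^+ 2 by rewrite w2; ring.
  have -> : 1 + (x / (1 + w)) ^+ 2 = 2 / (1 + w) by rewrite expr_div_n x2; field.
  have -> : x * (- (1 + w) ^- 2 * (- x / w)) = x ^+ 2 / (w * (1 + w) ^+ 2).
    by field; rewrite ?w1 ?w1'.
  by rewrite x2; field; rewrite w1.
Qed.

(** The image of Lebesgue measure by [x |-> a + b x], scaled by [|b|], agrees
    with Lebesgue measure on intervals, hence on all Borel sets. *)
Lemma ge0_integral_affine (f : R -> \bar R) a b : b != 0 ->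
  measurable_fun setT f -> (forall x, 0 <= f x)%E ->
  (\int[leb]_x f (a + b * x)%R = (`|b|^-1)%:E * \int[leb]_x f x)%E.
Proof.
move=> b0 mf f0.
have mphi : measurable_fun [set: measurableTypeR R]
    ((fun x => a + b * x) : _ -> measurableTypeR R).
  by apply: measurable_funD => //; exact: measurable_funM.
pose phi (x : measurableTypeR R) : measurableTypeR R := a + b * x.
have [pm pmE] : exists pm : measure (measurableTypeR R) R,
    forall A, pm A = pushforward leb phi A.
  by unshelve refine (ex_intro _ (pushforward leb phi : measure _ _) _).
pose m : measure (measurableTypeR R) R := mscale (NngNum (normr_ge0 b)) pm.
have lebE A : measurable A -> leb A = m A.
  apply: lebesgue_measure_unique => _ [[x y]] _ <- /=.
  rewrite /m /mscale/= pmE /pushforward.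
  have [b_lt0|b_gt0|/eqP] := ltgtP b 0; last by rewrite (negbTE b0).
    have -> : phi @^-1` `]x, y] = `[((y - a) / b), ((x - a) / b)[%classic.
      apply/seteqP; split => z /=; rewrite !in_itv/= /phi.
        rewrite ler_ndivrMr// ltr_ndivlMr// => /andP[h1 h2].
        by apply/andP; split; lra.
      rewrite ler_ndivrMr// ltr_ndivlMr// => /andP[h1 h2].
      by apply/andP; split; lra.
    rewrite !lebesgue_measure_itv/= !lte_fin ltr_nM2r ?invr_lt0//.
    rewrite ltrD2r; case: ifPn => _; last by rewrite mule0.
    rewrite -!EFinD -EFinM; congr EFin.
    rewrite ltr0_norm//; field.
    by [].
  have -> : phi @^-1` `]x, y] = `]((x - a) / b), ((y - a) / b)]%classic.
    apply/seteqP; split => z /=; rewrite !in_itv/= /phi.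
      rewrite ltr_pdivrMr// ler_pdivlMr// => /andP[h1 h2].
      by apply/andP; split; lra.
    rewrite ltr_pdivrMr// ler_pdivlMr// => /andP[h1 h2].
    by apply/andP; split; lra.
  rewrite !lebesgue_measure_itv/= !lte_fin ltr_pM2r ?invr_gt0//.
  rewrite ltrD2r; case: ifPn => _; last by rewrite mule0.
  rewrite -!EFinD -EFinM; congr EFin.
  rewrite gtr0_norm//; field.
  by [].
rewrite -[LHS](@ge0_integral_pushforward _ _ _ _ R phi _ leb setT f)//.
rewrite [in RHS](eq_measure_integral m) => [|A mA _]; last exact: lebE.
rewrite /m ge0_integral_mscale//= muleA -EFinM mulVf ?normr_eq0// mul1e.
by apply: eq_measure_integral => A mA _; rewrite pmE.
Qed.

(** Completing the square reduces to the integral of [1 / (1 + x^2)]; the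
    discriminant condition says that the quadratic has no real root. *)
Lemma integral_quadraticV a b c : 0 < a -> b ^+ 2 < a * c ->
  (\int[leb]_x (a * x ^+ 2 + 2 * b * x + c)^-1%:E =
   (pi / Num.sqrt (a * c - b ^+ 2))%:E)%E.
Proof.
move=> a0 bac; pose d := Num.sqrt (a * c - b ^+ 2).
have d0 : 0 < d by rewrite sqrtr_gt0 subr_gt0.
have d2 : d ^+ 2 = a * c - b ^+ 2 by rewrite sqr_sqrtr// subr_ge0 ltW.
have an0 : a != 0 by rewrite gt_eqF.
have dn0 : d != 0 by rewrite gt_eqF.
rewrite -/d.
pose f (x : R) : \bar R := (1 + x ^+ 2)^-1%:E.
have mf : measurable_fun setT f.
  apply/measurable_EFinP; apply: continuous_measurable_fun.
  exact: (@continuous_oneDsqrV R).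
have f0 x : (0 <= f x)%E.
  by rewrite lee_fin invr_ge0 addr_ge0// sqr_ge0.
transitivity (\int[leb]_x ((a / d ^+ 2)%:E * f (b / d + a / d * x)%R))%E.
  apply: eq_integral => x _; rewrite /f -EFinM; congr EFin.
  have e : a * x ^+ 2 + 2 * b * x + c =
      (d ^+ 2 / a) * (1 + (b / d + a / d * x) ^+ 2).
    have -> : c = (d ^+ 2 + b ^+ 2) / a by rewrite d2; field.
    by field; rewrite dn0.
  by rewrite e invfM invf_div.
rewrite ge0_integralZl//; first last.
- by rewrite lee_fin divr_ge0 ?ltW// exprn_gt0.
- apply: measurableT_comp => //.
  by apply: measurable_funD => //; exact: measurable_funM.
rewrite ge0_integral_affine//; last by rewrite mulf_neq0// invr_eq0.
rewrite integral_oneDsqrV muleA -!EFinM; congr EFin.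
rewrite ger0_norm ?divr_ge0// ?ltW//; field.
by rewrite dn0.
Qed.

(** Completing the square reduces to the arcsine integral, and the dependence on
    [b] and [c] disappears: the length of the chord on which the radicand is
    positive does not matter. *)
Lemma integral_sqrt_quadraticV a b c : 0 < a -> - b ^+ 2 < a * c ->
  (\int[leb]_x (Num.sqrt (c - 2 * b * x - a * x ^+ 2))^-1%:E =
   (pi / Num.sqrt a)%:E)%E.
Proof.
move=> a0 bac; pose d := Num.sqrt (a * c + b ^+ 2).
have d0 : 0 < d by rewrite sqrtr_gt0; lra.
have d2 : d ^+ 2 = a * c + b ^+ 2 by rewrite sqr_sqrtr//; lra.
have an0 : a != 0 by rewrite gt_eqF.
have dn0 : d != 0 by rewrite gt_eqF.
pose f (x : R) : \bar R := (Num.sqrt (1 - x ^+ 2))^-1%:E.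
have mf : measurable_fun setT f.
  apply/measurable_EFinP; apply: measurableT_comp; first exact: measurable_inv.
  apply: measurableT_comp; first exact: measurable_sqrt.
  by apply: measurable_funB => //; exact: measurable_funX.
have f0 x : (0 <= f x)%E by rewrite lee_fin invr_ge0 sqrtr_ge0.
transitivity (\int[leb]_x ((Num.sqrt a / d)%:E * f (b / d + a / d * x)%R))%E.
  apply: eq_integral => x _; rewrite /f -EFinM; congr EFin.
  have e : c - 2 * b * x - a * x ^+ 2 =
      (d ^+ 2 / a) * (1 - (b / d + a / d * x) ^+ 2).
    have -> : c = (d ^+ 2 - b ^+ 2) / a by rewrite d2; field.
    by field; rewrite dn0.
  rewrite e sqrtrM ?divr_ge0 ?sqr_ge0 ?ltW// sqrtrM ?sqr_ge0//.
  by rewrite sqrtr_sqr gtr0_norm// sqrtrV ?ltW// invfM invf_div.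
rewrite ge0_integralZl//; first last.
- by rewrite lee_fin divr_ge0 ?sqrtr_ge0// ltW.
- apply: measurableT_comp => //.
  by apply: measurable_funD => //; exact: measurable_funM.
rewrite ge0_integral_affine//; last by rewrite mulf_neq0// invr_eq0.
rewrite integral_sqrt_oneBsqrV muleA -!EFinM; congr EFin.
rewrite ger0_norm ?divr_ge0// ?ltW// -{2}(sqr_sqrtr (ltW a0)).
field.
by rewrite dn0 gt_eqF// sqrtr_gt0.
Qed.

Lemma integral_sqrt_quadraticV0 a b c : 0 < a -> a * c <= - b ^+ 2 ->
  (\int[leb]_x (Num.sqrt (c - 2 * b * x - a * x ^+ 2))^-1%:E = 0)%E.
Proof.
move=> a0 acb; apply: integral0_eq => x _; rewrite ler0_sqrtr ?invr0//.
rewrite -(pmulr_rle0 _ a0).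
have -> : a * (c - 2 * b * x - a * x ^+ 2) = (a * c + b ^+ 2) - (a * x + b) ^+ 2.
  by ring.
have := sqr_ge0 (a * x + b); lra.
Qed.

End LineIntegrals.

(** * Potentials of superposed disk densities *)

(** Measurability of explicit real functions, by recursion on their shape: the
    shape is read off syntactically so that unification never has to guess the
    outermost operation. *)
Ltac measurable_step :=
  lazymatch goal with
  | |- @measurable_fun _ _ _ _ _ ?f =>
    lazymatch f with
    | (fun _ => ?c) => exact: measurable_cst
    | (fun x => x) => exact: measurable_id
    | (fun x => x.1) => exact: measurable_fst
    | (fun x => x.2) => exact: measurable_snd
    | fst => exact: measurable_fst
    | snd => exact: measurable_snd
    | (fun x => EFin (@?g x)) => apply/measurable_EFinP
    | (fun x => mule (@?g x) (@?h x)) => apply: emeasurable_funM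
    | (fun x => (@?g x, @?h x)) => apply: measurable_fun_pair
    | (fun x => GRing.add (@?g x) (GRing.opp (@?h x))) => apply: measurable_funB
    | (fun x => GRing.add (@?g x) (@?h x)) => apply: measurable_funD
    | (fun x => GRing.opp (@?g x)) =>
        apply: (measurableT_comp (@oppr_measurable _ setT))
    | (fun x => GRing.mul (@?g x) (@?h x)) => apply: measurable_funM
    | (fun x => GRing.exp (@?g x) _) => apply: measurable_funX
    | (fun x => GRing.inv (@?g x)) => apply: (measurableT_comp measurable_inv)
    | (fun x => Num.sqrt (@?g x)) => apply: (measurableT_comp measurable_sqrt)
    | (fun x => Num.norm (@?g x)) =>
        apply: (measurableT_comp (@normr_measurable _ setT))
    | (fun x => (@?g x).1) => apply: (measurableT_comp measurable_fst)
    | (fun x => (@?g x).2) => apply: (measurableT_comp measurable_snd)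
    | GRing.add ?c => apply: (@measurable_funD _ _ _ _ (cst c) id)
    | GRing.mul ?c => apply: (@measurable_funM _ _ _ _ (cst c) id)
    | cst _ => exact: measurable_cst
    | id => exact: measurable_id
    | _ => assumption
    end
  end.
Ltac measurable_tac := repeat measurable_step.

Section PlaneIntegrals.
Context {R : realType}.
Notation leb := (@lebesgue_measure R).
Notation R2 := (measurableTypeR R * measurableTypeR R)%type.
Implicit Types (a b c s t y x : R) (z : R2).

Definition sqn z : R := z.1 ^+ 2 + z.2 ^+ 2.

Lemma sqn_ge0 z : 0 <= sqn z.
Proof. by rewrite addr_ge0 ?sqr_ge0. Qed.

Lemma measurable_sqn : measurable_fun setT sqn.
Proof. by rewrite /sqn; measurable_tac. Qed.

Lemma measurable_inv_EFin :
  measurable_fun [set: R] (fun r : R => (r%:E)^-1 : \bar R)%E.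
Proof.
have -> : (fun r : R => (r%:E)^-1%E) =
    (fun r : R => if r == 0 then +oo%E else (r^-1)%:E).
  by apply/funext => r; rewrite inver.
apply: measurable_fun_ifT => //.
  exact: measurable_fun_eqr.
by apply/measurable_EFinP; exact: measurable_inv.
Qed.

(** Lets an identity of integrands fail at the point where a kernel is singular. *)
Lemma eq_integral_setD1 (f g : R -> \bar R) x :
  measurable_fun setT f -> measurable_fun setT g ->
  (forall y, y != x -> f y = g y) ->
  (\int[leb]_y f y = \int[leb]_y g y)%E.
Proof.
move=> mf mg fg.
rewrite -[LHS](@integral_setD1 _ _ x)//; [|exact: measurableD|exact: measurable_funTS].
rewrite -[RHS](@integral_setD1 _ _ x)//; [|exact: measurableD|exact: measurable_funTS].
by apply: eq_integral => y; rewrite inE => -[_ /= /eqP]; exact: fg.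
Qed.

(** Polar coordinates around [(x1, x2)], with the slope in place of the angle: the
    Jacobian [|y|] of [(y, t) |-> (x1 + y, x2 + y t)] cancels the singularity of the
    kernel [1 / |z - x|], so that a potential becomes an average of integrals over
    the lines through the point. *)
Lemma slope_coordinates (F : R2 -> \bar R) x1 x2 :
  measurable_fun setT F -> (forall z, 0 <= F z)%E ->
  (\int[leb \x leb]_z F z =
   \int[leb]_t \int[leb]_y (`|y|%:E * F (x1 + y, x2 + y * t)%R))%E.
Proof.
move=> mF F0; rewrite fubini_tonelli1//.
have mF1 : measurable_fun setT (fubini_F leb F).
  exact: measurable_fun_fubini_tonelli_F.
pose H (p : R2) : \bar R := (`|p.1|%:E * F (x1 + p.1, x2 + p.1 * p.2)%R)%E.
have mH : measurable_fun setT H.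
  apply: emeasurable_funM; first by measurable_tac.
  by apply: (measurableT_comp mF); measurable_tac.
have H0 p : (0 <= H p)%E by rewrite mule_ge0// lee_fin.
transitivity (\int[leb]_y \int[leb]_t H (y, t))%E; last first.
  by rewrite (@fubini_tonelli _ _ _ _ R leb leb H).
transitivity (\int[leb]_y fubini_F leb F (x1 + 1 * y)%R)%E.
  rewrite ge0_integral_affine//; last by move=> x; exact: integral_ge0.
  by rewrite normr1 invr1 mul1e.
have mHF : measurable_fun setT (fubini_F leb H).
  exact: measurable_fun_fubini_tonelli_F.
apply: (@eq_integral_setD1 _ _ 0) => //.
  by apply: (measurableT_comp mF1); measurable_tac.
move=> y y0.
rewrite /fubini_F/= mul1r /H/=.
have mFy : measurable_fun setT (fun v => F (x1 + y, v)%R).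
  by apply: (measurableT_comp mF); measurable_tac.
rewrite ge0_integralZl//; last first.
  by apply: (measurableT_comp mF); measurable_tac.
rewrite (@ge0_integral_affine R (fun v => F (x1 + y, v)%R) x2 y)//.
by rewrite muleA -EFinM mulfV ?normr_eq0// mul1e.
Qed.

Section DiskMixture.
Variable w : R -> R.
Hypotheses (mw : measurable_fun setT w) (w0 : forall s, 0 <= w s).

(** The superposition, with weight [w], of the densities [1 / sqrt (s - |z|^2)] of
    the disks of squared radius [s]; such a density vanishes outside of its disk
    because the square root of a negative number and the inverse of [0] are [0]. *)
Definition disk_mixture z : \bar R :=
  (\int[leb]_s (w s * (Num.sqrt (s - sqn z))^-1)%:E)%E.

Definition weight_tail s : \bar R := (\int[leb]_(r in `]s, +oo[) (w r)%:E)%E.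

Lemma disk_mixture_ge0 z : (0 <= disk_mixture z)%E.
Proof.
by apply: integral_ge0 => s _; rewrite lee_fin mulr_ge0// invr_ge0 sqrtr_ge0.
Qed.

Lemma weight_tail_ge0 s : (0 <= weight_tail s)%E.
Proof. by apply: integral_ge0 => r _; rewrite lee_fin. Qed.

Lemma measurable_disk_mixture : measurable_fun setT disk_mixture.
Proof.
pose G (p : R2 * measurableTypeR R) : \bar R :=
  (w p.2 * (Num.sqrt (p.2 - sqn p.1))^-1)%:E.
apply: (@measurable_fun_fubini_tonelli_F _ _ _ _ R leb G).
  rewrite /G; apply/measurable_EFinP; apply: measurable_funM.
    by apply: (measurableT_comp mw).
  apply: (measurableT_comp measurable_inv).
  apply: (measurableT_comp measurable_sqrt).
  apply: measurable_funB => //.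
  by apply: (measurableT_comp measurable_sqn).
by move=> p; rewrite lee_fin mulr_ge0// invr_ge0 sqrtr_ge0.
Qed.

(** Restricted to a line at squared distance [d] from the origin, the density of the
    disk of squared radius [s] has the integral [pi] (up to the parametrization)
    when [d < s] and [0] otherwise; hence only the tail of [w] beyond [d] counts. *)
Lemma disk_mixture_line x1 x2 t :
  (\int[leb]_y disk_mixture (x1 + y, x2 + y * t)%R =
   (pi / Num.sqrt (1 + t ^+ 2))%:E *
     weight_tail ((x2 - t * x1) ^+ 2 / (1 + t ^+ 2)))%E.
Proof.
have t1 : 0 < 1 + t ^+ 2 by rewrite ltr_pwDl// sqr_ge0.
pose G (p : R2) : \bar R :=
  (w p.2 * (Num.sqrt (p.2 - sqn (x1 + p.1, x2 + p.1 * t)%R))^-1)%:E.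
have mG : measurable_fun setT G.
  rewrite /G; apply/measurable_EFinP; apply: measurable_funM.
    by apply: (measurableT_comp mw).
  apply: (measurableT_comp measurable_inv).
  apply: (measurableT_comp measurable_sqrt).
  apply: measurable_funB => //.
  by apply: (measurableT_comp measurable_sqn); measurable_tac.
transitivity (\int[leb]_s \int[leb]_y G (y, s))%E.
  rewrite -(@fubini_tonelli _ _ _ _ R leb leb G)//.
  by move=> p; rewrite lee_fin mulr_ge0// invr_ge0 sqrtr_ge0.
rewrite /weight_tail [in RHS]integral_mkcond -ge0_integralZl//; last 3 first.
- by apply/(measurable_restrictT _ _).1 => //; apply/measurable_EFinP; exact: measurable_funTS.
- by move=> s _; apply: erestrict_ge0 => r _; rewrite lee_fin.
- by rewrite lee_fin divr_ge0 ?pi_ge0 ?sqrtr_ge0.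
apply: eq_integral => s _; rewrite /G/=.
have sE y : s - sqn (x1 + y, x2 + y * t)%R =
    (s - x1 ^+ 2 - x2 ^+ 2) - 2 * (x1 + t * x2) * y - (1 + t ^+ 2) * y ^+ 2.
  by rewrite /sqn/=; ring.
under eq_integral do rewrite sE EFinM.
rewrite ge0_integralZl//; last 2 first.
- by measurable_tac.
- by rewrite lee_fin.
have dE : (1 + t ^+ 2) * (s - x1 ^+ 2 - x2 ^+ 2) + (x1 + t * x2) ^+ 2 =
    s * (1 + t ^+ 2) - (x2 - t * x1) ^+ 2 by ring.
rewrite patchE; case: ifPn => [|/negP]; rewrite inE/= in_itv/= andbT.
  rewrite ltr_pdivrMr// => h.
  rewrite (@integral_sqrt_quadraticV R (1 + t ^+ 2) (x1 + t * x2)) //.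
    by rewrite muleC.
  by rewrite -subr_gt0 opprK dE subr_gt0.
move/negP; rewrite -leNgt ler_pdivlMr// => h.
rewrite (@integral_sqrt_quadraticV0 R (1 + t ^+ 2) (x1 + t * x2)) ?mule0//.
by rewrite -subr_le0 opprK dE subr_le0.
Qed.

Lemma disk_mixture_potential x1 x2 :
  (\int[leb \x leb]_z
     (disk_mixture z * ((Num.sqrt (sqn (z.1 - x1, z.2 - x2)%R))%:E)^-1) =
   \int[leb]_t ((pi / (1 + t ^+ 2))%:E *
     weight_tail ((x2 - t * x1) ^+ 2 / (1 + t ^+ 2))))%E.
Proof.
rewrite (@slope_coordinates _ x1 x2); last 2 first.
- apply: emeasurable_funM; first exact: measurable_disk_mixture.
  apply: (measurableT_comp measurable_inv_EFin).
  apply: (measurableT_comp measurable_sqrt).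
  by apply: (measurableT_comp measurable_sqn); measurable_tac.
- by move=> z; rewrite mule_ge0 ?disk_mixture_ge0// inve_ge0 lee_fin sqrtr_ge0.
apply: eq_integral => t _.
have t1 : 0 < 1 + t ^+ 2 by rewrite ltr_pwDl// sqr_ge0.
have st1 : 0 < Num.sqrt (1 + t ^+ 2) by rewrite sqrtr_gt0.
have mD : measurable_fun setT (fun y => disk_mixture (x1 + y, x2 + y * t)%R).
  by apply: (measurableT_comp measurable_disk_mixture); measurable_tac.
transitivity (\int[leb]_y (((Num.sqrt (1 + t ^+ 2))^-1)%:E *
    disk_mixture (x1 + y, x2 + y * t)%R))%E.
  apply: (@eq_integral_setD1 _ _ 0).
  - apply: emeasurable_funM; first by measurable_tac.
    apply: emeasurable_funM; first by [].
    apply: (measurableT_comp measurable_inv_EFin).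
    apply: (measurableT_comp measurable_sqrt).
    by apply: (measurableT_comp measurable_sqn); measurable_tac.
  - by apply: emeasurable_funM.
  move=> y y0.
  have -> : Num.sqrt (sqn (x1 + y - x1, x2 + y * t - x2)%R) =
      `|y| * Num.sqrt (1 + t ^+ 2).
    rewrite -sqrtr_sqr -sqrtrM ?sqr_ge0//; congr Num.sqrt.
    by rewrite /sqn/=; ring.
  rewrite inver mulf_eq0 normr_eq0 (negbTE y0) gt_eqF//=.
  rewrite muleCA muleC -EFinM; congr (_%:E * _)%E.
  by rewrite invfM mulrA mulfV ?normr_eq0// mul1r.
rewrite ge0_integralZl//; last by move=> y _; exact: disk_mixture_ge0.
rewrite disk_mixture_line muleA -EFinM; congr (_%:E * _)%E.
rewrite mulrCA -invfM -expr2 sqr_sqrtr// ltW//.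
Qed.

End DiskMixture.

(** The primitive is minus the arctangent of [sqrt ((s - u^2) / (1 + u^2))]. *)
Lemma integral_radial_disk s : 0 < s ->
  (\int[leb]_(u in `[0%R, +oo[)
     (`|u| * ((Num.sqrt (1 + u ^+ 2))^-1 * (Num.sqrt (s - u ^+ 2))^-1))%:E =
   (atan (Num.sqrt s))%:E)%E.
Proof.
move=> s0; pose r := Num.sqrt s.
have r0 : 0 < r by rewrite sqrtr_gt0.
have r2 : r ^+ 2 = s by rewrite sqr_sqrtr// ltW.
have u1 (u : R) : 0 < 1 + u ^+ 2 by rewrite ltr_pwDl// sqr_ge0.
have cv : continuous (fun u : R => (s + 1) * (1 + u ^+ 2)^-1 - 1).
  move=> u; apply: cvgB; last exact: cvg_cst.
  apply: cvgM; first exact: cvg_cst.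
  exact: (@continuous_oneDsqrV R).
(* (s + 1) / (1 + u^2) - 1 is (s - u^2) / (1 + u^2), and is continuous in u *)
pose F (u : R) := - atan (Num.sqrt ((s + 1) * (1 + u ^+ 2)^-1 - 1)).
have cF : continuous F.
  move=> u; apply: cvgN; apply: continuous_comp; last exact: continuous_atan.
  by apply: continuous_comp; [exact: cv|exact: sqrt_continuous].
pose f (u : R) := u * ((Num.sqrt (1 + u ^+ 2))^-1 * (Num.sqrt (s - u ^+ 2))^-1).
transitivity (\int[leb]_(u in `]0%R, r[) (f u)%:E)%E.
  rewrite [LHS]integral_mkcond [RHS]integral_mkcond.
  apply: eq_integral => u _; rewrite !patchE !mem_setE !in_itv/= andbT.
  have [u0|u0|<-] := ltgtP 0 u => //=; last by rewrite normr0 mul0r.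
  rewrite gtr0_norm//; case: ltP => // ru.
  rewrite (@ler0_sqrtr _ (s - _)) ?invr0 ?mulr0//.
  by rewrite subr_le0 -r2 ler_pXn2r// ?nnegrE// ltW.
have FE : F r - F 0 = atan r.
  rewrite /F expr0n/= addr0 invr1 mulr1 addrK -/r r2 (addrC s) mulfV ?gt_eqF//.
    by rewrite subrr sqrtr0 atan0 oppr0 opprK add0r.
  lra.
rewrite -FE; apply: ge0_FTC_itvoo; [by []| | | |exact: cF|exact: cF].
- by move=> u /andP[/ltW u0 _]; rewrite !mulr_ge0// invr_ge0 sqrtr_ge0.
- move=> u /andP[u0 ur].
  have su : 0 < s - u ^+ 2 by rewrite subr_gt0 -r2 ltr_pXn2r// nnegrE ltW.
  apply: cvgM; first exact: cvg_id.
  apply: cvgM; apply: cvgV; rewrite ?gt_eqF ?sqrtr_gt0//.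
    apply: continuous_comp; last exact: sqrt_continuous.
    by apply: cvgD; [exact: cvg_cst|apply: cvgM; exact: cvg_id].
  apply: continuous_comp; last exact: sqrt_continuous.
  by apply: cvgB; [exact: cvg_cst|apply: cvgM; exact: cvg_id].
move=> u /andP[u0 ur].
have su : 0 < s - u ^+ 2 by rewrite subr_gt0 -r2 ltr_pXn2r// nnegrE ltW.
have nu : 1 + u ^+ 2 != 0 by rewrite gt_eqF.
have vE : (s + 1) * (1 + u ^+ 2)^-1 - 1 = (s - u ^+ 2) / (1 + u ^+ 2) by field.
have v0 : 0 < (s + 1) * (1 + u ^+ 2)^-1 - 1 by rewrite vE divr_gt0.
have dX : is_derive u 1 (fun u : R => 1 + u ^+ 2) (2 * u).
  by apply: is_derive_eq; rewrite scaler1 /GRing.scale/=; ring.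
have dV := @is_deriveV R (fun u : R => 1 + u ^+ 2) u _ _ nu dX.
have dv : is_derive u 1 (fun u : R => (s + 1) * (1 + u ^+ 2)^-1 - 1)
    (- (s + 1) * (2 * u) / (1 + u ^+ 2) ^+ 2).
  apply: eq_is_derive1 (is_deriveB (is_deriveZ (s + 1) dV)
    (is_derive_cst (1 : R) u 1)) _ _ => //.
  by rewrite /GRing.scale/=; field.
have ds := @is_derive1_comp R Num.sqrt _ u _ _ (is_derive1_sqrt v0) dv.
have da := is_deriveN (@is_derive1_comp R atan _ u _ _ (is_derive1_atan _) ds).
apply: eq_is_derive1 da _ _ => //.
rewrite /= sqr_sqrtr ?ltW// vE sqrtrM ?ltW// sqrtrV ?ltW// /f.
set a := Num.sqrt (s - u ^+ 2); set b := Num.sqrt (1 + u ^+ 2).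
have a0 : a != 0 by rewrite gt_eqF// sqrtr_gt0.
have b0 : b != 0 by rewrite gt_eqF// sqrtr_gt0.
have -> : 1 + (s - u ^+ 2) / (1 + u ^+ 2) = (1 + s) / (1 + u ^+ 2) by field.
have -> : 1 + u ^+ 2 = b ^+ 2 by rewrite sqr_sqrtr// ltW.
clearbody a b; field.
rewrite a0 b0 gt_eqF//; lra.
Qed.

(** The factor [1 / sqrt (1 + |z|^2)] is the one that the conformal factor of the
    stereographic projection puts on the disk density. *)
Lemma disk_mass s : 0 < s ->
  (\int[leb \x leb]_z
     ((Num.sqrt (1 + sqn z))^-1 * (Num.sqrt (s - sqn z))^-1)%:E =
   (2 * pi * atan (Num.sqrt s))%:E)%E.
Proof.
move=> s0; rewrite (@slope_coordinates _ 0 0); last 2 first.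
- apply/measurable_EFinP; apply: measurable_funM.
    apply: (measurableT_comp measurable_inv).
    apply: (measurableT_comp measurable_sqrt).
    by apply: measurable_funD => //; exact: measurable_sqn.
  apply: (measurableT_comp measurable_inv).
  apply: (measurableT_comp measurable_sqrt).
  by apply: measurable_funB => //; exact: measurable_sqn.
- by move=> z; rewrite lee_fin mulr_ge0// invr_ge0 sqrtr_ge0.
pose H (u : R) :=
  `|u| * ((Num.sqrt (1 + u ^+ 2))^-1 * (Num.sqrt (s - u ^+ 2))^-1).
have H0 u : 0 <= H u by rewrite !mulr_ge0// invr_ge0 sqrtr_ge0.
have mH : measurable_fun setT H by rewrite /H; measurable_tac.
have intH : (\int[leb]_u (H u)%:E = (2 * atan (Num.sqrt s))%:E)%E.
  have -> : [set: measurableTypeR R] = `]-oo, 0%R] `|` `]0%R, +oo[.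
    apply/esym/seteqP; split => // u _; rewrite /= !in_itv/= andbT.
    by case: (leP u 0) => _; [left|right].
  have mHE D : measurable_fun D (EFin \o H).
    by apply/measurable_EFinP; exact: measurable_funTS.
  rewrite ge0_integral_setU//=; last 3 first.
  - exact: mHE.
  - by move=> u _; rewrite lee_fin.
  - apply/disj_setPS => u [/=]; rewrite !in_itv/= andbT => u0.
    by rewrite ltNge u0.
  rewrite integral_itv_obnd_cbnd; last exact: measurable_funTS.
  have HE : (\int[leb]_(u in `[0%R, +oo[) (H u)%:E =
      (atan (Num.sqrt s))%:E)%E by exact: integral_radial_disk.
  have HN : (\int[leb]_(u in `]-oo, 0%R]) (H u)%:E =
      \int[leb]_(u in `[0%R, +oo[) (H u)%:E)%E.
    rewrite (@ge0_integration_by_substitution0 _ (EFin \o H))//.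
    by apply: eq_integral => u _; rewrite /= /H normrN sqrrN.
  by rewrite HN HE -EFinD; congr EFin; ring.
transitivity (\int[leb]_t ((2 * atan (Num.sqrt s))%:E * (1 + t ^+ 2)^-1%:E))%E.
  apply: eq_integral => t _.
  have t1 : 0 < 1 + t ^+ 2 by rewrite ltr_pwDl// sqr_ge0.
  pose g := Num.sqrt (1 + t ^+ 2).
  have g0 : 0 < g by rewrite sqrtr_gt0.
  have g2 : g ^+ 2 = 1 + t ^+ 2 by rewrite sqr_sqrtr// ltW.
  transitivity (\int[leb]_y (g^-1%:E * (H (0 + g * y))%:E))%E.
    apply: eq_integral => y _; rewrite -!EFinM; congr EFin.
    have -> : sqn (0 + y, 0 + y * t) = (0 + g * y) ^+ 2.
      by rewrite /sqn/= !add0r !exprMn g2; ring.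
    rewrite /H [RHS]mulrA; congr (_ * _).
    by rewrite add0r normrM gtr0_norm// mulrA mulVf ?mul1r// gt_eqF.
  rewrite ge0_integralZl//; last 3 first.
  - by apply/measurable_EFinP; apply: (measurableT_comp mH); measurable_tac.
  - by move=> y _; rewrite lee_fin.
  - by rewrite lee_fin invr_ge0 ltW.
  rewrite (@ge0_integral_affine R (fun u => (H u)%:E))//; last 2 first.
  - by rewrite gt_eqF.
  - exact/measurable_EFinP.
  rewrite intH -!EFinM -g2 gtr0_norm//; congr EFin; field.
  by rewrite gt_eqF.
rewrite ge0_integralZl//.
- by rewrite integral_oneDsqrV -EFinM; congr EFin; ring.
- by apply/measurable_EFinP; measurable_tac.
- by move=> t _; rewrite lee_fin invr_ge0 addr_ge0// sqr_ge0.
- by rewrite lee_fin mulr_ge0// -atan0 le_atan// sqrtr_ge0.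
Qed.

End PlaneIntegrals.

(** * Positive definiteness of the Coulomb kernel on the sphere *)

Section PositiveDefinite.
Context {R : realType}.
Notation leb := (@lebesgue_measure R).
Notation S := (@sphere R).
Implicit Types (x y : R3 R) (s t : R) (n : nat) (mu nu : probability (R3 R) R).

Definition dot x y : R := x.1.1 * y.1.1 + x.1.2 * y.1.2 + x.2 * y.2.

(** On the sphere this ranges over [0, 1] and [|x - y| = 2 sqrt (1 - proximity x y)]. *)
Definition proximity x y : R := (1 + dot x y) / 2.

Lemma enorm_sqr x : enorm x ^+ 2 = dot x x.
Proof.
by rewrite /enorm sqr_sqrtr ?addr_ge0 ?sqr_ge0// /dot -!expr2.
Qed.

Lemma enorm_ge0 x : 0 <= enorm x.
Proof. exact: sqrtr_ge0. Qed.

Lemma sphereE x : S x <-> dot x x = 1.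
Proof.
rewrite -enorm_sqr; split; first by rewrite /sphere/= => ->; rewrite expr1n.
move=> /eqP; rewrite sqrp_eq1 ?enorm_ge0//; by move/eqP.
Qed.

Lemma dotBB x y : dot (x - y) (x - y) = dot x x + dot y y - 2 * dot x y.
Proof. by rewrite /dot/=; ring. Qed.

Lemma enormB_proximity x y : S x -> S y ->
  enorm (x - y) ^+ 2 = 4 * (1 - proximity x y).
Proof.
move=> /sphereE xx /sphereE yy.
by rewrite enorm_sqr dotBB xx yy /proximity; field.
Qed.

Lemma proximity_ge0 x y : S x -> S y -> 0 <= proximity x y.
Proof.
move=> /sphereE xx /sphereE yy.
have : 0 <= dot (x + y) (x + y) by rewrite -enorm_sqr sqr_ge0.
have -> : dot (x + y) (x + y) = dot x x + dot y y + 2 * dot x y.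
  by rewrite /dot/=; ring.
rewrite xx yy /proximity; lra.
Qed.

Lemma proximity_le1 x y : S x -> S y -> proximity x y <= 1.
Proof.
by move=> Sx Sy; have := sqr_ge0 (enorm (x - y)); rewrite enormB_proximity//; lra.
Qed.

Lemma measurable_enorm : measurable_fun setT (@enorm R).
Proof. by rewrite /enorm; measurable_tac. Qed.

Lemma measurable_sphere : measurable S.
Proof.
have -> : S = setT `&` enorm @^-1` [set 1] by rewrite setTI.
exact: measurable_enorm.
Qed.

Lemma measurable_proximity x : measurable_fun setT (proximity x).
Proof. by rewrite /proximity /dot; measurable_tac. Qed.

(** The n-th Taylor coefficient of [1 / (2 sqrt (1 - s))], obtained by expanding the
    integrand of the integral of [1 / (t^2 + 1 - s)] in a geometric series; in this
    form its positivity is evident. *)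
Definition kernel_coef n : \bar R :=
  ((2 * pi)^-1%:E * \int[leb]_t ((1 + t ^+ 2)^-1 ^+ n.+1)%:E)%E.

Lemma kernel_coef_ge0 n : (0 <= kernel_coef n)%E.
Proof.
rewrite mule_ge0 ?lee_fin ?invr_ge0 ?mulr_ge0 ?pi_ge0//.
apply: integral_ge0 => t _; rewrite lee_fin exprn_ge0// invr_ge0.
by rewrite addr_ge0// sqr_ge0.
Qed.

Lemma kernel_coef_gt0 n : (0 < kernel_coef n)%E.
Proof.
rewrite mule_gt0// ?lte_fin ?invr_gt0 ?mulr_gt0 ?pi_gt0//.
apply: (@lt_le_trans _ _ (\int[leb]_(t in `[0%R, 1%R]) (2^-1 ^+ n.+1)%:E)%E).
  rewrite integral_cst//= lebesgue_measure_itv/= lte_fin ltr01.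
  by rewrite oppr0 addr0 mule1 lte_fin exprn_gt0.
apply: (@le_trans _ _ (\int[leb]_(t in `[0%R, 1%R]) ((1 + t ^+ 2)^-1 ^+ n.+1)%:E)%E).
  apply: ge0_le_integral => //.
  - by apply: measurable_funTS; measurable_tac.
  - move=> t /=; rewrite in_itv/= => /andP[t0 t1].
    have t2 : t ^+ 2 <= 1 by rewrite expr_le1.
    have t3 : 0 <= t ^+ 2 by rewrite sqr_ge0.
    rewrite lee_fin ler_pXn2r// ?nnegrE ?invr_ge0//; last lra.
    rewrite lef_pV2 ?posrE//; lra.
apply: ge0_subset_integral => //.
- by measurable_tac.
- move=> t _; rewrite lee_fin exprn_ge0// invr_ge0.
  by rewrite addr_ge0// sqr_ge0.
Qed.

Lemma kernel_coef_fin n : kernel_coef n \is a fin_num.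
Proof.
rewrite ge0_fin_numE ?kernel_coef_ge0//.
apply: (@le_lt_trans _ _ ((2 * pi)^-1%:E * pi%:E)%E); last by rewrite -EFinM ltry.
apply: lee_wpmul2l; first by rewrite lee_fin invr_ge0 mulr_ge0 ?pi_ge0.
rewrite -integral_oneDsqrV; apply: ge0_le_integral => //.
- move=> t _; rewrite lee_fin exprn_ge0// invr_ge0.
  by rewrite addr_ge0// sqr_ge0.
- by measurable_tac.
- by measurable_tac.
- move=> t _; have t2 : 0 <= t ^+ 2 by rewrite sqr_ge0.
  rewrite lee_fin exprS ger_pMr ?invr_gt0//; last lra.
  rewrite exprn_ile1 ?invr_ge0//; first lra.
  rewrite invf_le1//; lra.
Qed.

Lemma kernel_series_lt1 s : 0 <= s < 1 ->
  (\sum_(0 <= n <oo) (kernel_coef n * (s ^+ n)%:E) =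
   ((2 * Num.sqrt (1 - s))^-1)%:E)%E.
Proof.
move=> /andP[s0 s1].
transitivity ((2 * pi)^-1%:E * \int[leb]_t (1 * t ^+ 2 + 2 * 0 * t + (1 - s))^-1%:E)%E.
  transitivity ((2 * pi)^-1%:E * \sum_(0 <= n <oo)
      \int[leb]_t ((s ^+ n)%:E * ((1 + t ^+ 2)^-1 ^+ n.+1)%:E))%E.
    rewrite -nneseriesZl//; last first.
      move=> n _; apply: integral_ge0 => t _.
      rewrite mule_ge0 ?lee_fin ?exprn_ge0 ?invr_ge0//.
      by rewrite addr_ge0// sqr_ge0.
    apply: eq_eseriesr => n _; rewrite ge0_integralZl//.
    - by rewrite /kernel_coef -muleA [X in (_ * X)%E]muleC.
    - by measurable_tac.
    - move=> t _; rewrite lee_fin exprn_ge0 ?invr_ge0//.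
      by rewrite addr_ge0// sqr_ge0.
    - by rewrite lee_fin exprn_ge0.
  congr (_ * _)%E; rewrite -integral_nneseries//; last 2 first.
  - by move=> n; measurable_tac.
  - move=> n t _; rewrite mule_ge0 ?lee_fin ?exprn_ge0 ?invr_ge0//.
    by rewrite addr_ge0// sqr_ge0.
  apply: eq_integral => t _.
  have t2 : 0 <= t ^+ 2 by rewrite sqr_ge0.
  pose g := (1 + t ^+ 2)^-1.
  have g0 : 0 < g by rewrite invr_gt0; lra.
  have g1 : g <= 1 by rewrite invf_le1; lra.
  have sg : `|s * g| < 1.
    rewrite ger0_norm ?mulr_ge0// ?ltW//.
    by apply: le_lt_trans s1; rewrite ler_piMr.
  have e : (1 * t ^+ 2 + 2 * 0 * t + (1 - s))^-1 = g / (1 - s * g).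
    by rewrite /g; field; rewrite !gt_eqF//; lra.
  rewrite e; apply/cvg_lim => //.
  rewrite (_ : (fun n => _) = EFin \o series (geometric g (s * g))).
    by apply: cvg_EFin; [exact: nearW|exact: cvg_geometric_series].
  apply/funext => n; rewrite /series/= -sumEFin; apply: eq_bigr => i _.
  by rewrite -/g -EFinM exprS exprMn; congr EFin; ring.
rewrite integral_quadraticV//; last by rewrite expr0n/= mul1r subr_gt0.
rewrite expr0n/= mul1r subr0 -EFinM; congr EFin.
have q0 : Num.sqrt (1 - s) != 0 by rewrite gt_eqF// sqrtr_gt0 subr_gt0.
have : (pi : R) != 0 by rewrite gt_eqF// pi_gt0.
by move: (pi : R) => p p0; field; rewrite q0.
Qed.

(** The series dominates its values at [1 - e], which tend to infinity. *)
Lemma kernel_series1 : (\sum_(0 <= n <oo) kernel_coef n = +oo :> \bar R)%E.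
Proof.
apply/eqyP => A A0.
pose e : R := ((1 + 2 * A)^-1) ^+ 2.
have e0 : 0 < e by rewrite exprn_gt0// invr_gt0; lra.
have e1 : e <= 1.
  by rewrite exprn_ile1// ?invr_ge0 ?invf_le1; lra.
apply: (@le_trans _ _ (\sum_(0 <= n <oo) (kernel_coef n * ((1 - e) ^+ n)%:E))%E).
  rewrite kernel_series_lt1; last by apply/andP; split; lra.
  rewrite lee_fin opprB addrC subrK sqrtr_sqr ger0_norm; last by rewrite invr_ge0; lra.
  by rewrite invfM invrK; lra.
apply: lee_nneseries => n _; first by rewrite mule_ge0 ?kernel_coef_ge0// lee_fin exprn_ge0//; lra.
rewrite -[leRHS]mule1 lee_wpmul2l ?kernel_coef_ge0// lee_fin exprn_ile1//; lra.
Qed.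

Lemma coulomb_series x y : S x -> S y ->
  coulomb x y = (\sum_(0 <= n <oo) (kernel_coef n * (proximity x y ^+ n)%:E))%E.
Proof.
move=> Sx Sy; have p0 := proximity_ge0 Sx Sy; have p1 := proximity_le1 Sx Sy.
have eE : enorm (x - y) = 2 * Num.sqrt (1 - proximity x y).
  rewrite -[LHS]ger0_norm ?enorm_ge0// -sqrtr_sqr enormB_proximity//.
  rewrite sqrtrM//; congr (_ * _).
  by rewrite (_ : 4 = 2 ^+ 2) ?sqrtr_sqr ?ger0_norm//; ring.
rewrite /coulomb eE; move: p1; rewrite le_eqVlt => /predU1P[->|p1].
  rewrite subrr sqrtr0 mulr0 inve0; under eq_eseriesr do rewrite expr1n mule1.
  by rewrite kernel_series1.
rewrite kernel_series_lt1 ?p0// inver mulf_eq0 gt_eqF//= gt_eqF//.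
by rewrite sqrtr_gt0 subr_gt0.
Qed.

(** The four functions [1, x1, x2, x3] over [sqrt 2]: [proximity] is the dot
    product of their values, so its powers are sums of products of words in
    them. *)
Definition letter (j : 'I_4) x : R :=
  nth 0 [:: 1; x.1.1; x.1.2; x.2] j / Num.sqrt 2.

Definition word n (f : {ffun 'I_n -> 'I_4}) x : R := \prod_(i < n) letter (f i) x.

Lemma measurable_letter j : measurable_fun setT (letter j).
Proof.
by rewrite /letter; case: j => -[|[|[|[|//]]]] ?/=; measurable_tac.
Qed.

Lemma measurable_word n (f : {ffun 'I_n -> 'I_4}) : measurable_fun setT (word f).
Proof.
apply: measurable_prod => i _; exact: measurable_letter.
Qed.

Lemma proximity_letter x y : proximity x y = \sum_j letter j x * letter j y.
Proof.
have s2 : Num.sqrt (2 : R) ^+ 2 = 2 by rewrite sqr_sqrtr.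
have s0 : Num.sqrt (2 : R) != 0 by rewrite gt_eqF// sqrtr_gt0.
rewrite !big_ord_recr big_ord0 /letter/= /proximity /dot.
have E a b : a / Num.sqrt 2 * (b / Num.sqrt 2) = a * b / 2 :> R.
  by rewrite -[in RHS]s2; field.
by rewrite !E; ring.
Qed.

Lemma proximity_exp n x y :
  proximity x y ^+ n = \sum_(f : {ffun 'I_n -> 'I_4}) word f x * word f y.
Proof.
rewrite -[in LHS](card_ord n) -prodr_const.
under eq_bigr do rewrite proximity_letter.
rewrite bigA_distr_bigA; apply: eq_bigr => f _.
by rewrite /word -big_split.
Qed.

Lemma letter_le1 j x : S x -> `|letter j x| <= 1.
Proof.
move=> Sx; have := proximity_le1 Sx Sx.
rewrite proximity_letter (bigD1 j)//= => h.
have : letter j x ^+ 2 <= 1.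
  apply: le_trans h; rewrite expr2 lerDl; apply: sumr_ge0 => i _.
  by rewrite -expr2 sqr_ge0.
by move=> l2; rewrite ler_norml; apply/andP; split; nra.
Qed.

Lemma word_le1 n (f : {ffun 'I_n -> 'I_4}) x : S x -> `|word f x| <= 1.
Proof.
move=> Sx; rewrite normr_prod; apply: prodr_ile1 => i _.
by rewrite normr_ge0 letter_le1.
Qed.

Lemma integrable_word n (f : {ffun 'I_n -> 'I_4}) mu :
  mu.-integrable S (EFin \o word f).
Proof.
apply: measurable_bounded_integrable.
- exact: measurable_sphere.
- by rewrite (le_lt_trans (probability_le1 mu measurable_sphere))// ltry.
- by apply: measurable_funTS; exact: measurable_word.
- exists 1; split => // M M1 x /= Sx.
  by rewrite (le_trans (word_le1 f Sx))// ltW.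
Qed.

(** The moments of [mu] are enough to express all double integrals of powers of
    [proximity]. *)
Definition moment mu n (f : {ffun 'I_n -> 'I_4}) : R :=
  (\int[mu]_(x in S) word f x)%R.

Lemma momentE mu n (f : {ffun 'I_n -> 'I_4}) :
  (\int[mu]_(x in S) (word f x)%:E = (moment mu f)%:E)%E.
Proof.
rewrite fineK//; apply: integrable_fin_num; last exact: integrable_word.
exact: measurable_sphere.
Qed.

(** The potential of [mu] for the kernel [proximity ^+ n], a polynomial in [x]; see
    [integral_proximity_exp]. *)
Definition power_potential mu n x : R :=
  \sum_(f : {ffun 'I_n -> 'I_4}) word f x * moment mu f.

Lemma integral_proximity_exp mu n x :
  (\int[mu]_(y in S) (proximity x y ^+ n)%:E = (power_potential mu n x)%:E)%E.
Proof.
under eq_integral do rewrite proximity_exp -sumEFin.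
rewrite integral_sum; last 2 first.
- exact: measurable_sphere.
- move=> f; under eq_fun do rewrite EFinM.
  by apply: integrableZl; [exact: measurable_sphere|exact: integrable_word].
rewrite -sumEFin; apply: eq_bigr => f _.
under eq_integral do rewrite EFinM.
rewrite integralZl; [|exact: measurable_sphere|exact: integrable_word].
by rewrite momentE EFinM.
Qed.

Lemma integral_power_potential mu nu n :
  (\int[mu]_(x in S) (power_potential nu n x)%:E =
   (\sum_(f : {ffun 'I_n -> 'I_4}) moment mu f * moment nu f)%:E)%E.
Proof.
under eq_integral do rewrite /power_potential -sumEFin.
rewrite integral_sum; last 2 first.
- exact: measurable_sphere.
- move=> f; under eq_fun do rewrite mulrC EFinM.
  by apply: integrableZl; [exact: measurable_sphere|exact: integrable_word].
rewrite -sumEFin; apply: eq_bigr => f _.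
under eq_integral do rewrite mulrC EFinM.
rewrite integralZl; [|exact: measurable_sphere|exact: integrable_word].
by rewrite momentE -EFinM mulrC.
Qed.

Lemma power_potential_ge0 mu n x : S x -> 0 <= power_potential mu n x.
Proof.
move=> Sx; rewrite -lee_fin -integral_proximity_exp.
by apply: integral_ge0 => y Sy; rewrite lee_fin exprn_ge0// proximity_ge0.
Qed.

Lemma measurable_power_potential mu n : measurable_fun setT (power_potential mu n).
Proof.
apply: measurable_sum => f; apply: measurable_funM => //.
exact: measurable_word.
Qed.

Definition mutual_energy mu nu : \bar R :=
  (\int[mu]_(x in S) \int[nu]_(y in S) coulomb x y)%E.

Lemma potential_series nu x : S x ->
  (\int[nu]_(y in S) coulomb x y =
   \sum_(0 <= n <oo) (kernel_coef n * (power_potential nu n x)%:E))%E.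
Proof.
move=> Sx.
transitivity (\int[nu]_(y in S) \sum_(0 <= n <oo)
    (kernel_coef n * (proximity x y ^+ n)%:E))%E.
  by apply: eq_integral => y /[!inE] Sy; exact: coulomb_series.
rewrite integral_nneseries; last 3 first.
- exact: measurable_sphere.
- move=> n; apply: measurable_funTS; apply: emeasurable_funM => //.
  apply/measurable_EFinP; apply: measurable_funX; exact: measurable_proximity.
- by move=> n y Sy; rewrite mule_ge0 ?kernel_coef_ge0// lee_fin exprn_ge0// proximity_ge0.
apply: eq_eseriesr => n _; rewrite ge0_integralZl//; last 4 first.
- exact: measurable_sphere.
- apply: measurable_funTS; apply/measurable_EFinP; apply: measurable_funX.
  exact: measurable_proximity.
- by move=> y Sy; rewrite lee_fin exprn_ge0// proximity_ge0.
- exact: kernel_coef_ge0.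
by rewrite integral_proximity_exp.
Qed.

Lemma mutual_energy_series mu nu :
  mutual_energy mu nu = (\sum_(0 <= n <oo) (kernel_coef n *
    (\sum_(f : {ffun 'I_n -> 'I_4}) moment mu f * moment nu f)%:E))%E.
Proof.
transitivity (\int[mu]_(x in S) \sum_(0 <= n <oo)
    (kernel_coef n * (power_potential nu n x)%:E))%E.
  by apply: eq_integral => x /[!inE] Sx; exact: potential_series.
rewrite integral_nneseries; last 3 first.
- exact: measurable_sphere.
- move=> n; apply: measurable_funTS; apply: emeasurable_funM => //.
  by apply/measurable_EFinP; exact: measurable_power_potential.
- by move=> n x Sx; rewrite mule_ge0 ?kernel_coef_ge0// lee_fin power_potential_ge0.
apply: eq_eseriesr => n _; rewrite ge0_integralZl//; last 4 first.
- exact: measurable_sphere.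
- by apply: measurable_funTS; apply/measurable_EFinP; exact: measurable_power_potential.
- by move=> x Sx; rewrite lee_fin power_potential_ge0.
- exact: kernel_coef_ge0.
by rewrite integral_power_potential.
Qed.

(** The quantity [I(mu, mu) + I(nu, nu) - 2 I(mu, nu)] is a series with positive
    coefficients in the sums of [(moment mu f - moment nu f) ^ 2] over the words [f] of
    each length, so it can only fail to be positive when all moments agree.  Adding
    [2 I(mu, nu)] to this series instead of subtracting keeps all terms
    nonnegative. *)
Lemma energy_rigidity mu nu :
  (mutual_energy mu mu + mutual_energy nu nu < +oo)%E ->
  (mutual_energy mu mu + mutual_energy nu nu <= 2%:E * mutual_energy mu nu)%E ->
  forall n x, power_potential mu n x = power_potential nu n x.
Proof.
pose Q n := \sum_(f : {ffun 'I_n -> 'I_4}) (moment mu f - moment nu f) ^+ 2.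
pose P n := \sum_(f : {ffun 'I_n -> 'I_4}) moment mu f * moment nu f.
have Q0 n : 0 <= Q n by apply: sumr_ge0 => f _; exact: sqr_ge0.
have P0 n : 0 <= P n.
  rewrite -lee_fin -integral_power_potential; apply: integral_ge0 => x Sx.
  by rewrite lee_fin power_potential_ge0.
have M0 a n : 0 <= \sum_(f : {ffun 'I_n -> 'I_4}) moment a f * moment a f.
  by apply: sumr_ge0 => f _; rewrite -expr2 sqr_ge0.
have sumE : (mutual_energy mu mu + mutual_energy nu nu =
    \sum_(0 <= n <oo) (kernel_coef n * (Q n)%:E) + 2%:E * mutual_energy mu nu)%E.
  rewrite !mutual_energy_series -nneseriesZl; last first.
    by move=> n _; rewrite mule_ge0 ?kernel_coef_ge0// lee_fin P0.
  rewrite -nneseriesD; last 2 first.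
  - by move=> n _ _; rewrite mule_ge0 ?kernel_coef_ge0// lee_fin M0.
  - by move=> n _ _; rewrite mule_ge0 ?kernel_coef_ge0// lee_fin M0.
  rewrite -nneseriesD; last 2 first.
  - by move=> n _ _; rewrite mule_ge0 ?kernel_coef_ge0// lee_fin Q0.
  - by move=> n _ _; rewrite mule_ge0// mule_ge0 ?kernel_coef_ge0// lee_fin P0.
  apply: eq_eseriesr => n _.
  rewrite -(fineK (kernel_coef_fin n)) -!EFinM -!EFinD; congr EFin.
  rewrite [in RHS]mulrCA -!mulrDr; congr (_ * _).
  rewrite /Q mulr_sumr -!big_split/=; apply: eq_bigr => f _; ring.
move=> fin le.
have fin2 : (2%:E * mutual_energy mu nu)%E \is a fin_num.
  rewrite ge0_fin_numE; last first.
    rewrite mule_ge0// mutual_energy_series nneseries_ge0// => n _ _.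
    by rewrite mule_ge0 ?kernel_coef_ge0// lee_fin P0.
  apply: le_lt_trans fin; rewrite sumE leeDr// nneseries_ge0// => n _ _.
  by rewrite mule_ge0 ?kernel_coef_ge0// lee_fin Q0.
have Qle : (\sum_(0 <= n <oo) (kernel_coef n * (Q n)%:E) <= 0)%E.
  by move: le; rewrite sumE -leeBrDr// subee.
have Q00 n : Q n = 0.
  apply/le_anti; rewrite Q0 andbT -lee_fin -(@pmule_rle0 _ (kernel_coef n)); last exact: kernel_coef_gt0.
  apply: le_trans Qle; rewrite (@nneseriesD1 _ _ n)//; last first.
    by move=> k _; rewrite mule_ge0 ?kernel_coef_ge0// lee_fin Q0.
  rewrite leeDl// nneseries_ge0// => k _ _.
  by rewrite mule_ge0 ?kernel_coef_ge0// lee_fin Q0.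
move=> n x; apply: eq_bigr => f _; congr (_ * _).
have /psumr_eq0P := Q00 n; move=> /(_ _ f isT)/wrap[]; first by move=> *; exact: sqr_ge0.
by move/eqP; rewrite sqrf_eq0 subr_eq0 => /eqP.
Qed.

End PositiveDefinite.

(** * Recovering the support from the power potentials *)

Section Support.
Context {R : realType}.
Notation S := (@sphere R).
Implicit Types (x y : R3 R) (U : set (R3 R)) (mu nu : probability (R3 R) R).

Definition box x (e : R) : set (R3 R) :=
  [set y | [/\ `|x.1.1 - y.1.1| < e, `|x.1.2 - y.1.2| < e & `|x.2 - y.2| < e]].

Lemma box_ball x e : box x e = ball x e.
Proof.
apply/seteqP; split => -[[y1 y2] y3] /=.
  by case=> h1 h2 h3; split; [split|].
by case=> [[h1 h2] h3]; split.
Qed.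

Lemma measurable_box x e : measurable (box x e).
Proof.
have -> : box x e = [set y | `|x.1.1 - y.1.1| < e] `&`
    [set y | `|x.1.2 - y.1.2| < e] `&` [set y | `|x.2 - y.2| < e].
  by apply/seteqP; split => y /= => [[]|[[]]].
have key (f : R3 R -> R) : measurable_fun setT f -> measurable [set y | f y < e].
  move=> mf; have -> : [set y | f y < e] = setT `&` f @^-1` `]-oo, e[.
    by apply/seteqP; split => y /=; rewrite in_itv/=; tauto.
  exact: mf.
by apply: measurableI; [apply: measurableI|]; apply: key; measurable_tac.
Qed.

(** The Borel sets of the product topology are product-measurable: an open set
    is the union of the boxes with rational data that it contains. *)
Lemma open_measurable3 U : open U -> measurable U.
Proof.
move=> oU.
pose B (a b c e : rat) : set (R3 R) := box (ratr a, ratr b, ratr c) (ratr e).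
pose F a b c e := if `[< B a b c e `<=` U >] then B a b c e else set0.
have -> : U = \bigcup_a \bigcup_b \bigcup_c \bigcup_e F a b c e.
  apply/seteqP; split => [x Ux|x [a _ [b _ [c _ [e _]]]]]; last first.
    by rewrite /F; case: asboolP => // /(_ x).
  have /nbhs_ballP[e /= e0 xeU] : nbhs x U by exact: open_nbhs_nbhs.
  rewrite -box_ball in xeU.
  have [q q0 qe] : exists2 q : rat, 0 < ratr q :> R & ratr q < e / 2.
    have [|q] := @rat_in_itvoo R 0 (e / 2); first by rewrite divr_gt0.
    by rewrite in_itv/= => /andP[]; exists q.
  have near (t : R) : exists a : rat, `|ratr a - t| < ratr q.
    have [|a] := @rat_in_itvoo R (t - ratr q) (t + ratr q); first lra.
    rewrite in_itv/= => /andP[h1 h2]; exists a.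
    by rewrite ltr_norml; apply/andP; split; lra.
  have [a ha] := near x.1.1; have [b hb] := near x.1.2; have [c hc] := near x.2.
  exists a => //; exists b => //; exists c => //; exists q => //.
  have sub : B a b c q `<=` U.
    move=> y /= [y1 y2 y3]; apply: xeU.
    have tri (s t r : R) : `|s - t| < ratr q -> `|s - r| < ratr q -> `|t - r| < e.
      by rewrite !ltr_norml => /andP[? ?] /andP[? ?]; apply/andP; split; lra.
    by split; [exact: tri ha y1|exact: tri hb y2|exact: tri hc y3].
  by rewrite /F asboolT.
apply: bigcupT_measurable_rat => a; apply: bigcupT_measurable_rat => b.
apply: bigcupT_measurable_rat => c; apply: bigcupT_measurable_rat => e.
by rewrite /F; case: asboolP => // _; exact: measurable_box.
Qed.

Lemma continuous_coordinates :
  [/\ continuous (fun x : R3 R => x.1.1), continuous (fun x : R3 R => x.1.2)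
    & continuous (fun x : R3 R => x.2)].
Proof.
split=> x.
- by apply: continuous_comp; [exact: cvg_fst|exact: cvg_fst].
- by apply: continuous_comp; [exact: cvg_fst|exact: cvg_snd].
- exact: cvg_snd.
Qed.

Lemma continuous_dot x : continuous (dot x).
Proof.
have [c1 c2 c3] := continuous_coordinates.
move=> y; apply: cvgD; [apply: cvgD|].
- by apply: cvgM; [exact: cvg_cst|exact: c1].
- by apply: cvgM; [exact: cvg_cst|exact: c2].
- by apply: cvgM; [exact: cvg_cst|exact: c3].
Qed.

Lemma continuous_proximity x : continuous (proximity x).
Proof.
move=> y; apply: cvgM; last exact: cvg_cst.
by apply: cvgD; [exact: cvg_cst|exact: continuous_dot].
Qed.

Lemma continuous_enorm : continuous (@enorm R).
Proof.
have [c1 c2 c3] := continuous_coordinates.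
move=> y; apply: continuous_comp; last exact: sqrt_continuous.
apply: cvgD; [apply: cvgD|].
- by apply: cvgM; exact: c1.
- by apply: cvgM; exact: c2.
- by apply: cvgM; exact: c3.
Qed.

Lemma closed_sphere : closed S.
Proof.
have -> : S = @enorm R @^-1` [set 1] by [].
by apply: closed_comp; [move=> x _; exact: continuous_enorm|exact: closed_eq].
Qed.

Lemma probability_setC0 mu (A : set (R3 R)) :
  measurable A -> mu A = 1%E -> mu (~` A) = 0%E.
Proof. by move=> mA muA; rewrite probability_setC// muA subee. Qed.

Lemma msupport_sphere mu : on_sphere mu -> msupport mu `<=` S.
Proof.
move=> muS x xm; apply/not_notP => Sx.
have := xm (~` S) (closed_openC closed_sphere) Sx.
by rewrite probability_setC0 ?ltxx//; exact: measurable_sphere.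
Qed.

Lemma coordinate_le_enorm x :
  [/\ `|x.1.1| <= enorm x, `|x.1.2| <= enorm x & `|x.2| <= enorm x].
Proof.
have a := sqr_ge0 x.1.1; have b := sqr_ge0 x.1.2; have c := sqr_ge0 x.2.
by split; rewrite -sqrtr_sqr ler_sqrt ?addr_ge0//; lra.
Qed.

(** A point outside of the box is at distance at least [e] from [x]. *)
Lemma box_proximity x y e : S x -> S y -> 0 < e -> ~ box x e y ->
  proximity x y <= 1 - e ^+ 2 / 4.
Proof.
move=> Sx Sy e0 nb.
have ee : e <= enorm (x - y).
  rewrite leNgt; apply/negP => lee; apply: nb.
  by have [h1 h2 h3] := coordinate_le_enorm (x - y); split; exact: le_lt_trans lee.
have : e ^+ 2 <= enorm (x - y) ^+ 2 by rewrite ler_pXn2r// ?nnegrE ?enorm_ge0// ltW.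
by rewrite enormB_proximity//; lra.
Qed.

(** The powers of [proximity x] peak at [x], so a point [x] of the sphere is in
    the support exactly when their integrals do not decay geometrically. *)
Lemma msupport_power_potential mu nu : on_sphere mu -> on_sphere nu ->
  (forall n x, power_potential mu n x = power_potential nu n x) ->
  msupport mu `<=` msupport nu.
Proof.
move=> muS nuS munu x xmu U oU Ux.
have Sx : S x := msupport_sphere muS xmu.
have mS := @measurable_sphere R.
rewrite lt_neqAle measure_ge0 andbT eq_sym; apply/eqP => nuU.
have /nbhs_ballP[e0 /= e00 xeU] : nbhs x U by exact: open_nbhs_nbhs.
pose e := Num.min e0 1.
have ep : 0 < e by rewrite lt_min e00/=.
have e1 : e <= 1 by rewrite ge_min lexx orbT.
have beU : box x e `<=` U.
  apply: subset_trans xeU; rewrite box_ball; apply: le_ball.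
  by rewrite ge_min lexx.
pose r := 1 - e ^+ 2 / 4; pose r' := 1 - e ^+ 2 / 8.
have e2 : 0 < e ^+ 2 by rewrite exprn_gt0.
have e2' : e ^+ 2 <= 1 by rewrite expr_le1// ltW.
have r0 : 0 < r by rewrite /r; lra.
have r'0 : 0 < r' by rewrite /r'; lra.
have rr' : r < r' by rewrite /r /r'; lra.
have mU := open_measurable3 oU.
(* outside of U the powers are at most r ^ n, and U is null *)
have nu_le n : power_potential nu n x <= r ^+ n.
  rewrite -lee_fin -integral_proximity_exp.
  have mp : measurable_fun setT (fun y => (proximity x y ^+ n)%:E).
    by apply/measurable_EFinP; apply: measurable_funX; exact: measurable_proximity.
  rewrite (@ge0_negligible_integral _ _ _ nu S U)//; last 2 first.
    exact: measurable_funTS.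
    by move=> y Sy; rewrite lee_fin exprn_ge0// proximity_ge0.
  apply: (@le_trans _ _ (\int[nu]_(y in S `\` U) (r ^+ n)%:E)%E).
    apply: ge0_le_integral => //.
    - exact: measurableD.
    - by move=> y [Sy _]; rewrite lee_fin exprn_ge0// proximity_ge0.
    - exact: measurable_funTS.
    - move=> y [Sy Uy]; rewrite lee_fin; apply: lerXn2r.
      + by rewrite nnegrE proximity_ge0.
      + by rewrite nnegrE ltW.
      + by apply: box_proximity => // /beU.
  rewrite integral_cst//; last exact: measurableD.
  rewrite -[leRHS]mule1; apply: lee_wpmul2l; first by rewrite lee_fin exprn_ge0// ltW.
  by apply: probability_le1; exact: measurableD.
(* the powers are at least r' ^ n on the neighbourhood V of x *)
pose V := proximity x @^-1` [set t | r' < t].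
have oV : open V.
  by apply: open_comp; [move=> y _; exact: continuous_proximity|exact: open_gt].
have Vx : V x.
  move/sphereE: Sx => xx; rewrite /V/= /proximity xx /r'; lra.
have mV := open_measurable3 oV.
have muV := xmu V oV Vx.
have muVS : mu (S `&` V) = mu V.
  rewrite -[in RHS](setTI V) -(setUv S) setIUl measureU; last 3 first.
  - exact: measurableI.
  - by apply: measurableI => //; exact: measurableC.
  - by rewrite -setICA setICA setIACA setICr set0I.
  rewrite [X in (_ + X)%E](_ : _ = 0%E) ?adde0//.
  apply: (@subset_measure0 _ _ _ _ _ (~` S)) => //.
  - by apply: measurableI => //; exact: measurableC.
  - exact: measurableC.
  - exact: probability_setC0.
have mu_ge n : ((r' ^+ n)%:E * mu V <= (r ^+ n)%:E)%E.
  apply: (@le_trans _ _ (power_potential mu n x)%:E); last by rewrite munu lee_fin.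
  rewrite -integral_proximity_exp -muVS -integral_cst; last exact: measurableI.
  have mp : measurable_fun setT (fun y => (proximity x y ^+ n)%:E).
    by apply/measurable_EFinP; apply: measurable_funX; exact: measurable_proximity.
  apply: (@le_trans _ _ (\int[mu]_(y in S `&` V) (proximity x y ^+ n)%:E)%E).
    apply: ge0_le_integral => //.
    - exact: measurableI.
    - by move=> y _; rewrite lee_fin exprn_ge0// ltW.
    - exact: measurable_funTS.
    - move=> y [Sy Vy]; rewrite lee_fin; apply: lerXn2r.
      + by rewrite nnegrE ltW.
      + by rewrite nnegrE proximity_ge0.
      + exact: ltW.
  apply: ge0_subset_integral => //.
  - exact: measurableI.
  - exact: measurable_funTS.
  - by move=> y Sy; rewrite lee_fin exprn_ge0// proximity_ge0.
have mufin : mu V \is a fin_num by exact: fin_num_measure.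
pose m := fine (mu V).
have m0 : 0 < m by rewrite -lte_fin fineK.
pose k := r / r'.
have k0 : 0 < k by rewrite divr_gt0.
have k1 : k < 1 by rewrite ltr_pdivrMr// mul1r.
have mk n : m <= k ^+ n.
  have := mu_ge n; rewrite -(fineK mufin) -EFinM lee_fin.
  by rewrite expr_div_n ler_pdivlMr ?exprn_gt0// mulrC.
have : k ^+ n @[n --> \oo] --> (0 : R) by apply: cvg_expr; rewrite gtr0_norm.
move/cvgr_lt => /(_ _ m0)[N _ /(_ N (leqnn N))] /=.
by rewrite ltNge mk.
Qed.

End Support.

(** * The weight of the equilibrium density *)

Section CapWeight.
Context {R : realType}.
Notation leb := (@lebesgue_measure R).
Notation R2 := (measurableTypeR R * measurableTypeR R)%type.
Variables (q u v c a : R).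
Hypotheses (q0 : 0 < q) (u0 : 0 < u) (vu : v ^+ 2 < u ^+ 2) (c0 : 0 < c).
Hypothesis aE : a * (u ^+ 2 + v ^+ 2 * c ^+ 2) = q * u * (1 + c ^+ 2).
Implicit Types (s t z : R).

(** The value that [weight_tail] must take for the potential of [disk_mixture] and the
    field of the charge to add up to the constant [a] along every line at squared
    distance [s] from the origin; [u] and [v] stand for [1 + h] and [1 - h]. *)
Definition edge_profile s : R :=
  2 / pi ^+ 2 * (a / (1 + s) - q * u / (u ^+ 2 + v ^+ 2 * s)).

(** Minus the derivative of [edge_profile]. *)
Definition edge_slope s : R :=
  2 / pi ^+ 2 * (a / (1 + s) ^+ 2 - q * u * v ^+ 2 / (u ^+ 2 + v ^+ 2 * s) ^+ 2).

Definition cap_weight s : R := if 0 < s < c ^+ 2 then edge_slope s else 0.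

(** The primitive of [edge_profile (z ^+ 2) / (1 + z ^+ 2)] that vanishes at [0]. *)
Definition profile_primitive z : R :=
  2 / pi ^+ 2 * (a / 2 * (atan z + z / (1 + z ^+ 2))
    - q * u / (u ^+ 2 - v ^+ 2) * (atan z - v / u * atan (v / u * z))).

Let uv0 s : 0 <= s -> 0 < u ^+ 2 + v ^+ 2 * s.
Proof. by move=> s0; rewrite ltr_pwDl ?exprn_gt0// mulr_ge0// sqr_ge0. Qed.

Let s1 s : 0 <= s -> 0 < 1 + s.
Proof. by move=> s0; rewrite ltr_pwDl. Qed.

Let pi2_gt0 : 0 < 2 / (pi : R) ^+ 2.
Proof. by rewrite divr_gt0// exprn_gt0// pi_gt0. Qed.

Let a0 : 0 < a.
Proof.
have h : 0 < a * (u ^+ 2 + v ^+ 2 * c ^+ 2).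
  by rewrite aE !mulr_gt0// s1// sqr_ge0.
by move: h; rewrite pmulr_lgt0// uv0// sqr_ge0.
Qed.

(** The hypothesis [aE] on the level [a] is what makes [edge_profile] vanish at
    [c ^+ 2]; it is positive before and negative after, because
    [(1 + s) / (u^2 + v^2 s)] increases with [s] when [v^2 < u^2]. *)
Lemma edge_profileE s : 0 <= s -> edge_profile s =
  2 / pi ^+ 2 * (q * u * (u ^+ 2 - v ^+ 2) * (c ^+ 2 - s) /
    ((u ^+ 2 + v ^+ 2 * c ^+ 2) * (u ^+ 2 + v ^+ 2 * s) * (1 + s))).
Proof.
move=> s0; congr (_ * _).
have h1 : u ^+ 2 + v ^+ 2 * c ^+ 2 != 0 by rewrite gt_eqF// uv0// sqr_ge0.
have h2 : u ^+ 2 + v ^+ 2 * s != 0 by rewrite gt_eqF// uv0.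
have h3 : 1 + s != 0 by rewrite gt_eqF// s1.
have -> : a = q * u * (1 + c ^+ 2) / (u ^+ 2 + v ^+ 2 * c ^+ 2).
  by rewrite -aE mulfK.
by field; rewrite exprMn h1 h2 h3.
Qed.

Lemma edge_profile_le0 s : c ^+ 2 <= s -> edge_profile s <= 0.
Proof.
move=> cs; have s0 : 0 <= s by rewrite (le_trans _ cs)// sqr_ge0.
have d0 : 0 < (u ^+ 2 + v ^+ 2 * c ^+ 2) * (u ^+ 2 + v ^+ 2 * s) * (1 + s).
  by rewrite !mulr_gt0// ?uv0// ?s1// sqr_ge0.
rewrite edge_profileE// pmulr_rle0//.
apply: mulr_le0_ge0; last by rewrite invr_ge0 ltW.
apply: mulr_ge0_le0; last by rewrite subr_le0.
by rewrite !mulr_ge0// ?subr_ge0 ltW.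
Qed.

Lemma edge_profile_gt0 s : 0 <= s < c ^+ 2 -> 0 < edge_profile s.
Proof.
move=> /andP[s0 sc]; rewrite edge_profileE// mulr_gt0// divr_gt0//.
  by rewrite !mulr_gt0// subr_gt0.
by rewrite !mulr_gt0// ?uv0// ?s1// sqr_ge0.
Qed.

(** The first term of [edge_slope] is that of [edge_profile] times [1 / (1 + s)], and the
    second is that of [edge_profile] times [v^2 / (u^2 + v^2 s)], which is smaller. *)
Lemma edge_slope_ge0 s : 0 < s < c ^+ 2 -> 0 <= edge_slope s.
Proof.
move=> /andP[s0 sc].
have /edge_profile_gt0 : 0 <= s < c ^+ 2 by rewrite ltW.
have h1 := uv0 (ltW s0); have h2 := s1 (ltW s0).
rewrite /edge_profile pmulr_rgt0// subr_gt0 => lt.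
rewrite /edge_slope mulr_ge0 ?(ltW pi2_gt0)// subr_ge0.
have -> : q * u * v ^+ 2 / (u ^+ 2 + v ^+ 2 * s) ^+ 2 =
    (q * u / (u ^+ 2 + v ^+ 2 * s)) * (v ^+ 2 / (u ^+ 2 + v ^+ 2 * s)).
  by field; rewrite gt_eqF.
have -> : a / (1 + s) ^+ 2 = (a / (1 + s)) * (1 + s)^-1 by field; rewrite gt_eqF.
apply: ler_pM => //.
- by rewrite divr_ge0// ?mulr_ge0// ltW.
- by rewrite divr_ge0 ?sqr_ge0// ltW.
- exact: ltW.
- rewrite ler_pdivrMr// mulrC ler_pdivlMr// mulrDr mulr1 lerD2r.
  exact: ltW.
Qed.

Lemma cap_weight_ge0 s : 0 <= cap_weight s.
Proof. by rewrite /cap_weight; case: ifPn => // /edge_slope_ge0. Qed.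

Lemma measurable_cap_weight : measurable_fun setT cap_weight.
Proof.
apply: measurable_fun_ifT => //; last by rewrite /edge_slope; measurable_tac.
by apply: measurable_and; apply: measurable_fun_ltr.
Qed.

Let is_derive_ratio k (m n : R) s : m + n * s != 0 ->
  is_derive s 1 (fun s => k / (m + n * s) : R) (- (k * n) / (m + n * s) ^+ 2).
Proof.
move=> h.
have d : is_derive s 1 (fun s => m + n * s) n.
  apply: eq_is_derive1 (is_deriveD (is_derive_cst m s 1)
    (is_deriveZ n (is_derive_id s 1))) _ _ => //.
  by rewrite /GRing.scale/= mulr1 add0r.
have dV := @is_deriveV R (fun s => m + n * s) s _ _ h d.
apply: eq_is_derive1 (is_deriveZ k dV) _ _ => //.
by rewrite /GRing.scale/=; field.
Qed.

Lemma is_derive_edge_profile s : 0 <= s ->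
  is_derive s 1 edge_profile (- edge_slope s).
Proof.
move=> s0; have h1 : 1 + 1 * s != 0 by rewrite mul1r gt_eqF// s1.
have h2 : u ^+ 2 + v ^+ 2 * s != 0 by rewrite gt_eqF// uv0.
apply: eq_is_derive1 (is_deriveZ (2 / pi ^+ 2)
  (is_deriveB (is_derive_ratio a h1) (is_derive_ratio (q * u) h2))) _ _.
  move=> t; have e : 1 + t = 1 + 1 * t by rewrite mul1r.
  by rewrite /edge_profile e.
rewrite /GRing.scale /edge_slope mul1r -[RHS]mulrN; congr (_ * _); ring.
Qed.

Lemma continuous_edge_slope s : 0 <= s -> {for s, continuous edge_slope}.
Proof.
move=> s0; have h1 : 1 + s != 0 by rewrite gt_eqF// s1.
have h2 : u ^+ 2 + v ^+ 2 * s != 0 by rewrite gt_eqF// uv0.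
apply: cvgM; first exact: cvg_cst.
apply: cvgB; apply: cvgM; [exact: cvg_cst| |exact: cvg_cst|].
  apply: cvgV; first by rewrite expf_neq0.
  have d : (fun t : R => 1 + t) x @[x --> s] --> 1 + s.
    by apply: cvgD; [exact: cvg_cst|exact: cvg_id].
  by apply: cvgM.
apply: cvgV; first by rewrite expf_neq0.
have d : (fun t : R => u ^+ 2 + v ^+ 2 * t) x @[x --> s] --> u ^+ 2 + v ^+ 2 * s.
  apply: cvgD; first exact: cvg_cst.
  by apply: cvgM; [exact: cvg_cst|exact: cvg_id].
by apply: cvgM.
Qed.

Lemma edge_profile_edge : edge_profile (c ^+ 2) = 0.
Proof. by rewrite edge_profileE ?sqr_ge0// subrr mulr0 mul0r mulr0. Qed.

Let continuous_profile s : 0 <= s -> {for s, continuous edge_profile}.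
Proof.
move=> s0; apply: differentiable_continuous; apply/derivable1_diffP.
by have [] := is_derive_edge_profile s0.
Qed.

Lemma weight_tail_cap s : 0 <= s < c ^+ 2 ->
  weight_tail cap_weight s = (edge_profile s)%:E.
Proof.
move=> /andP[s0 sc].
transitivity (\int[leb]_(t in `]s, (c ^+ 2)%R[) (edge_slope t)%:E)%E.
  rewrite /weight_tail [LHS]integral_mkcond [RHS]integral_mkcond.
  apply: eq_integral => t _; rewrite !patchE !mem_setE !in_itv/= andbT.
  case: ltP => //= st; rewrite /cap_weight (le_lt_trans s0 st)/=.
  by case: ltP.
transitivity ((- edge_profile (c ^+ 2) - - edge_profile s)%:E); last first.
  by rewrite edge_profile_edge oppr0 add0r opprK.
have dF t : s < t < c ^+ 2 -> is_derive t 1 (fun t => - edge_profile t) (edge_slope t).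
  move=> /andP[st tc].
  have t0 : 0 <= t by rewrite (le_trans s0)// ltW.
  by apply: eq_is_derive1 (is_deriveN (is_derive_edge_profile t0)) _ _ => //; rewrite opprK.
apply: (@ge0_FTC_itvoo R edge_slope (fun t => - edge_profile t) s (c ^+ 2) sc _ _ dF).
- by move=> t /andP[st tc]; rewrite edge_slope_ge0// tc (le_lt_trans s0 st).
- by move=> t /andP[st tc]; apply: continuous_edge_slope; rewrite (le_trans s0)// ltW.
- by apply: cvgN; exact: continuous_profile.
- by apply: cvgN; apply: continuous_profile; exact: sqr_ge0.
Qed.

Lemma weight_tail_out s : c ^+ 2 <= s -> weight_tail cap_weight s = 0%E.
Proof.
move=> cs; apply: integral0_eq => t /=; rewrite in_itv/= andbT => st.
by rewrite /cap_weight [t < _]ltNge (ltW (le_lt_trans cs st)) andbF.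
Qed.

(** Beyond the edge the tail is zero and the profile is nonpositive; this gives the
    inequality between potentials outside of the cap. *)
Lemma weight_tail_ge_profile s : 0 <= s ->
  ((edge_profile s)%:E <= weight_tail cap_weight s)%E.
Proof.
move=> s0; have [cs|sc] := leP (c ^+ 2) s.
  by rewrite weight_tail_out// lee_fin edge_profile_le0.
by rewrite weight_tail_cap// s0.
Qed.

Lemma weight_tail_profile s : 0 <= s <= c ^+ 2 ->
  weight_tail cap_weight s = (edge_profile s)%:E.
Proof.
move=> /andP[s0]; rewrite le_eqVlt => /predU1P[->|sc].
  by rewrite weight_tail_out// edge_profile_edge.
by rewrite weight_tail_cap// s0.
Qed.

Lemma is_derive_profile_primitive z :
  is_derive z 1 profile_primitive (edge_profile (z ^+ 2) / (1 + z ^+ 2)).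
Proof.
have z2 := sqr_ge0 z.
have h1 : 1 + z ^+ 2 != 0 by rewrite gt_eqF// s1.
have h2 : u ^+ 2 + v ^+ 2 * z ^+ 2 != 0 by rewrite gt_eqF// uv0.
have h3 : u != 0 by rewrite gt_eqF.
have h4 : u ^+ 2 - v ^+ 2 != 0 by rewrite gt_eqF// subr_gt0.
have dX : is_derive z 1 (fun z : R => 1 + z ^+ 2) (2 * z).
  by apply: is_derive_eq; rewrite scaler1 /GRing.scale/=; ring.
have dV := @is_deriveV R (fun z : R => 1 + z ^+ 2) z _ _ h1 dX.
have dr := is_deriveM (is_derive_id z 1) dV.
have dk := is_deriveZ (v / u) (is_derive_id z 1).
have dak := @is_derive1_comp R atan _ z _ _ (is_derive1_atan _) dk.
have da := is_derive1_atan z.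
apply: eq_is_derive1 (is_deriveZ (2 / pi ^+ 2)
  (is_deriveB (is_deriveZ (a / 2) (is_deriveD da dr))
    (is_deriveZ (q * u / (u ^+ 2 - v ^+ 2))
       (is_deriveB da (is_deriveZ (v / u) dak))))) _ _ => //.
rewrite /GRing.scale/= /GRing.scale/= /edge_profile -[RHS]mulrA; congr (_ * _).
have -> : 1 + (v / u * z) ^+ 2 = (u ^+ 2 + v ^+ 2 * z ^+ 2) / u ^+ 2 by field.
by field; rewrite exprMn h1 h2 h3 h4.
Qed.

(** Integration by parts: the weight is minus the derivative of the profile, the
    boundary terms vanish, and [atan (sqrt s)] contributes [ds / (2 sqrt s (1 + s))], which
    is [dz / (1 + z^2)] for [z = sqrt s]. *)
Lemma integral_cap_weight_atan :
  (\int[leb]_s (cap_weight s * (2 * pi * atan (Num.sqrt s)))%:E =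
   (2 * pi * profile_primitive c)%:E)%E.
Proof.
have c2 : 0 < c ^+ 2 by rewrite exprn_gt0.
pose f s := edge_slope s * (2 * pi * atan (Num.sqrt s)).
pose F s := 2 * pi * (profile_primitive (Num.sqrt s) -
  edge_profile s * atan (Num.sqrt s)).
transitivity (\int[leb]_(s in `]0%R, (c ^+ 2)%R[) (f s)%:E)%E.
  rewrite [RHS]integral_mkcond.
  apply: eq_integral => s _; rewrite !patchE !mem_setE !in_itv/= /cap_weight.
  by case: ifPn => // _; rewrite mul0r.
have csq : continuous (@Num.sqrt R) by exact: sqrt_continuous.
have cp : continuous profile_primitive.
  move=> z; apply: differentiable_continuous; apply/derivable1_diffP.
  by have [] := is_derive_profile_primitive z.
have cF s : 0 <= s -> {for s, continuous F}.
  move=> s0; apply: cvgM; first exact: cvg_cst.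
  apply: cvgB; first by apply: continuous_comp; [exact: csq|exact: cp].
  apply: cvgM; first exact: continuous_profile.
  by apply: continuous_comp; [exact: csq|exact: continuous_atan].
transitivity ((F (c ^+ 2) - F 0)%:E); last first.
  congr EFin; rewrite /F edge_profile_edge mul0r subr0 sqrtr0 atan0 mulr0 subr0.
  rewrite [profile_primitive 0]/profile_primitive mulr0 atan0 mulr0 mul0r.
  by rewrite subr0 addr0 !mulr0 subr0 mulr0 mulr0 subr0 sqrtr_sqr gtr0_norm.
have dF s : 0 < s < c ^+ 2 -> is_derive s 1 F (f s).
  move=> /andP[s0 sc].
  have z0 : 0 < Num.sqrt s by rewrite sqrtr_gt0.
  have dq := is_derive1_sqrt s0.
  have d1 := is_derive1_comp (is_derive_profile_primitive (Num.sqrt s)) dq.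
  have d2 := is_derive1_comp (is_derive1_atan (Num.sqrt s)) dq.
  have d3 := is_deriveM (is_derive_edge_profile (ltW s0)) d2.
  apply: eq_is_derive1 (is_deriveZ (2 * pi) (is_deriveB d1 d3)) _ _ => //.
  rewrite /GRing.scale/= sqr_sqrtr ?(ltW s0)// /f.
  have h1 : 1 + s != 0 by rewrite gt_eqF// s1// ltW.
  have h2 : Num.sqrt s != 0 by rewrite gt_eqF.
  by field; rewrite h1 h2.
apply: (@ge0_FTC_itvoo R f F 0 (c ^+ 2) c2 _ _ dF).
- move=> s /andP[s0 sc]; rewrite /f mulr_ge0 ?edge_slope_ge0 ?s0//.
  rewrite !mulr_ge0 ?pi_ge0//.
  by rewrite -atan0 le_atan// sqrtr_ge0.
- move=> s /andP[s0 sc]; apply: cvgM; first exact/continuous_edge_slope/ltW.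
  apply: cvgM; first exact: cvg_cst.
  by apply: continuous_comp; [exact: csq|exact: continuous_atan].
- exact: cF.
- exact/cF/ltW.
Qed.

End CapWeight.

(** * Image of a measure with a density *)

Section ImageDensity.
Context d d' (X : measurableType d) (Y : measurableType d') (R : realType).
Local Open Scope ereal_scope.
Import HBNNSimple.

(** The change of variables goes through simple functions because the density may
    be infinite. *)
Lemma image_density (m : {measure set X -> \bar R}) (g : X -> \bar R)
    (phi : X -> Y) :
  measurable_fun setT g -> (forall x, 0 <= g x) -> measurable_fun setT phi ->
  \int[m]_x g x = 1 ->
  exists P : probability Y R, forall f : Y -> \bar R,
    measurable_fun setT f -> (forall y, 0 <= f y) ->
    \int[P]_y f y = \int[m]_x (f (phi x) * g x).
Proof.
move=> mg g0 mphi g1.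
pose P A := \int[m]_(x in phi @^-1` A) g x.
have mpre A : measurable A -> measurable (phi @^-1` A).
  by move=> mA; rewrite -[_ @^-1` _]setTI; exact: mphi.
have P0 : P set0 = 0 by rewrite /P preimage_set0 integral_set0.
have Pge0 A : 0 <= P A by apply: integral_ge0.
have Psig : semi_sigma_additive P.
  move=> F mF tF mUF; rewrite /P preimage_bigcup ge0_integral_bigcup//=.
  - by apply: is_cvg_ereal_nneg_natsum_cond => n _ _; exact: integral_ge0.
  - by move=> n; exact: mpre.
  - exact: measurable_funTS.
  - apply/trivIsetP => i j _ _ ij; rewrite -preimage_setI.
    by move/trivIsetP : tF => /(_ _ _ _ _ ij) ->//; rewrite preimage_set0.
have PT : P setT = 1 by rewrite /P preimage_setT.
have [Q QE] : exists Q : probability Y R, forall A, Q A = P A.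
  pose Pm : {measure set Y -> \bar R} :=
    HB.pack P (isMeasure.Build _ _ _ P P0 Pge0 Psig).
  pose Q : probability Y R :=
    HB.pack P (isMeasure.Build _ _ _ P P0 Pge0 Psig)
      (Measure_isProbability.Build _ _ _ Pm PT).
  by exists Q.
exists Q => f mf f0.
pose f_ := nnsfun_approx measurableT mf.
have fE n : \int[Q]_y (f_ n y)%:E = \int[m]_x ((f_ n (phi x))%:E * g x).
  rewrite integralT_nnsfun sintegralE.
  transitivity (\int[m]_x \sum_(r \in range (f_ n))
      ((r * \1_(f_ n @^-1` [set r]) (phi x))%:E * g x)); last first.
    apply: eq_integral => x _; rewrite [in RHS]fimfunE -fsumEFin//.
    rewrite ge0_mule_fsuml//.
    by move=> r; exact: nnfun_muleindic_ge0.
  have mI r : measurable_fun setT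
      (fun x => \1_(f_ n @^-1` [set r]) (phi x) : R).
    apply: (measurableT_comp _ mphi).
    exact: measurable_indic.
  have mind r : measurable_fun setT
      (fun x => (r * \1_(f_ n @^-1` [set r]) (phi x))%:E * g x).
    apply: emeasurable_funM => //; apply/measurable_EFinP.
    by apply: measurable_funM.
  rewrite ge0_integral_fsum//; last first.
    move=> r x _; rewrite mule_ge0//.
    exact: nnfun_muleindic_ge0.
  apply: eq_fsbigr => r; rewrite inE => -[y _ <-].
  under eq_integral do rewrite EFinM -muleA.
  rewrite ge0_integralZl//; last 3 first.
  - by apply: emeasurable_funM => //; exact/measurable_EFinP.
  - by move=> x _; rewrite mule_ge0// lee_fin.
  - by rewrite lee_fin.
  congr (_ * _); apply: (eq_trans (QE _)); rewrite [LHS]integral_mkcond.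
  apply: eq_integral => x _; rewrite patchE indicE.
  have -> : (x \in phi @^-1` (f_ n @^-1` [set f_ n y])) =
      (phi x \in f_ n @^-1` [set f_ n y]).
    by apply/idP/idP; rewrite !inE.
  by case: ifPn => _; rewrite ?mul1e ?mul0e.
transitivity (limn (fun n => \int[Q]_y (f_ n y)%:E)).
  rewrite -monotone_convergence//.
  - apply: eq_integral => y _; apply/esym/cvg_lim => //.
    by apply: cvg_nnsfun_approx.
  - by move=> n; exact/measurable_EFinP/measurable_funP.
  - by move=> n y _; rewrite lee_fin.
  - by move=> y _ i j ij; rewrite lee_fin; exact/lefP/nd_nnsfun_approx.
under eq_fun do rewrite fE.
rewrite -monotone_convergence//.
- apply: eq_integral => x _; apply/cvg_lim => //.
  have cf : (EFin \o f_ ^~ (phi x)) @ \oo --> f (phi x).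
    by apply: cvg_nnsfun_approx.
  have [gfin|ginf] := boolP (g x \is a fin_num); first exact: cvgeZr.
  have [f00|fn0] := eqVneq (f (phi x)) 0.
    have nd : nondecreasing_seq (EFin \o f_ ^~ (phi x)).
      by move=> i j ij; rewrite lee_fin; exact/lefP/nd_nnsfun_approx.
    have supE : f (phi x) = ereal_sup (range (EFin \o f_ ^~ (phi x))).
      by apply: cvg_unique cf _ => //; exact: ereal_nondecreasing_cvgn.
    have fn0 n : f_ n (phi x) = 0%R.
      have : (f_ n (phi x))%:E <= f (phi x).
        by rewrite supE; apply: ereal_sup_ubound; exists n.
      rewrite f00 lee_fin => le0.
      by apply/le_anti; rewrite le0 fun_ge0.
    rewrite f00 mul0e; under eq_fun do rewrite fn0 mul0e.
    exact: cvg_cst.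
  apply: cvgeM => //; last exact: cvg_cst.
  have := f0 (phi x); have := g0 x; move: ginf fn0.
  by case: (g x) => [r||]//; case: (f (phi x)).
- move=> n; apply: emeasurable_funM => //; apply/measurable_EFinP.
  exact: measurableT_comp.
- by move=> n x _; rewrite mule_ge0// lee_fin.
- move=> x _ i j ij; rewrite lee_wpmul2r// lee_fin.
  exact/lefP/nd_nnsfun_approx.
Qed.

End ImageDensity.

(** * Stereographic projection and the equilibrium condition *)

Section Chart.
Context {R : realType}.
Notation leb := (@lebesgue_measure R).
Notation S := (@sphere R).
Notation R2 := (measurableTypeR R * measurableTypeR R)%type.
Implicit Types (z : R2) (x y : R3 R) (s t h q : R).

Definition north : R3 R := (0, 0, 1).

(** The inverse of the stereographic projection from the north pole. *)
Definition stereo z : R3 R :=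
  (2 * z.1 / (1 + sqn z), 2 * z.2 / (1 + sqn z), (sqn z - 1) / (1 + sqn z)).

Lemma sqn1_gt0 z : 0 < 1 + sqn z.
Proof. by rewrite ltr_pwDl// sqn_ge0. Qed.

Let sqn1_neq0 z : 1 + sqn z != 0.
Proof. by rewrite gt_eqF// sqn1_gt0. Qed.

Lemma stereo_sphere z : S (stereo z).
Proof.
apply/sphereE; rewrite /dot/=; have := sqn1_neq0 z; rewrite /sqn => h.
by field.
Qed.

Lemma measurable_stereo : measurable_fun setT stereo.
Proof.
have := @measurable_sqn R => ms; rewrite /stereo.
apply: measurable_fun_pair; first apply: measurable_fun_pair.
- by measurable_tac.
- by measurable_tac.
- by measurable_tac.
Qed.

Lemma enorm_stereoB z z' : enorm (stereo z - stereo z') =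
  2 * Num.sqrt (sqn (z'.1 - z.1, z'.2 - z.2)) /
    (Num.sqrt (1 + sqn z) * Num.sqrt (1 + sqn z')).
Proof.
have h1 := sqn1_neq0 z; have h2 := sqn1_neq0 z'.
rewrite -[LHS]ger0_norm ?enorm_ge0// -sqrtr_sqr.
rewrite enormB_proximity; [|exact: stereo_sphere..].
have -> : 4 * (1 - proximity (stereo z) (stereo z')) =
    2 ^+ 2 * sqn (z'.1 - z.1, z'.2 - z.2) / ((1 + sqn z) * (1 + sqn z')).
  move: h1 h2; rewrite /proximity /dot/= /sqn/= => h1 h2.
  by field; rewrite h1 h2.
rewrite sqrtrM ?mulr_ge0 ?sqn_ge0// sqrtrM// sqrtr_sqr ger0_norm//.
rewrite sqrtrV ?mulr_ge0 ?(ltW (sqn1_gt0 _))//.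
by rewrite sqrtrM// ltW// sqn1_gt0.
Qed.

Lemma sphere_third_le1 x : S x -> -1 <= x.2 <= 1.
Proof.
move=> /sphereE; rewrite /dot => xx.
by have a := sqr_ge0 x.1.1; have b := sqr_ge0 x.1.2; apply/andP; split; nra.
Qed.

Lemma sphere_third_eq1 x : S x -> x.2 = 1 -> x = north.
Proof.
move=> /sphereE; case: x => [[x1 x2] x3]; rewrite /dot/= => xx x31; subst x3.
have a := sqr_ge0 x1; have b := sqr_ge0 x2.
have x10 : x1 = 0 by apply/eqP; rewrite -sqrf_eq0; apply/eqP; nra.
have x20 : x2 = 0 by apply/eqP; rewrite -sqrf_eq0; apply/eqP; nra.
by rewrite x10 x20.
Qed.

Lemma stereo_surj x : S x -> x <> north -> exists2 z, x = stereo z &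
  sqn z = (1 + x.2) / (1 - x.2).
Proof.
move=> Sx xN; have /andP[_ x31] := sphere_third_le1 Sx.
have x3 : 1 - x.2 != 0.
  apply/eqP => e; apply: xN; apply: sphere_third_eq1 => //.
  by apply/esym/eqP; rewrite -subr_eq0 e.
have xx := Sx; move/sphereE: xx; rewrite /dot => xx.
have x12 : x.1.1 ^+ 2 + x.1.2 ^+ 2 = (1 + x.2) * (1 - x.2).
  apply/eqP; rewrite -subr_eq0; apply/eqP.
  transitivity (x.1.1 * x.1.1 + x.1.2 * x.1.2 + x.2 * x.2 - 1); first ring.
  by rewrite xx subrr.
pose z : R2 := (x.1.1 / (1 - x.2), x.1.2 / (1 - x.2)).
have zE : sqn z = (1 + x.2) / (1 - x.2).
  by rewrite /sqn/= !expr_div_n -mulrDl x12; field.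
exists z => //; rewrite /stereo zE /z/=.
case: x {Sx xN x31 xx x12 z zE} x3 => [[x1 x2] x3]/= h.
have -> : 1 + (1 + x3) / (1 - x3) = 2 / (1 - x3) by field.
by congr ((_, _), _); field; rewrite ?h.
Qed.

Lemma enorm_stereo_charge z h : enorm (stereo z - (0, 0, h)) =
  Num.sqrt ((1 + h) ^+ 2 + (1 - h) ^+ 2 * sqn z) / Num.sqrt (1 + sqn z).
Proof.
have h1 := sqn1_neq0 z.
rewrite -sqrtrV ?(ltW (sqn1_gt0 _))// -sqrtrM; last first.
  by rewrite addr_ge0 ?sqr_ge0// mulr_ge0 ?sqr_ge0 ?sqn_ge0.
congr Num.sqrt; rewrite /=; move: h1; rewrite /sqn => h1; field.
by [].
Qed.

Lemma sqr_oneB_lt h : 0 < h -> (1 - h) ^+ 2 < (1 + h) ^+ 2.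
Proof.
move=> h0; rewrite -subr_gt0.
have -> : (1 + h) ^+ 2 - (1 - h) ^+ 2 = 4 * h by ring.
by rewrite mulr_gt0.
Qed.

Lemma measurable_coulomb x : measurable_fun setT (coulomb x).
Proof.
apply: (measurableT_comp measurable_inv_EFin).
by rewrite /enorm/=; measurable_tac.
Qed.

Lemma coulomb_ge0 x y : (0 <= coulomb x y)%E.
Proof. by rewrite inve_ge0 lee_fin enorm_ge0. Qed.

Section Equilibrium.
Variables (q h c a : R).
Hypotheses (q0 : 0 < q) (h0 : 0 < h) (c0 : 0 < c).
Hypothesis aE : a * ((1 + h) ^+ 2 + (1 - h) ^+ 2 * c ^+ 2) =
  q * (1 + h) * (1 + c ^+ 2).

Let u0 : 0 < 1 + h. Proof. by rewrite addr_gt0. Qed.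
Let vu : (1 - h) ^+ 2 < (1 + h) ^+ 2 := sqr_oneB_lt h0.
Let w := cap_weight q (1 + h) (1 - h) c a.
Let M := edge_profile q (1 + h) (1 - h) a.
Let w0 : forall s, 0 <= w s := cap_weight_ge0 q0 u0 vu aE.
Let mw : measurable_fun setT w := measurable_cap_weight q (1 + h) (1 - h) c a.

(** By [disk_mixture_potential], the planar potential at [z] of the disk mixture of
    weight [w]. *)
Definition line_potential z : \bar R :=
  (\int[leb]_t ((pi / (1 + t ^+ 2))%:E *
     weight_tail w ((z.2 - t * z.1) ^+ 2 / (1 + t ^+ 2))))%E.

Let P0 s : 0 <= s -> 0 < (1 + h) ^+ 2 + (1 - h) ^+ 2 * s.
Proof.
by move=> s0; rewrite ltr_pwDl ?exprn_gt0// mulr_ge0// sqr_ge0.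
Qed.

Let a0 : 0 < a.
Proof.
have p : 0 < a * ((1 + h) ^+ 2 + (1 - h) ^+ 2 * c ^+ 2).
  by rewrite aE !mulr_gt0// ltr_pwDl// sqr_ge0.
by move: p; rewrite pmulr_lgt0// P0// sqr_ge0.
Qed.

Let t1 t : 0 < 1 + t ^+ 2. Proof. by rewrite ltr_pwDl// sqr_ge0. Qed.

(** The squared distance from the origin to the line of slope [t] through [z]. *)
Let dist z t := (z.2 - t * z.1) ^+ 2 / (1 + t ^+ 2).

Let dist_ge0 z t : 0 <= dist z t.
Proof. by rewrite divr_ge0 ?sqr_ge0// ltW. Qed.

Let dist_le z t : dist z t <= sqn z.
Proof.
rewrite ler_pdivrMr// /sqn.
by have := sqr_ge0 (z.1 + t * z.2); nra.
Qed.

(** The constant [a] and the field of the charge are, in the plane, averages over the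
    lines through [z] as well, so the equilibrium condition can be checked line by
    line. *)
Let line_const z :
  (\int[leb]_t (pi / (1 + t ^+ 2) * (2 / pi ^+ 2 * (a / (1 + dist z t))))%:E =
   (2 * a / Num.sqrt (1 + sqn z))%:E)%E.
Proof.
have p0 : (pi : R) != 0 by rewrite gt_eqF// pi_gt0.
transitivity ((2 * a / pi)%:E * \int[leb]_t (((1 + z.1 ^+ 2) * t ^+ 2 +
    2 * (- (z.1 * z.2)) * t + (1 + z.2 ^+ 2))^-1)%:E)%E.
  rewrite -ge0_integralZl//; last 3 first.
  - by measurable_tac.
  - move=> t _; rewrite lee_fin invr_ge0.
    by have := sqr_ge0 (z.2 - t * z.1); have := sqr_ge0 t; nra.
  - by rewrite lee_fin divr_ge0 ?pi_ge0// mulr_ge0// ltW.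
  apply: eq_integral => t _; rewrite -EFinM; congr EFin.
  have d0 : 1 + t ^+ 2 + (z.2 - t * z.1) ^+ 2 != 0.
    by rewrite gt_eqF// ltr_pwDl// sqr_ge0.
  have -> : (1 + z.1 ^+ 2) * t ^+ 2 + 2 * (- (z.1 * z.2)) * t + (1 + z.2 ^+ 2) =
      1 + t ^+ 2 + (z.2 - t * z.1) ^+ 2 by ring.
  have t1' : 1 + t ^+ 2 != 0 by rewrite gt_eqF.
  have -> : 1 + dist z t = (1 + t ^+ 2 + (z.2 - t * z.1) ^+ 2) / (1 + t ^+ 2).
    by rewrite /dist; field.
  move: (pi : R) p0 => p p0; field.
  by rewrite p0 d0 t1'.
rewrite integral_quadraticV; last 2 first.
- by rewrite ltr_pwDl// sqr_ge0.
- by rewrite sqrrN; have := sqr_ge0 z.1; have := sqr_ge0 z.2; nra.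
have -> : (1 + z.1 ^+ 2) * (1 + z.2 ^+ 2) - (- (z.1 * z.2)) ^+ 2 = 1 + sqn z.
  by rewrite /sqn; ring.
rewrite -EFinM; congr EFin.
have s0 : Num.sqrt (1 + sqn z) != 0 by rewrite gt_eqF// sqrtr_gt0 sqn1_gt0.
by move: (pi : R) p0 => p p0; field; rewrite p0 s0.
Qed.

Let line_charge z :
  (\int[leb]_t (pi / (1 + t ^+ 2) * (2 / pi ^+ 2 *
      (q * (1 + h) / ((1 + h) ^+ 2 + (1 - h) ^+ 2 * dist z t))))%:E =
   (2 * q / Num.sqrt ((1 + h) ^+ 2 + (1 - h) ^+ 2 * sqn z))%:E)%E.
Proof.
have p0 : (pi : R) != 0 by rewrite gt_eqF// pi_gt0.
set u := 1 + h; set v := 1 - h.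
have u2 : 0 < u ^+ 2 by rewrite exprn_gt0.
have v2 := sqr_ge0 v.
transitivity ((2 * q * u / pi)%:E * \int[leb]_t
    (((u ^+ 2 + v ^+ 2 * z.1 ^+ 2) * t ^+ 2 +
    2 * (- (v ^+ 2 * z.1 * z.2)) * t + (u ^+ 2 + v ^+ 2 * z.2 ^+ 2))^-1)%:E)%E.
  have quadE t : (u ^+ 2 + v ^+ 2 * z.1 ^+ 2) * t ^+ 2 +
      2 * (- (v ^+ 2 * z.1 * z.2)) * t + (u ^+ 2 + v ^+ 2 * z.2 ^+ 2) =
      u ^+ 2 * (1 + t ^+ 2) + v ^+ 2 * (z.2 - t * z.1) ^+ 2 by ring.
  have d0 t : 0 < u ^+ 2 * (1 + t ^+ 2) + v ^+ 2 * (z.2 - t * z.1) ^+ 2.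
    by rewrite ltr_pwDl// ?mulr_gt0// mulr_ge0// sqr_ge0.
  rewrite -ge0_integralZl//; last 3 first.
  - by measurable_tac.
  - by move=> t _; rewrite lee_fin invr_ge0 quadE ltW.
  - by rewrite lee_fin divr_ge0 ?pi_ge0// !mulr_ge0// ltW.
  apply: eq_integral => t _; rewrite -EFinM; congr EFin.
  have d1 : u ^+ 2 * (1 + t ^+ 2) + v ^+ 2 * (z.2 - t * z.1) ^+ 2 != 0.
    by rewrite gt_eqF.
  rewrite quadE.
  have t1' : 1 + t ^+ 2 != 0 by rewrite gt_eqF.
  have -> : u ^+ 2 + v ^+ 2 * dist z t =
      (u ^+ 2 * (1 + t ^+ 2) + v ^+ 2 * (z.2 - t * z.1) ^+ 2) / (1 + t ^+ 2).
    by rewrite /dist; field.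
  move: d1; set D := u ^+ 2 * _ + _ => d1; clearbody D.
  move: (pi : R) p0 => p p0; field.
  by rewrite p0 d1 t1'.
have sz := sqn_ge0 z.
rewrite integral_quadraticV; last 2 first.
- by rewrite ltr_pwDl// mulr_ge0// sqr_ge0.
- rewrite -subr_gt0.
  have -> : (u ^+ 2 + v ^+ 2 * z.1 ^+ 2) * (u ^+ 2 + v ^+ 2 * z.2 ^+ 2) -
    (- (v ^+ 2 * z.1 * z.2)) ^+ 2 = u ^+ 2 * (u ^+ 2 + v ^+ 2 * sqn z).
    by rewrite /sqn; ring.
  by rewrite mulr_gt0// P0.
have -> : (u ^+ 2 + v ^+ 2 * z.1 ^+ 2) * (u ^+ 2 + v ^+ 2 * z.2 ^+ 2) -
    (- (v ^+ 2 * z.1 * z.2)) ^+ 2 = u ^+ 2 * (u ^+ 2 + v ^+ 2 * sqn z).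
  by rewrite /sqn; ring.
rewrite -EFinM; congr EFin.
rewrite sqrtrM ?(ltW u2)// sqrtr_sqr (gtr0_norm u0) -/u.
have s0 : Num.sqrt (u ^+ 2 + v ^+ 2 * sqn z) != 0.
  by rewrite gt_eqF// sqrtr_gt0 P0.
have u1 : u != 0 by rewrite gt_eqF.
move: s0; set r := Num.sqrt _ => s0; clearbody r.
by move: (pi : R) p0 => p p0; field; rewrite p0 s0 u1.
Qed.

Let splitE z t : pi / (1 + t ^+ 2) * (2 / pi ^+ 2 * (a / (1 + dist z t))) =
  pi / (1 + t ^+ 2) * M (dist z t) + pi / (1 + t ^+ 2) * (2 / pi ^+ 2 *
      (q * (1 + h) / ((1 + h) ^+ 2 + (1 - h) ^+ 2 * dist z t))).
Proof. by rewrite /M /edge_profile; ring. Qed.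

Let mdist z : measurable_fun setT (dist z).
Proof. by rewrite /dist; measurable_tac. Qed.

Let m1 z : measurable_fun setT (fun t : measurableTypeR R =>
  (pi / (1 + t ^+ 2) * (2 / pi ^+ 2 * (a / (1 + dist z t))))%:E).
Proof. by rewrite /dist; measurable_tac. Qed.

Let m2 z : measurable_fun setT (fun t : measurableTypeR R =>
  (pi / (1 + t ^+ 2) * (2 / pi ^+ 2 *
      (q * (1 + h) / ((1 + h) ^+ 2 + (1 - h) ^+ 2 * dist z t))))%:E).
Proof. by rewrite /dist; measurable_tac. Qed.

Let n1 z t : (0 <= (pi / (1 + t ^+ 2) * (2 / pi ^+ 2 * (a / (1 + dist z t))))%:E)%E.
Proof.
rewrite lee_fin; apply: mulr_ge0; first by rewrite divr_ge0 ?pi_ge0// ltW.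
apply: mulr_ge0; first by rewrite divr_ge0// exprn_ge0// pi_ge0.
by rewrite divr_ge0 ?(ltW a0)// addr_ge0.
Qed.

Let n2 z t : (0 <= (pi / (1 + t ^+ 2) * (2 / pi ^+ 2 *
      (q * (1 + h) / ((1 + h) ^+ 2 + (1 - h) ^+ 2 * dist z t))))%:E)%E.
Proof.
rewrite lee_fin; apply: mulr_ge0; first by rewrite divr_ge0 ?pi_ge0// ltW.
apply: mulr_ge0; first by rewrite divr_ge0// exprn_ge0// pi_ge0.
apply: divr_ge0; first by rewrite mulr_ge0// ltW.
exact/ltW/P0.
Qed.

Let mtail : measurable_fun setT (fun s : measurableTypeR R => weight_tail w s).
Proof.
pose G (p : measurableTypeR R * measurableTypeR R) : \bar R :=
  if p.1 < p.2 then (w p.2)%:E else 0%E.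
have -> : (fun s : measurableTypeR R => weight_tail w s) = fubini_F leb G.
  apply/funext => s; rewrite /weight_tail /fubini_F [LHS]integral_mkcond.
  apply: eq_integral => r _; rewrite patchE mem_setE in_itv/= andbT /G/=.
  by case: ifPn.
apply: measurable_fun_fubini_tonelli_F; last first.
  by move=> p; rewrite /G; case: ifP => // _; rewrite lee_fin.
apply: measurable_fun_ifT => //.
- by apply: measurable_fun_ltr; measurable_tac.
- by apply/measurable_EFinP; apply: (measurableT_comp mw).
Qed.

Let m3 z : measurable_fun setT (fun t : measurableTypeR R =>
  ((pi / (1 + t ^+ 2))%:E * weight_tail w (dist z t))%E).
Proof.
apply: emeasurable_funM; first by measurable_tac.
by apply: (measurableT_comp mtail); exact: mdist.
Qed.

Let n3 z t : (0 <= (pi / (1 + t ^+ 2))%:E * weight_tail w (dist z t))%E.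
Proof.
rewrite mule_ge0 ?weight_tail_ge0//.
by rewrite lee_fin divr_ge0 ?pi_ge0// ltW.
Qed.

Let line_potentialE z : line_potential z =
  (\int[leb]_t ((pi / (1 + t ^+ 2))%:E * weight_tail w (dist z t)))%E := erefl.

Lemma line_potential_ge z :
  ((2 * a / Num.sqrt (1 + sqn z))%:E <= line_potential z +
   (2 * q / Num.sqrt ((1 + h) ^+ 2 + (1 - h) ^+ 2 * sqn z))%:E)%E.
Proof.
rewrite line_potentialE -line_const -line_charge -ge0_integralD//.
apply: ge0_le_integral => //; first exact: emeasurable_funD.
move=> t _; rewrite splitE EFinD leeD2r// EFinM lee_wpmul2l//.
  by rewrite lee_fin divr_ge0 ?pi_ge0// ltW.
exact: weight_tail_ge_profile.
Qed.

Lemma line_potential_eq z : sqn z <= c ^+ 2 ->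
  ((2 * a / Num.sqrt (1 + sqn z))%:E = line_potential z +
   (2 * q / Num.sqrt ((1 + h) ^+ 2 + (1 - h) ^+ 2 * sqn z))%:E)%E.
Proof.
move=> zc; rewrite line_potentialE -line_const -line_charge -ge0_integralD//.
apply: eq_integral => t _; rewrite splitE EFinD EFinM.
rewrite weight_tail_profile// dist_ge0/=.
exact: le_trans (dist_le _ _) zc.
Qed.

End Equilibrium.

End Chart.

(** * The equilibrium measure of a cap *)

Section EquilibriumMeasure.
Context {R : realType}.
Notation leb := (@lebesgue_measure R).
Notation S := (@sphere R).
Notation R2 := (measurableTypeR R * measurableTypeR R)%type.
Implicit Types (z : R2) (x y : R3 R) (s t : R).

Definition cap_below t : set (R3 R) := [set x | S x /\ x.2 <= t].

Lemma measurable_third_ge t : measurable [set x : R3 R | t < x.2].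
Proof.
rewrite -[X in measurable X]setTI.
have := @measurable_snd _ _ (measurableTypeR R * measurableTypeR R)%type
  (measurableTypeR R).
move=> /(_ measurableT `]t, +oo[%classic (measurable_itv _)).
by congr (measurable (_ `&` _)); apply/seteqP; split => x /=;
  rewrite in_itv/= andbT.
Qed.

Lemma cap_belowE t : cap_below t = S `\` [set x : R3 R | t < x.2].
Proof.
by apply/seteqP; split => x /= [Sx]; [rewrite leNgt => /negP|
  move=> /negP; rewrite -leNgt].
Qed.

Lemma measurable_cap_below t : measurable (cap_below t).
Proof.
rewrite cap_belowE; apply: measurableD; first exact: measurable_sphere.
exact: measurable_third_ge.
Qed.

Lemma plane_fubini_tonelli (G : R2 * measurableTypeR R -> \bar R) :
  measurable_fun setT G -> (forall p, 0 <= G p)%E ->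
  (\int[leb \x leb]_z \int[leb]_s G (z, s) =
   \int[leb]_s \int[leb \x leb]_z G (z, s))%E.
Proof.
move=> mG G0.
have swapG : measurable_fun setT
    (fun p : R2 * measurableTypeR R => G ((p.1.1, p.2), p.1.2)).
  by apply: (measurableT_comp mG); measurable_tac.
rewrite (@fubini_tonelli1 _ _ _ _ R leb leb (fun z => \int[leb]_s G (z, s))%E);
  last 2 first.
- exact: (@measurable_fun_fubini_tonelli_F _ _ _ _ R leb G).
- by move=> z; exact: integral_ge0.
transitivity (\int[leb]_y1 \int[leb]_s \int[leb]_y2 G ((y1, y2), s))%E.
  apply: eq_integral => y1 _.
  rewrite -(@fubini_tonelli _ _ _ _ R leb leb (fun p => G ((y1, p.1), p.2)))//.
  by apply: (measurableT_comp mG); measurable_tac.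
rewrite (@fubini_tonelli _ _ _ _ R leb leb
  (fun p => \int[leb]_y2 G ((p.1, y2), p.2))%E); last 2 first.
- exact: (@measurable_fun_fubini_tonelli_F _ _ _ _ R leb
    (fun p : R2 * measurableTypeR R => G ((p.1.1, p.2), p.1.2))).
- by move=> z; exact: integral_ge0.
apply: eq_integral => s _.
rewrite (@fubini_tonelli1 _ _ _ _ R leb leb (fun z => G (z, s)))//.
by apply: (measurableT_comp mG); measurable_tac.
Qed.

Lemma measurable_potential (nu : probability (R3 R) R) :
  measurable_fun setT (fun x => \int[nu]_(y in S) coulomb x y)%E.
Proof.
pose G (p : R3 R * R3 R) : \bar R := if p.2 \in S then coulomb p.1 p.2 else 0%E.
have -> : (fun x => \int[nu]_(y in S) coulomb x y)%E = fubini_F nu G.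
  apply/funext => x; rewrite /fubini_F [LHS]integral_mkcond.
  by apply: eq_integral => y _; rewrite patchE /G.
apply: measurable_fun_fubini_tonelli_F; last first.
  by move=> p; rewrite /G; case: ifP => // _; exact: coulomb_ge0.
apply: measurable_fun_ifT => //.
- apply: (measurableT_comp _ measurable_snd).
  apply: (measurable_fun_bool true); rewrite setTI.
  rewrite (_ : mem S @^-1` [set true] = S); first exact: measurable_sphere.
  by apply/seteqP; split => x; [exact: set_mem|exact: mem_set].
- apply: (measurableT_comp measurable_inv_EFin).
  by rewrite /enorm/=; measurable_tac.
Qed.

Lemma measurable_field q h : measurable_fun setT (@field_of_charge R q h).
Proof.
rewrite /field_of_charge; apply: emeasurable_funM => //.
apply: (measurableT_comp measurable_inv_EFin).
by rewrite /enorm/=; measurable_tac.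
Qed.

Lemma field_ge0 q h x : 0 < q -> (0 <= field_of_charge q h x)%E.
Proof.
by move=> q0; rewrite mule_ge0 ?lee_fin ?(ltW q0)// inve_ge0 lee_fin enorm_ge0.
Qed.

Variables (q h c a : R).
Hypotheses (q0 : 0 < q) (h0 : 0 < h) (c0 : 0 < c).
Hypothesis aE : a * ((1 + h) ^+ 2 + (1 - h) ^+ 2 * c ^+ 2) =
  q * (1 + h) * (1 + c ^+ 2).
Hypothesis mass : 2 * pi * profile_primitive q (1 + h) (1 - h) a c = 1.

Let u0 : 0 < 1 + h. Proof. by rewrite addr_gt0. Qed.
Let vu : (1 - h) ^+ 2 < (1 + h) ^+ 2 := sqr_oneB_lt h0.
Let w := cap_weight q (1 + h) (1 - h) c a.
Let w0 : forall s, 0 <= w s := cap_weight_ge0 q0 u0 vu aE.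
Let mw : measurable_fun setT w := measurable_cap_weight q (1 + h) (1 - h) c a.
Let D := disk_mixture w.
Let D0 z : (0 <= D z)%E := disk_mixture_ge0 w0 z.
Let mD : measurable_fun setT D := measurable_disk_mixture mw w0.
Let g z : \bar R := ((Num.sqrt (1 + sqn z))^-1%:E * D z)%E.

Let r0 z : 0 < Num.sqrt (1 + sqn z). Proof. by rewrite sqrtr_gt0 sqn1_gt0. Qed.

Let g0 z : (0 <= g z)%E.
Proof. by rewrite mule_ge0// lee_fin invr_ge0 ltW. Qed.

Let mr : measurable_fun setT (fun z : R2 => (Num.sqrt (1 + sqn z))^-1).
Proof. by have ms := @measurable_sqn R; measurable_tac. Qed.

Let mg : measurable_fun setT g.
Proof. by apply: emeasurable_funM => //; exact/measurable_EFinP. Qed.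

Let total_mass : (\int[leb \x leb]_z g z = 1)%E.
Proof.
pose G (p : R2 * measurableTypeR R) : \bar R :=
  (w p.2 * ((Num.sqrt (1 + sqn p.1))^-1 * (Num.sqrt (p.2 - sqn p.1))^-1))%:E.
have ms := @measurable_sqn R.
have mG : measurable_fun setT G.
  apply/measurable_EFinP; apply: measurable_funM.
    by apply: (measurableT_comp mw).
  apply: measurable_funM; apply: (measurableT_comp measurable_inv);
    apply: (measurableT_comp measurable_sqrt).
    by apply: measurable_funD => //; apply: (measurableT_comp ms).
  by apply: measurable_funB => //; apply: (measurableT_comp ms).
have G0 p : (0 <= G p)%E.
  by rewrite lee_fin mulr_ge0// mulr_ge0 ?invr_ge0 ?sqrtr_ge0.
transitivity (\int[leb \x leb]_z \int[leb]_s G (z, s))%E.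
  apply: eq_integral => z _; rewrite /g /D /disk_mixture -ge0_integralZl//.
  - by apply: eq_integral => s _; rewrite /G/= -EFinM; congr EFin; ring.
  - apply/measurable_EFinP; apply: measurable_funM => //.
    by measurable_tac.
  - by move=> s _; rewrite lee_fin mulr_ge0// invr_ge0 sqrtr_ge0.
rewrite plane_fubini_tonelli//.
transitivity (\int[leb]_s (w s * (2 * pi * atan (Num.sqrt s)))%:E)%E; last first.
  by rewrite integral_cap_weight_atan// mass.
apply: eq_integral => s _; rewrite /G/=.
have [s0|s0] := ltP 0 s; last first.
  have ws : w s = 0 by rewrite /w /cap_weight ltNge s0.
  by rewrite ws mul0r; apply: integral0_eq => z _; rewrite mul0r.
under eq_integral do rewrite EFinM.
rewrite ge0_integralZl//.
- by rewrite disk_mass// EFinM.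
- apply/measurable_EFinP; apply: measurable_funM => //.
  by measurable_tac.
- by rewrite lee_fin.
Qed.

Let D_out z : c ^+ 2 < sqn z -> D z = 0%E.
Proof.
move=> cz; apply: integral0_eq => s _.
have [ws|ws] := boolP (0 < s < c ^+ 2); last first.
  by rewrite /w /cap_weight (negbTE ws) mul0r.
move: ws => /andP[_ sc]; rewrite ler0_sqrtr ?invr0 ?mulr0//.
by rewrite subr_le0 ltW// (lt_trans sc).
Qed.

(** Inside the cap the squared radii are below [c ^+ 2], so the disk densities are at
    least [c^-1]; this makes the equilibrium measure charge every open subset of the
    cap. *)
Let D_ge z s : sqn z <= s -> (c^-1%:E * weight_tail w s <= D z)%E.
Proof.
move=> zs; rewrite /D /disk_mixture /weight_tail -ge0_integralZl//; last 3 first.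
- by apply/measurable_EFinP; exact: measurable_funTS.
- by move=> r _; rewrite lee_fin.
- by rewrite lee_fin invr_ge0 ltW.
rewrite [leLHS]integral_mkcond; apply: ge0_le_integral => //.
- by move=> r _; apply: erestrict_ge0 => {}r _; rewrite -EFinM lee_fin mulr_ge0// invr_ge0 ltW.
- apply/(measurable_restrictT _ _).1 => //; apply: measurable_funTS.
  by apply: emeasurable_funM => //; exact/measurable_EFinP.
- by apply/measurable_EFinP; apply: measurable_funM => //; measurable_tac.
- move=> r _; rewrite patchE mem_setE in_itv/= andbT.
  case: ifPn => [sr|_]; last by rewrite lee_fin mulr_ge0// invr_ge0 sqrtr_ge0.
  rewrite -EFinM lee_fin mulrC.
  have [ws|ws] := boolP (0 < r < c ^+ 2); last first.
    by rewrite /w /cap_weight (negbTE ws) !mul0r.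
  apply: ler_wpM2l => //; move: ws => /andP[_ rc].
  have zr : 0 < r - sqn z by rewrite subr_gt0 (le_lt_trans zs).
  rewrite lef_pV2 ?posrE ?sqrtr_gt0//.
  rewrite -[leRHS]gtr0_norm// -sqrtr_sqr ler_wsqrtr//.
  by rewrite lerBlDr (le_trans (ltW rc))// lerDl sqn_ge0.
Qed.

Let cap := cap_below ((c ^+ 2 - 1) / (c ^+ 2 + 1)).

Let stereo_cap z : cap (stereo z) <-> sqn z <= c ^+ 2.
Proof.
have z1 := sqn1_gt0 z; have c1 : 0 < c ^+ 2 + 1 by rewrite ltr_wpDl// sqr_ge0.
rewrite /cap/=; split.
  move=> [_]; rewrite ler_pdivrMr// mulrAC ler_pdivlMr//; lra.
move=> zc; split; first exact: stereo_sphere.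
by rewrite ler_pdivrMr// mulrAC ler_pdivlMr//; lra.
Qed.

Let not_cap_north : ~ cap (@north R).
Proof.
have c1 : 0 < c ^+ 2 + 1 by rewrite ltr_wpDl// sqr_ge0.
by move=> [_]; rewrite /north/= ler_pdivlMr//; lra.
Qed.

Let continuous_stereo (z : R * R) : {for z, continuous (fun z : R * R => stereo z)}.
Proof.
have c1 : (fun z : R * R => z.1) x @[x --> z] --> z.1 by exact: cvg_fst.
have c2 : (fun z : R * R => z.2) x @[x --> z] --> z.2 by exact: cvg_snd.
have cs : (fun z : R * R => sqn z) x @[x --> z] --> sqn z.
  by apply: cvgD; apply: cvgM.
have ci : (fun z : R * R => (1 + sqn z)^-1) x @[x --> z] --> (1 + sqn z)^-1.
  apply: cvgV; first by rewrite gt_eqF// sqn1_gt0.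
  by apply: cvgD => //; exact: cvg_cst.
rewrite /prop_for/continuous_at /stereo.
apply: (@cvg_pair _ _ _ _ (nbhs (_, _)) (nbhs _)).
  apply: (@cvg_pair _ _ _ _ (nbhs _) (nbhs _)).
  - by apply: cvgM => //; apply: cvgM => //; exact: cvg_cst.
  - by apply: cvgM => //; apply: cvgM => //; exact: cvg_cst.
by apply: cvgM => //; apply: cvgB => //; exact: cvg_cst.
Qed.

(** The distance of two points of the sphere is twice the distance of their planar
    coordinates divided by the factors [sqrt (1 + |z|^2)]; one of them is compensated by
    the density [g], the other comes out of the integral. *)
Let density_potential (eta : probability (R3 R) R) :
  (forall f : R3 R -> \bar R, measurable_fun setT f -> (forall y, 0 <= f y)%E ->
    \int[eta]_y f y = \int[leb \x leb]_z (f (stereo z) * g z))%E ->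
  forall z0, (\int[eta]_(y in S) coulomb (stereo z0) y =
    (Num.sqrt (1 + sqn z0) / 2)%:E * line_potential q h c a z0)%E.
Proof.
move=> etaE z0; rewrite integral_mkcond etaE; last 2 first.
- apply/(measurable_restrictT _ _).1; first exact: measurable_sphere.
  by apply: measurable_funTS; exact: measurable_coulomb.
- by move=> y; apply: erestrict_ge0 => {}y _; exact: coulomb_ge0.
rewrite /line_potential -(disk_mixture_potential mw w0) -ge0_integralZl//; first last.
- by move=> z _; rewrite mule_ge0// inve_ge0 lee_fin sqrtr_ge0.
- apply: emeasurable_funM => //; apply: (measurableT_comp measurable_inv_EFin).
  apply: (measurableT_comp measurable_sqrt).
  by apply: (measurableT_comp (@measurable_sqn R)); measurable_tac.
apply: eq_integral => z _; rewrite patchE mem_set; last exact: stereo_sphere.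
rewrite /g /coulomb enorm_stereoB.
have a1 := r0 z0; have b1 := r0 z.
set s := Num.sqrt (sqn _); set A := Num.sqrt (1 + sqn z0) in a1 *.
set B := Num.sqrt (1 + sqn z) in b1 *.
have s0 : 0 <= s by exact: sqrtr_ge0.
have [s00|sn0] := eqVneq s 0.
  rewrite s00 mulr0 mul0r inve0 muleA gt0_mulye; last by rewrite lte_fin invr_gt0.
  rewrite [RHS]muleCA gt0_muley; last by rewrite lte_fin divr_gt0.
  by rewrite muleC.
rewrite !inver (negbTE sn0) mulf_eq0 invr_eq0 !mulf_eq0 (negbTE sn0).
rewrite (gt_eqF a1) (gt_eqF b1) pnatr_eq0/=.
rewrite [RHS]muleCA [RHS]muleC muleA -!EFinM; congr (_%:E * _)%E.
by field; rewrite sn0 !gt_eqF.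
Qed.

(** The measure is the image by [stereo] of the disk mixture of weight [w], divided by
    [sqrt (1 + |z|^2)].  Its potential and the field add up to [a] on the cap and to
    at least [a] off it, by [line_potential_eq] and [line_potential_ge]; the north pole,
    which is outside of the chart, escapes the inequality. *)
Lemma equilibrium_measure : exists eta : probability (R3 R) R,
  [/\ eta S = 1%E, eta cap = 1%E,
      (forall x, S x -> x <> @north R ->
        a%:E <= \int[eta]_(y in S) coulomb x y + field_of_charge q h x)%E,
      (forall x, cap x ->
        \int[eta]_(y in S) coulomb x y + field_of_charge q h x = a%:E)%E &
      (forall U, open U -> forall x, cap x -> U x -> 0 < eta U)%E].
Proof.
have [eta etaE] := image_density mg g0 (@measurable_stereo R) total_mass.
exists eta.
have etaA A : measurable A ->
    (eta A = \int[leb \x leb]_z ((\1_A (stereo z))%:E * g z))%E.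
  move=> mA; rewrite -(etaE (fun y => (\1_A y)%:E)).
  - by rewrite integral_indic// setIT.
  - by apply/measurable_EFinP; exact: measurable_indic.
  - by move=> y; rewrite lee_fin.
have fieldE z : field_of_charge q h (stereo z) =
    ((Num.sqrt (1 + sqn z) / 2)%:E *
      (2 * q / Num.sqrt ((1 + h) ^+ 2 + (1 - h) ^+ 2 * sqn z))%:E)%E.
  have p0 : 0 < Num.sqrt ((1 + h) ^+ 2 + (1 - h) ^+ 2 * sqn z).
    rewrite sqrtr_gt0 ltr_pwDl ?exprn_gt0// mulr_ge0 ?sqr_ge0// sqn_ge0.
    by [].
  rewrite /field_of_charge enorm_stereo_charge inver mulf_eq0 invr_eq0.
  rewrite (gt_eqF p0) (gt_eqF (r0 z))/= -!EFinM; congr EFin.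
  by field; rewrite !gt_eqF.
have kE z : ((Num.sqrt (1 + sqn z) / 2)%:E *
    (2 * a / Num.sqrt (1 + sqn z))%:E = a%:E :> \bar R)%E.
  by rewrite -EFinM; congr EFin; field; rewrite gt_eqF.
have LP0 z : (0 <= line_potential q h c a z)%E.
  apply: integral_ge0 => t _; rewrite mule_ge0 ?weight_tail_ge0//.
  by rewrite lee_fin divr_ge0 ?pi_ge0// addr_ge0// sqr_ge0.
have q1 z : (0 <= (2 * q / Num.sqrt ((1 + h) ^+ 2 + (1 - h) ^+ 2 * sqn z))%:E)%E.
  by rewrite lee_fin divr_ge0 ?sqrtr_ge0// mulr_ge0// ltW.
have sumE z : (\int[eta]_(y in S) coulomb (stereo z) y +
    field_of_charge q h (stereo z) = (Num.sqrt (1 + sqn z) / 2)%:E *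
    (line_potential q h c a z +
     (2 * q / Num.sqrt ((1 + h) ^+ 2 + (1 - h) ^+ 2 * sqn z))%:E))%E.
  rewrite [RHS](ge0_muleDr _ (LP0 z) (q1 z)) (density_potential etaE).
  by congr (_ + _)%E; exact: fieldE.
split.
- rewrite etaA; last exact: measurable_sphere.
  rewrite -[RHS]total_mass; apply: eq_integral => z _.
  by rewrite indicE mem_set ?mul1e//; exact: stereo_sphere.
- rewrite etaA; last exact: measurable_cap_below.
  rewrite -[RHS]total_mass; apply: eq_integral => z _.
  rewrite indicE; have [zc|zc] := leP (sqn z) (c ^+ 2).
    by rewrite mem_set ?mul1e//; exact/stereo_cap.
  by rewrite /g D_out// !mule0.
- move=> x Sx xN; have [z -> _] := stereo_surj Sx xN.
  rewrite sumE -(kE z); apply: lee_wpmul2l.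
    by rewrite lee_fin divr_ge0// ltW.
  exact: line_potential_ge.
- move=> x xc; have xN : x <> @north R by move=> xN; apply: not_cap_north; rewrite -xN.
  have [z xz _] := stereo_surj xc.1 xN.
  have zc : sqn z <= c ^+ 2 by apply/stereo_cap; rewrite -xz.
  rewrite xz sumE -(kE z); congr (_ * _)%E; apply/esym.
  exact: line_potential_eq.
- move=> U oU x xc Ux.
  have xN : x <> @north R by move=> xN; apply: not_cap_north; rewrite -xN.
  have [z0 xz _] := stereo_surj xc.1 xN.
  have zc : sqn z0 <= c ^+ 2 by apply/stereo_cap; rewrite -xz.
  (* move the point slightly towards the south pole, into the open cap *)
  have [z1 Uz1 z1c] : exists2 z1 : R * R, U (stereo z1) & sqn z1 < c ^+ 2.
    pose zl (l : R) : R * R := (l * z0.1, l * z0.2).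
    have zl1 : zl 1 = z0 by rewrite /zl !mul1r -surjective_pairing.
    have cz : (fun l : R => (l * z0.1, l * z0.2)) x @[x --> (1 : R)] -->
        (1 * z0.1, 1 * z0.2).
      apply: (@cvg_pair _ _ _ _ (nbhs _) (nbhs _)).
        by apply: cvgM; [exact: cvg_id|exact: cvg_cst].
      by apply: cvgM; [exact: cvg_id|exact: cvg_cst].
    have cl : (fun l => stereo (zl l)) x @[x --> (1 : R)] --> stereo (zl 1).
      apply: (@continuous_comp R (R * R)%type (R3 R) zl (fun z => stereo z) 1).
        exact: cz.
      exact: continuous_stereo.
    have /cl/nbhs_ballP[e /= e0 eU] : nbhs (stereo (zl 1)) U.
      by apply: open_nbhs_nbhs; split => //; rewrite zl1 -xz.
    pose d := Num.min e 1 / 2.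
    have d0 : 0 < d by rewrite divr_gt0// lt_min e0/=.
    have de : d < e.
      by rewrite /d ltr_pdivrMr//; have : Num.min e 1 <= e; [rewrite ge_min lexx|lra].
    have d1 : d < 1.
      by rewrite /d ltr_pdivrMr//; have : Num.min e 1 <= 1; [rewrite ge_min lexx orbT|lra].
    exists (zl (1 - d)).
      by apply: eU; rewrite /ball/= opprB addrC subrK gtr0_norm.
    have -> : sqn (zl (1 - d)) = (1 - d) ^+ 2 * sqn z0 by rewrite /sqn/=; ring.
    apply: (@le_lt_trans _ _ ((1 - d) ^+ 2 * c ^+ 2)).
      by rewrite ler_wpM2l// sqr_ge0.
    rewrite gtr_pMl ?exprn_gt0//; nra.
  pose r := (sqn z1 + c ^+ 2) / 2.
  have zr : sqn z1 < r by rewrite /r; lra.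
  have rc : r < c ^+ 2 by rewrite /r; lra.
  have rge0 : 0 <= r by rewrite ltW// (le_lt_trans _ zr)// sqn_ge0.
  have /nbhs_ballP[e /= e0 eK] : nbhs z1 [set z : R * R | U (stereo z) /\ sqn z < r].
    have n1 : nbhs z1 [set z : R * R | U (stereo z)].
      by apply: continuous_stereo; exact: open_nbhs_nbhs.
    have n2 : nbhs z1 [set z : R * R | sqn z < r].
      have cs : (fun z : R * R => sqn z) x @[x --> z1] --> sqn z1.
        by apply: cvgD; apply: cvgM; [exact: cvg_fst|exact: cvg_fst|
          exact: cvg_snd|exact: cvg_snd].
      exact: (cvgr_lt _ cs).
    exact: filterI.
  pose K : set R2 := ball z1.1 e `*` ball z1.2 e.
  have mK : measurable K by apply: measurableX; exact: measurable_ball.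
  have Kin z : K z -> U (stereo z) /\ sqn z < r.
    by move=> [k1 k2]; apply: (eK z); split.
  pose ep : \bar R := ((Num.sqrt (1 + r))^-1%:E * (c^-1%:E * weight_tail w r))%E.
  have ep0 : (0 < ep)%E.
    rewrite mule_gt0 ?lte_fin ?invr_gt0 ?sqrtr_gt0 ?ltr_pwDl//.
    rewrite mule_gt0 ?lte_fin ?invr_gt0//.
    rewrite weight_tail_cap ?rge0// lte_fin.
    by apply: (edge_profile_gt0 _ _ _ aE) => //; rewrite rge0.
  have muK : (0 < (leb \x leb) K)%E.
    rewrite product_measure1E; [|exact: measurable_ball..].
    have lb t : (0 < leb (ball t e))%E.
      by rewrite lebesgue_measure_ball ?ltW// lte_fin mulrn_wgt0.
    exact: (mule_gt0 (lb _) (lb _)).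
  rewrite etaA; last exact: open_measurable3.
  apply: (@lt_le_trans _ _ (ep * (leb \x leb) K)%E); first by rewrite mule_gt0.
  rewrite -integral_cst// integral_mkcond; apply: ge0_le_integral => //.
  - by move=> z _; apply: erestrict_ge0 => {}z _; exact: ltW.
  - by apply/(measurable_restrictT _ _).1.
  - apply: emeasurable_funM => //; apply/measurable_EFinP.
    apply: (measurableT_comp _ (@measurable_stereo R)).
    by apply: measurable_indic; exact: open_measurable3.
  - move=> z _; rewrite patchE; case: ifPn; last first.
      by move=> _; rewrite mule_ge0// lee_fin.
    rewrite inE => /Kin[Uz zr']; rewrite indicE mem_set// mul1e.
    apply: lee_pmul.
    + by rewrite lee_fin invr_ge0 sqrtr_ge0.
    + rewrite mule_ge0 ?weight_tail_ge0// lee_fin invr_ge0 ltW//.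
    + rewrite lee_fin lef_pV2 ?posrE ?sqrtr_gt0 ?ltr_pwDl ?sqn_ge0//.
      by rewrite ler_wsqrtr// lerD2l ltW.
    + by apply: D_ge; exact: ltW.
Qed.

End EquilibriumMeasure.

(** * Comparison with an extremal measure *)

Section Extremal.
Context {R : realType}.
Notation S := (@sphere R).
Implicit Types (x y : R3 R) (mu eta : probability (R3 R) R) (Q : R3 R -> \bar R).

Let mS : measurable S := @measurable_sphere R.

Lemma north_sphere : [set @north R] `<=` S.
Proof. by move=> x ->; apply/sphereE; rewrite /dot/=; ring. Qed.

Lemma measurable_north : measurable [set @north R].
Proof.
have -> : [set @north R] =
    S `&` (fun x : R3 R => x.2) @^-1` [set 1].
  apply/seteqP; split => x /=; first by move=> ->; split => //; exact: north_sphere.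
  by case=> Sx; exact: sphere_third_eq1.
apply: measurableI => //.
rewrite -[_ @^-1` _]setTI.
exact: (@measurable_snd _ _ (measurableTypeR R * measurableTypeR R)%type
  (measurableTypeR R) measurableT [set 1] (measurable_set1 1)).
Qed.

Lemma integral_infinite_set1 mu x (f : R3 R -> \bar R) :
  S x -> measurable [set x] -> measurable_fun setT f -> (forall y, 0 <= f y)%E ->
  f x = +oo%E -> (0 < mu [set x])%E -> (\int[mu]_(y in S) f y = +oo)%E.
Proof.
move=> Sx mx mf f0 fx mux; apply/eqP; rewrite -leye_eq.
apply: (@le_trans _ _ (\int[mu]_(y in [set x]) f y)%E); last first.
  apply: ge0_subset_integral => //.
  - exact: measurable_funTS.
  - by move=> y ->.
rewrite (@eq_integral _ _ _ mu [set x] (cst +oo%E)); last first.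
  by move=> y; rewrite inE => ->.
by rewrite integral_cst// gt0_mulye.
Qed.

(** The kernel is infinite on the diagonal, so a point charge has infinite energy. *)
Lemma finite_energy_north mu : (mutual_energy mu mu < +oo)%E ->
  mu [set @north R] = 0%E.
Proof.
move=> fin; apply/eqP/negPn/negP => muN.
have muN0 : (0 < mu [set @north R])%E by rewrite lt0e muN measure_ge0.
have SN := north_sphere (erefl : [set @north R] (@north R)).
have mN := measurable_north.
have U0 x : (0 <= \int[mu]_(y in S) coulomb x y)%E.
  by apply: integral_ge0 => y _; exact: coulomb_ge0.
move: fin; rewrite /mutual_energy.
rewrite (integral_infinite_set1 SN mN (measurable_potential mu) U0)//.
apply: (integral_infinite_set1 SN mN _ _ _ muN0).
- exact: measurable_coulomb.
- by move=> y; exact: coulomb_ge0.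
- by rewrite /coulomb subrr /enorm/= expr0n/= !addr0 sqrtr0 inve0.
Qed.

Lemma integral_cap_below eta t (f : R3 R -> \bar R) :
  eta (cap_below t) = 1%E -> measurable_fun setT f -> (forall x, 0 <= f x)%E ->
  (\int[eta]_(x in S) f x = \int[eta]_(x in cap_below t) f x)%E.
Proof.
move=> cap1 mf f0.
have mC := measurable_cap_below t.
rewrite (@ge0_negligible_integral _ _ _ eta S _ _ (measurableC mC))//.
- congr (integral _ _ _); apply/seteqP; split => x.
    by case=> Sx /contrapT.
  by move=> Cx; split; [case: Cx|exact].
- exact: measurable_funTS.
- exact: probability_setC0.
Qed.

(** Integrating the equilibrium condition gives [I(eta) + Q(eta) = a], and
    [I(mu, eta) + Q(mu) >= a] because [mu] does not charge the north pole; here [Q(mu)]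
    is the integral of [Q].  Minimality of [mu] gives [I(mu) + 2 Q(mu) <= I(eta) + 2 Q(eta)].
    Together, [I(mu) + I(eta) <= 2 a - 2 Q(mu) <= 2 I(mu, eta)], which is the hypothesis of
    [energy_rigidity]. *)
Lemma extremal_power_potential Q mu eta t a :
  measurable_fun setT Q -> (forall x, 0 <= Q x)%E -> extremal Q mu ->
  on_sphere eta -> eta (cap_below t) = 1%E ->
  (forall x, S x -> x <> @north R ->
    a%:E <= \int[eta]_(y in S) coulomb x y + Q x)%E ->
  (forall x, cap_below t x ->
    \int[eta]_(y in S) coulomb x y + Q x = a%:E)%E ->
  forall n x, power_potential mu n x = power_potential eta n x.
Proof.
move=> mQ Q0 [muS muQ] etaS etaC ge_a eq_a.
have mU := measurable_potential eta.
have U0 x : (0 <= \int[eta]_(y in S) coulomb x y)%E.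
  by apply: integral_ge0 => y _; exact: coulomb_ge0.
have EE : (mutual_energy eta eta + \int[eta]_(x in S) Q x = a%:E)%E.
  rewrite /mutual_energy -ge0_integralD//; last 2 first.
  - exact: measurable_funTS.
  - exact: measurable_funTS.
  rewrite (integral_cap_below etaC); last 2 first.
  - exact: emeasurable_funD.
  - by move=> x; exact: adde_ge0.
  rewrite (@eq_integral _ _ _ eta _ (cst a%:E)); last first.
    by move=> x /set_mem; exact: eq_a.
  rewrite -[RHS]mule1 -etaC; apply: integral_cst.
  exact: measurable_cap_below.
have le_min : (mutual_energy mu mu + 2%:E * \int[mu]_(x in S) Q x <=
    mutual_energy eta eta + 2%:E * \int[eta]_(x in S) Q x)%E.
  by rewrite [leLHS]muQ; apply: ereal_inf_lbound; exists eta.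
have E0 (nu nu' : probability (R3 R) R) : (0 <= mutual_energy nu nu')%E.
  by apply: integral_ge0 => x _; apply: integral_ge0 => y _; exact: coulomb_ge0.
have I0 (nu : probability (R3 R) R) : (0 <= \int[nu]_(x in S) Q x)%E.
  exact: integral_ge0.
have /andP[Efin Jfin] : (mutual_energy eta eta \is a fin_num) &&
    ((\int[eta]_(x in S) Q x)%E \is a fin_num) by rewrite -fin_numD EE.
have Mfin : (mutual_energy mu mu < +oo)%E.
  rewrite (@le_lt_trans _ _ (mutual_energy mu mu + 2%:E * \int[mu]_(x in S) Q x)%E)//.
    by rewrite leeDl// mule_ge0.
  apply: (le_lt_trans le_min).
  apply: lte_add_pinfty; first by rewrite -ge0_fin_numE.
  by apply: lte_mul_pinfty; rewrite // -ge0_fin_numE.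
have Xa : (a%:E <= mutual_energy mu eta + \int[mu]_(x in S) Q x)%E.
  have mN := @measurable_north.
  rewrite /mutual_energy -ge0_integralD//; last 2 first.
  - exact: measurable_funTS.
  - exact: measurable_funTS.
  have mUQ : measurable_fun setT
      (fun x => \int[eta]_(y in S) coulomb x y + Q x)%E.
    exact: emeasurable_funD.
  have muSN : mu (S `\` [set @north R]) = 1%E.
    have N0 := finite_energy_north Mfin.
    have S_fin : (mu S < +oo)%E by rewrite muS ltry.
    have := measureD mS mN S_fin.
    rewrite (setIidr north_sphere) => ->; rewrite -[RHS]sube0.
    by congr (_ - _)%E; [exact: muS|exact: N0].
  apply: (@le_trans _ _ (\int[mu]_(x in S `\` [set @north R])
      (\int[eta]_(y in S) coulomb x y + Q x))%E).
    rewrite -[leLHS]mule1 -muSN -integral_cst//; last exact: measurableD.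
      have a0 : (0 <= a%:E)%E by rewrite -EE adde_ge0.
    apply: ge0_le_integral => //.
    - exact: measurableD.
    - exact: measurable_funTS.
    - by move=> x [Sx xN]; exact: ge_a.
  apply: ge0_subset_integral => //; first exact: measurableD.
  - exact: measurable_funTS.
  - by move=> x _; exact: adde_ge0.
apply: energy_rigidity.
  by apply: lte_add_pinfty => //; rewrite -ge0_fin_numE.
move: Efin Jfin Mfin le_min Xa EE (E0 mu mu) (E0 mu eta) (I0 mu).
case: (mutual_energy eta eta) => [e||]//; case: (mutual_energy mu mu) => [m||]//.
case: (mutual_energy mu eta) => [x||]//; last first.
  by move=> *; rewrite gt0_muley ?lte_fin// leey.
case: (\int[eta]_(x in S) Q x)%E => [j||]//.
case: (\int[mu]_(x in S) Q x)%E => [i||]//; last first.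
  by rewrite gt0_muley ?lte_fin.
rewrite -!EFinM -!EFinD !lee_fin => _ _ _ ? ? [?] *.
lra.
Qed.

Lemma msupport_cap_below eta t : eta (cap_below t) = 1%E ->
  (forall U, open U -> forall x, cap_below t x -> U x -> 0 < eta U)%E ->
  msupport eta = cap_below t.
Proof.
move=> etaC etaU; apply/seteqP; split => [x xeta|x Cx U oU Ux]; last exact: etaU Cx Ux.
have etaS : on_sphere eta.
  apply/eqP; rewrite eq_le probability_le1//= -etaC.
  apply: le_measure; rewrite ?inE//; first exact: measurable_cap_below.
  by move=> y [].
split; first exact: (msupport_sphere etaS).
rewrite leNgt; apply/negP => tx.
have oU : open [set y : R3 R | t < y.2].
  have [_ _ c3] := @continuous_coordinates R.
  have := @open_comp _ _ (fun y : R3 R => y.2) `]t, +oo[%classic.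
  move=> /(_ (fun y _ => c3 y) (interval_open _ _)).
  rewrite (_ : _ @^-1` _ = [set y | t < y.2]); first exact.
  by apply/seteqP; split => y /=; rewrite in_itv/= andbT.
have := xeta _ oU tx; rewrite ltNge => /negP; apply.
rewrite -(probability_setC0 (measurable_cap_below t) etaC).
apply: le_measure; rewrite ?inE.
- exact: measurable_third_ge.
- by apply: measurableC; exact: measurable_cap_below.
- by move=> y /= ty [_]; rewrite leNgt ty.
Qed.

End Extremal.

(** * Spherical caps in Cartesian coordinates *)

Section SphericalCap.
Context {R : realType}.
Implicit Types (x y : R3 R) (alpha a b : R).

Lemma polar_angle a b : a ^+ 2 + b ^+ 2 = 1 ->
  exists2 theta, 0 <= theta <= 2 * pi & cos theta = a /\ sin theta = b.
Proof.
move=> ab1; have a1 : -1 <= a <= 1.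
  by rewrite -ler_norml -(@ler_pXn2r _ 2)// ?nnegrE// expr1n real_normK ?num_real// -ab1 lerDl sqr_ge0.
have [/andP[t0 tpi] ct] := acos_def a1.
have st : sin (acos a) = `|b|.
  by rewrite sin_acos// -sqrtr_sqr; congr Num.sqrt; rewrite -ab1; ring.
have [b0|b0] := leP 0 b.
  exists (acos a); last by rewrite ct st ger0_norm.
  by rewrite t0/= (le_trans tpi)// ler_peMl ?pi_ge0// ler1n.
exists (2 * pi - acos a).
  by have := @pi_ge0 R; lra.
rewrite addrC mulr_natl cosD2pi sinD2pi cosN sinN ct st ltr0_norm//.
by split => //; exact: opprK.
Qed.

Lemma south_capE alpha : 0 < alpha < pi ->
  south_cap alpha = @cap_below R (cos alpha).
Proof.
move=> /andP[a0 api].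
have le_cos phi : 0 <= phi <= pi -> (cos phi <= cos alpha) = (alpha <= phi).
  by move=> phi0; rewrite !leNgt ltr_cos// in_itv/=// !ltW.
apply/seteqP; split => [x [theta [phi [/andP[ap pp] _ ->]]]|x [Sx xa]].
  have phi0 : 0 <= phi <= pi by rewrite pp (le_trans (ltW a0)).
  split; last by rewrite /= mul1r le_cos.
  apply/sphereE; rewrite /dot/= !mul1r.
  transitivity (sin phi ^+ 2 * (cos theta ^+ 2 + sin theta ^+ 2) + cos phi ^+ 2).
    by ring.
  by rewrite cos2Dsin2 mulr1 addrC cos2Dsin2.
have [phi0 cphi] := acos_def (sphere_third_le1 Sx).
have s0 := sin_ge0_pi phi0.
set phi := acos x.2 in phi0 cphi s0.
have sx : x.1.1 ^+ 2 + x.1.2 ^+ 2 = sin phi ^+ 2.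
  apply: (@addrI _ (cos phi ^+ 2)); rewrite cos2Dsin2 cphi.
  by rewrite -((sphereE _).1 Sx) /dot; ring.
have [theta theta0 [xc xs]] : exists2 theta, 0 <= theta <= 2 * pi &
    sin phi * cos theta = x.1.1 /\ sin phi * sin theta = x.1.2.
  have [sn|sn] := eqVneq (sin phi) 0.
    exists 0; first by rewrite lexx/= mulr_ge0// pi_ge0.
    move: sx; rewrite sn expr0n/= !mul0r => /eqP.
    by rewrite paddr_eq0 ?sqr_ge0// !sqrf_eq0 => /andP[/eqP -> /eqP ->].
  have [|theta t0 [ct st]] := @polar_angle (x.1.1 / sin phi) (x.1.2 / sin phi).
    by rewrite !expr_div_n -mulrDl sx divff// sqrf_eq0.
  by exists theta => //; rewrite ct st !(mulrC (sin phi)) !divfK.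
exists theta, phi; split => //; last first.
  by rewrite /spherical !mul1r xc xs cphi; case: (x) => -[].
by rewrite (andP phi0).2 andbT -le_cos// cphi.
Qed.

End SphericalCap.

(** * The mass of a cap and the transcendental equation *)

Section HalfAngle.
Context {R : realType}.
Implicit Types (t c : R).

Lemma atan_cot t : 0 < t < pi -> atan (cot t) = pi / 2 - t.
Proof.
move=> /andP[t0 tpi]; rewrite -[RHS]tanK ?in_itv/=; last by apply/andP; lra.
congr atan; rewrite /tan /cot.
by rewrite sinB cosB cos_pihalf sin_pihalf !mul1r !mul0r subr0 add0r.
Qed.

Lemma cot_pihalfB_atan c : cot (pi / 2 - atan c) = c.
Proof.
rewrite /cot sinB cosB cos_pihalf sin_pihalf !mul1r !mul0r subr0 add0r.
exact: (@atanK R c).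
Qed.

Lemma oneDcot_sqr t : sin t != 0 -> 1 + cot t ^+ 2 = (sin t ^+ 2)^-1.
Proof.
move=> s0; have e := cos2Dsin2 t; rewrite /cot.
apply: (mulfI (expf_neq0 2 s0)); rewrite divff ?expf_neq0// -{2}e.
by field.
Qed.

End HalfAngle.

Section CapMass.
Context {R : realType}.
Variables (q h : R).
Hypotheses (q0 : 0 < q) (h0 : 0 < h).
Implicit Types (c alpha : R).

(** The level [a] for which [edge_profile] vanishes at [c ^+ 2]; the parameter [c] is
    [cot (alpha / 2)] for the cap of opening [alpha]. *)
Definition cap_level c : R :=
  q * (1 + h) * (1 + c ^+ 2) / ((1 + h) ^+ 2 + (1 - h) ^+ 2 * c ^+ 2).

(** The mass of the disk mixture that solves the equilibrium condition on the cap
    of parameter [c]; see [disk_mass] and [integral_cap_weight_atan]. *)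
Definition cap_mass c : R :=
  2 * pi * profile_primitive q (1 + h) (1 - h) (cap_level c) c.

Let u0 : 0 < 1 + h. Proof. by rewrite addr_gt0. Qed.

Let vu : (1 - h) ^+ 2 < (1 + h) ^+ 2 := sqr_oneB_lt h0.

Let denom_gt0 c : 0 < (1 + h) ^+ 2 + (1 - h) ^+ 2 * c ^+ 2.
Proof. by rewrite ltr_pwDl ?exprn_gt0// mulr_ge0 ?sqr_ge0. Qed.

Lemma cap_levelE c :
  cap_level c * ((1 + h) ^+ 2 + (1 - h) ^+ 2 * c ^+ 2) =
  q * (1 + h) * (1 + c ^+ 2).
Proof. by rewrite divfK// gt_eqF. Qed.

Lemma cap_level_gt0 c : 0 < cap_level c.
Proof. by rewrite divr_gt0// !mulr_gt0// ltr_pwDl// sqr_ge0. Qed.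

Lemma cap_massE c : cap_mass c = 2 / pi *
  (cap_level c * (atan c + c / (1 + c ^+ 2))
   - q * (1 + h) / (2 * h) * atan c
   + q * (1 - h) / (2 * h) * atan ((1 - h) / (1 + h) * c)).
Proof.
have h1 := gt_eqF h0; have h2 := gt_eqF u0.
rewrite /cap_mass /profile_primitive; move: (atan c + _) => L.
move: (atan c) (atan _) => x y; move: (cap_level c) => A.
have : (pi : R) != 0 by rewrite gt_eqF// pi_gt0.
move: (pi : R) => p p0; have -> : (1 + h) ^+ 2 - (1 - h) ^+ 2 = 4 * h by ring.
by field; rewrite p0 h1 h2.
Qed.

Lemma cap_equation_mass alpha : 0 < alpha < pi ->
  cap_equation q h alpha <-> cap_mass (cot (alpha / 2)) = 1.
Proof.
move=> /andP[a0 api].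
have t0 : 0 < alpha / 2 < pi by have := @pi_gt0 R; lra.
have s0 := sin_gt0_pi t0; have sn := gt_eqF s0.
rewrite /cap_equation cap_massE atan_cot//; set c := cot _.
have e := cos2Dsin2 (alpha / 2).
have c1 := oneDcot_sqr (negbT sn).
have sE : sin alpha = 2 * (c / (1 + c ^+ 2)).
  rewrite c1 invrK /c /cot [in LHS](_ : alpha = (alpha / 2) *+ 2); last by lra.
  by rewrite sin_mulr2n -mulr_natl; field; rewrite sn.
have cE : h ^+ 2 + 1 - 2 * h * cos alpha =
    ((1 + h) ^+ 2 + (1 - h) ^+ 2 * c ^+ 2) / (1 + c ^+ 2).
  rewrite c1 invrK /c /cot [in LHS](_ : alpha = (alpha / 2) *+ 2); last by lra.
  rewrite cos_mulr2n -[X in X - 1]mulr_natl.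
  transitivity ((1 + h) ^+ 2 * sin (alpha / 2) ^+ 2 +
    (1 - h) ^+ 2 * cos (alpha / 2) ^+ 2); last by field; rewrite sn.
  have -> : sin (alpha / 2) ^+ 2 = 1 - cos (alpha / 2) ^+ 2 
    by apply/esym/eqP; rewrite subr_eq addrC e.
  by ring.
have L0 : 0 < pi / 2 - alpha / 2 + c / (1 + c ^+ 2).
  rewrite ltr_wpDr//; last lra.
  rewrite divr_ge0//; last by rewrite c1 invr_ge0 sqr_ge0.
  by rewrite /c /cot divr_ge0 ?(ltW s0)// cos_ge0_pihalf//; lra.
have -> : pi - alpha + sin alpha = 2 * (pi / 2 - alpha / 2 + c / (1 + c ^+ 2)).
  by rewrite sE; lra.
have AE : q * ((h + 1) / (h ^+ 2 + 1 - 2 * h * cos alpha)) = cap_level c.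
  by rewrite cE invf_div /cap_level !mulrA [h + 1]addrC.
have -> : c * ((h - 1) / (h + 1)) = - ((1 - h) / (1 + h) * c).
  by rewrite -[h - 1]opprB [h + 1]addrC mulNr mulrN mulrC.
rewrite AE atanN.
have A0 := cap_level_gt0 c; move: L0 A0.
move: (cap_level c) (atan ((1 - h) / _ * c)) (c / (1 + _)) => A y z.
have := @pi_gt0 R; move: (pi : R) => p p0 L0 A0.
have hn := gt_eqF h0; have pn := gt_eqF p0; have Ln := gt_eqF L0.
(* both equations are A = something, up to the factor pi / (2 L) *)
set L := p / 2 - alpha / 2 + z in L0 Ln *.
have key : p / (2 * L) * (1 + q * (h + 1) / (2 * h) * (1 - alpha / p) -
    q * (h - 1) / (p * h) * - y) - A = p / (2 * L) *
  (1 - 2 / p * (A * L - q * (1 + h) / (2 * h) * (p / 2 - alpha / 2) +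
      q * (1 - h) / (2 * h) * y)).
  by clearbody L; field; rewrite hn pn Ln.
split => H.
  move: key; rewrite H subrr => /esym/eqP; rewrite mulf_eq0 subr_eq0 => /orP[|/eqP//].
  by rewrite gt_eqF// divr_gt0// mulr_gt0.
by apply/eqP; rewrite -subr_eq0 key H subrr mulr0.
Qed.

(** The mass grows with the level for a fixed radius, and with the radius for a
    fixed level since the profile is nonnegative below the edge; the level itself
    grows with the radius. *)
Lemma lt_cap_mass c1 c2 : 0 < c1 -> c1 < c2 -> cap_mass c1 < cap_mass c2.
Proof.
move=> c10 c12; have c20 := lt_trans c10 c12; set A2 := cap_level c2.
have A12 : cap_level c1 < A2.
  rewrite /A2 /cap_level ltr_pdivrMr// [ltRHS]mulrAC ltr_pdivlMr// -subr_gt0.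
  rewrite (_ : _ - _ = 4 * h * (q * (1 + h)) * (c2 ^+ 2 - c1 ^+ 2)); last by ring.
  by rewrite !mulr_gt0// subr_gt0 ltrXn2r// ltW.
apply: (@lt_le_trans _ _ (2 * pi * profile_primitive q (1 + h) (1 - h) A2 c1)).
  rewrite ltr_pM2l ?mulr_gt0 ?pi_gt0// /profile_primitive.
  rewrite ltr_pM2l ?divr_gt0 ?exprn_gt0 ?pi_gt0// ltrD2r ltr_pM2r ?ltr_pM2r//.
  have at0 : 0 < atan c1 by rewrite -(@atan0 R) lt_atan.
  by rewrite addr_gt0// divr_gt0// ltr_pwDl// sqr_ge0.
rewrite ler_pM2l ?mulr_gt0 ?pi_gt0//.
set F := profile_primitive q (1 + h) (1 - h) A2.
have dF z := is_derive_profile_primitive q A2 u0 vu z.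
apply: (@ger0_derive1_ndecr R F c1 c2) => //; last exact: ltW.
- move=> z; rewrite in_itv/= => /andP[zc1 zc2].
  rewrite derive1E; have -> := @derive_val _ _ _ _ _ _ _ (dF z).
  rewrite divr_ge0//; last by rewrite addr_ge0 ?sqr_ge0.
  apply: ltW; apply: (edge_profile_gt0 q0 u0 vu (cap_levelE c2)).
  by rewrite sqr_ge0 ltrXn2r// ltW// (lt_trans c10).
- apply: derivable_within_continuous => z _.
  exact: (@ex_derive _ _ _ _ _ _ _ (dF z)).
Qed.

Lemma continuous_cap_mass : continuous cap_mass.
Proof.
move=> x; have -> : cap_mass = fun c => 2 / pi *
  (cap_level c * (atan c + c / (1 + c ^+ 2))
   - q * (1 + h) / (2 * h) * atan c
   + q * (1 - h) / (2 * h) * atan ((1 - h) / (1 + h) * c)).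
  by apply/funext => c; exact: cap_massE.
have id : y @[y --> x] --> x by exact: cvg_id.
have sqr : y ^+ 2 @[y --> x] --> x ^+ 2 by apply: cvgM.
have one : 1 + y ^+ 2 @[y --> x] --> 1 + x ^+ 2.
  by apply: cvgD => //; exact: cvg_cst.
have cA : cap_level y @[y --> x] --> cap_level x.
  apply: cvgM; first by apply: cvgM => //; exact: cvg_cst.
  apply: cvgV; first by rewrite gt_eqF.
  by apply: cvgD; [exact: cvg_cst|apply: cvgM => //; exact: cvg_cst].
have at1 : atan y @[y --> x] --> atan x by exact: continuous_atan.
apply: cvgM; first exact: cvg_cst.
apply: cvgD; first apply: cvgB.
- apply: cvgM => //; apply: cvgD => //; apply: cvgM => //.
  by apply: cvgV => //; rewrite gt_eqF// ltr_pwDl ?sqr_ge0.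
- by apply: cvgM => //; exact: cvg_cst.
- apply: cvgM; first exact: cvg_cst.
  apply: (@cvg_comp _ _ _ (fun y => (1 - h) / (1 + h) * y) (@atan R) _
    (nbhs ((1 - h) / (1 + h) * x))); last exact: continuous_atan.
  by apply: cvgM => //; exact: cvg_cst.
Qed.

Lemma cap_mass0 : cap_mass 0 = 0.
Proof. by rewrite cap_massE !(mulr0, mul0r, atan0, addr0, subr0). Qed.

(** The omitted term is positive and tends to [0] for large [c], so the bound has the
    same limit as the mass when [h != 1]. *)
Let cap_mass_ge c : 0 <= c -> 2 / pi *
  (cap_level c * atan c
   - q * (1 + h) / (2 * h) * atan c
   + q * (1 - h) / (2 * h) * atan ((1 - h) / (1 + h) * c)) <= cap_mass c.
Proof.
move=> c0; rewrite cap_massE ler_pM2l ?divr_gt0 ?pi_gt0// lerD2r lerD2r.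
rewrite ler_pM2l ?cap_level_gt0// lerDl divr_ge0//.
by rewrite addr_ge0 ?sqr_ge0.
Qed.

Let oneD_sqrV c : (1 + c ^+ 2)^-1 = cos (atan c) ^+ 2.
Proof.
by rewrite cos_atan exprVn sqr_sqrtr// addr_ge0 ?sqr_ge0.
Qed.

(** In terms of [atan c] the level extends continuously to [c = +oo]. *)
Let cap_level_atan c :
  cap_level c = q * (1 + h) / ((1 - h) ^+ 2 + 4 * h * cos (atan c) ^+ 2).
Proof.
have c1 : 1 + c ^+ 2 != 0 by rewrite gt_eqF// ltr_pwDl ?sqr_ge0.
rewrite -oneD_sqrV /cap_level.
have -> : (1 + h) ^+ 2 + (1 - h) ^+ 2 * c ^+ 2 =
    (1 + c ^+ 2) * ((1 - h) ^+ 2 + 4 * h / (1 + c ^+ 2)) by field.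
by rewrite [_ * (1 + c ^+ 2)]mulrC -mulf_div divff// mul1r.
Qed.

Let cap_mass_unbounded : h = 1 -> exists2 c, 0 < c & 1 < cap_mass c.
Proof.
(* the level is q (1 + c^2) / 2, so any c with q c^2 large enough will do *)
move=> h1; pose c := 4 / q + 2; exists c; first by rewrite addr_gt0 ?divr_gt0.
have c2 : 2 <= c by rewrite lerDr divr_ge0// ltW.
have c1 : 1 <= c by lra.
apply: lt_le_trans (cap_mass_ge (le_trans ler01 c1)).
rewrite /cap_level h1 subrr !mul0r expr0n/= !mulr0 !mul0r !addr0.
have a1 : pi / 4 <= atan c by rewrite -atan1 le_atan.
have cq : 4 + 2 * q = q * c by rewrite /c mulrDr mulrCA divff ?mulr1 1?mulrC// gt_eqF.
have -> : q * (1 + 1) * (1 + c ^+ 2) / (1 + 1) ^+ 2 * atan c -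
  q * (1 + 1) / (2 * 1) * atan c = (q * c * c - q) / 2 * atan c by field.
rewrite -cq; have p0 := @pi_gt0 R.
have e1 : 2 < ((4 + 2 * q) * c - q) / 2 by move: c2 cq; clearbody c; nra.
apply: (@lt_le_trans _ _ (2 / pi * (((4 + 2 * q) * c - q) / 2 * (pi / 4)))).
  move: e1; set B := (_ / 2 in X in _ < X -> _) => e1.
  have -> : 2 / pi * (B * (pi / 4)) = B / 2.
    by move: (pi : R) p0 => p p0; field; rewrite gt_eqF.
  by lra.
rewrite ler_pM2l ?divr_gt0// ler_pM2l//; exact: lt_trans e1.
Qed.

Let cap_mass_limit : h != 1 ->
  1 < q * (1 + h) / (1 - h) ^+ 2 - q * (1 + h) / (2 * h) + q * `|1 - h| / (2 * h) ->
  exists2 c, 0 < c & 1 < cap_mass c.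
Proof.
move=> h1 lt1; pose k := `|1 - h| / (1 + h).
have h1n : 1 - h != 0 by rewrite subr_eq0 eq_sym.
have k0 : 0 < k by rewrite divr_gt0// normr_gt0.
have kE c : (1 - h) * atan ((1 - h) / (1 + h) * c) = `|1 - h| * atan (k * c).
  rewrite /k; have [h2|h2] := leP 0 (1 - h); first by rewrite ger0_norm.
  by rewrite ltr0_norm// !mulNr atanN mulrN opprK.
have cvg1 : atan c @[c --> +oo] --> (pi : R) / 2 by exact: cvgy_atan.
have cvg2 : atan (k * c) @[c --> +oo] --> (pi : R) / 2.
  apply: cvg_comp; last exact: cvgy_atan.
  by apply: gt0_cvgMry => //; exact: cvg_id.
have cvgA : cap_level c @[c --> +oo] --> q * (1 + h) / (1 - h) ^+ 2.
  rewrite (_ : cap_level = fun c => q * (1 + h) /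
    ((1 - h) ^+ 2 + 4 * h * cos (atan c) ^+ 2)); last first.
    by apply/funext => c; exact: cap_level_atan.
  apply: cvgM; first exact: cvg_cst.
  have cc : cos (atan c) @[c --> +oo] --> (0 : R).
    rewrite -cos_pihalf.
    exact: (@cvg_comp _ _ _ (@atan R) (@cos R) _ _ _ cvg1 (@continuous_cos R _)).
  apply: cvgV; first by rewrite expf_neq0.
  rewrite -[X in _ --> X]addr0; apply: cvgD; first exact: cvg_cst.
  rewrite -[X in _ --> X](mulr0 (4 * h)); apply: cvgM; first exact: cvg_cst.
  by rewrite -[X in _ --> X](mulr0 (0 : R)); apply: cvgM.
have cvgm : 2 / pi * (cap_level c * atan c - q * (1 + h) / (2 * h) * atan c +
    q / (2 * h) * (`|1 - h| * atan (k * c))) @[c --> +oo] -->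
  2 / pi * (q * (1 + h) / (1 - h) ^+ 2 * (pi / 2) -
    q * (1 + h) / (2 * h) * (pi / 2) + q / (2 * h) * (`|1 - h| * (pi / 2))).
  apply: cvgM; first exact: cvg_cst.
  apply: cvgD; first apply: cvgB; apply: cvgM => //; try exact: cvg_cst.
  by apply: cvgM => //; exact: cvg_cst.
have lim1 : 1 < 2 / pi * (q * (1 + h) / (1 - h) ^+ 2 * (pi / 2) -
    q * (1 + h) / (2 * h) * (pi / 2) + q / (2 * h) * (`|1 - h| * (pi / 2))).
  have := @pi_gt0 R; move: (pi : R) => p p0.
  move: lt1; congr (1 < _); field.
  by rewrite h1n !gt_eqF.
have gt1 := @cvgr_gt _ _ _ _ _ _ cvgm _ lim1.
have [c [c0 c1]] := filter_ex (filterI (nbhs_pinfty_gt (num_real (0 : R)))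
  (gt1 _)).
exists c => //; apply: (lt_le_trans c1); apply: le_trans (cap_mass_ge (ltW c0)).
rewrite -kE le_eqVlt; apply/orP; left; apply/eqP; ring.
Qed.

(** As [c] grows, the mass tends to [q] times the difference in the hypothesis that
    applies when [h != 1], and to infinity when [h = 1]. *)
Lemma cap_mass_gt1 : (1 < h -> 1 / q < (h + 1) / (h - 1) ^+ 2 - 1 / h) ->
  (h < 1 -> 1 / q < (h + 1) / (1 - h) ^+ 2 - 1) ->
  exists2 c, 0 < c & 1 < cap_mass c.
Proof.
move=> hi lo; have hn := gt_eqF h0; have qn := gt_eqF q0.
have [h1|h1|h1] := ltgtP h 1; last exact: cap_mass_unbounded.
- apply: cap_mass_limit; first by rewrite lt_eqF.
  have := lo h1; rewrite ltr_pdivrMr// => lt.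
  rewrite ger0_norm ?subr_ge0 ?(ltW h1)//.
  have n : 1 - h != 0 by rewrite subr_eq0 gt_eqF.
  by move: lt; congr (1 < _); field; rewrite hn n.
- apply: cap_mass_limit; first by rewrite gt_eqF.
  have := hi h1; rewrite ltr_pdivrMr// => lt.
  rewrite ltr0_norm ?subr_lt0// opprB.
  have n : h - 1 != 0 by rewrite subr_eq0 gt_eqF.
  rewrite -[(1 - h) ^+ 2]sqrrN opprB.
  by move: lt; congr (1 < _); field; rewrite hn n.
Qed.

Lemma cap_mass_eq1 c0 : 0 < c0 -> 1 < cap_mass c0 ->
  exists c, unique (fun c => 0 < c /\ cap_mass c = 1) c.
Proof.
move=> c00 m1.
have [||c] := @IVT R cap_mass 0 c0 1 (ltW c00).
- by apply: continuous_subspaceT; exact: continuous_cap_mass.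
- by rewrite cap_mass0 ge_min ler01 le_max (ltW m1) orbT.
rewrite in_itv/= le_eqVlt => /andP[/orP[/eqP <-|cgt] _] mc.
  by move: mc; rewrite cap_mass0 => /eqP; rewrite eq_sym oner_eq0.
exists c; split => // d [d0 md].
have [cd|cd|//] := ltgtP c d.
- by have := lt_cap_mass cgt cd; rewrite mc md ltxx.
- by have := lt_cap_mass d0 cd; rewrite mc md ltxx.
Qed.

(** The openings [alpha] in ]0, pi[ and the parameters [c > 0] correspond by
    [c = cot (alpha / 2)]. *)
Lemma cap_equation_unique c : unique (fun c => 0 < c /\ cap_mass c = 1) c ->
  unique (fun alpha => 0 < alpha < pi /\ cap_equation q h alpha)
    (pi - 2 * atan c).
Proof.
move=> [[c0 mc] uc].
have at0 : 0 < atan c by rewrite -(@atan0 R) lt_atan.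
have at1 := @atan_ltpi2 R c.
have half : (pi - 2 * atan c) / 2 = pi / 2 - atan c by lra.
split.
  have alpha0 : 0 < pi - 2 * atan c < pi by lra.
  split => //; apply/cap_equation_mass => //.
  by rewrite half cot_pihalfB_atan.
move=> alpha [alpha0 /(cap_equation_mass alpha0) m1].
have t0 : 0 < alpha / 2 < pi by have := @pi_gt0 R; lra.
have -> : c = cot (alpha / 2); last by rewrite atan_cot//; lra.
apply: uc; split => //; rewrite divr_gt0 ?sin_gt0_pi// cos_gt0_pihalf//.
by have := @pi_gt0 R; lra.
Qed.

Lemma cos_piB_atan c : cos (pi - 2 * atan c) = (c ^+ 2 - 1) / (c ^+ 2 + 1).
Proof.
have c1 : 1 + c ^+ 2 != 0 by rewrite gt_eqF// ltr_pwDl ?sqr_ge0.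
rewrite addrC cosDpi cosN mulr_natl cos_mulr2n -oneD_sqrV mulr2n.
by field; rewrite [_ + 1]addrC c1.
Qed.

End CapMass.

(** * Critical heights *)

Section CriticalHeights.
Context {R : realType}.
Implicit Types (q h x y : R).

Let hplus_ratio x := (x + 1) / (x - 1) ^+ 2 - 1 / x.
Let hminus_ratio x := (x + 1) / (1 - x) ^+ 2 - 1.

(** In partial fractions both terms of the ratio are visibly decreasing. *)
Lemma gt_hplus_ratio x y : 1 < x -> x < y -> hplus_ratio y < hplus_ratio x.
Proof.
move=> x1 xy; have y1 := lt_trans x1 xy.
have split_ratio z : 1 < z ->
    hplus_ratio z = 2 * ((z - 1) ^+ 2)^-1 + ((z - 1) * z)^-1.
  move=> z1; rewrite /hplus_ratio; field.
  by rewrite subr_eq0 !gt_eqF// (lt_trans ltr01).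
rewrite !split_ratio// ltrD//.
  rewrite ltr_pM2l// ltf_pV2 ?posrE ?exprn_gt0 ?subr_gt0//.
  by rewrite ltrXn2r ?ltrD2r// subr_ge0 ltW.
rewrite ltf_pV2 ?posrE ?mulr_gt0 ?subr_gt0 ?(lt_trans ltr01)//.
by rewrite ltr_pM ?ltrD2r ?subr_ge0// ltW// (lt_trans ltr01).
Qed.

Lemma lt_hminus_ratio x y : 0 <= x -> x < y -> y < 1 ->
  hminus_ratio x < hminus_ratio y.
Proof.
move=> x0 xy y1; have x1 := lt_trans xy y1.
rewrite ltrD2r ltr_pM ?invr_ge0 ?sqr_ge0 ?addr_ge0 ?ltrD2r//.
rewrite ltf_pV2 ?posrE ?exprn_gt0 ?subr_gt0//.
by rewrite ltrXn2r ?ltrD2l ?ltrN2// subr_ge0 ltW.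
Qed.

Lemma exists_hplus q : 0 < q -> exists! hp, zero_hplus q hp.
Proof.
move=> q0; have q1 : 0 < 1 + q by rewrite addr_gt0.
(* k < 1 and k^2 < q put the ratio at 1 + k above 1 / q; l >= 1 and l >= 3 q put
   the ratio at 1 + l below it *)
pose k := q / (1 + q); pose l := 3 * q + 1.
have k0 : 0 < k by rewrite divr_gt0.
have k1 : k < 1 by rewrite ltr_pdivrMr// mul1r ltrDr.
have kq : k < q by rewrite ltr_pdivrMr// ltr_pMr// ltrDl.
have lq : 3 * q < l by rewrite ltrDl.
have l1 : 1 < l by rewrite ltrDr mulr_gt0.
have [|||hp] := @IVT R hplus_ratio (1 + k) (1 + l) (1 / q).
- by rewrite lerD2l; lra.
- apply: continuous_in_subspaceT => x; rewrite inE/= in_itv/= => /andP[kx _].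
  have x1 : 1 < x by rewrite (lt_le_trans _ kx)// ltrDl.
  have id : y @[y --> x] --> x by exact: cvg_id.
  have cst (v : R) : v @[_ --> x] --> v by exact: cvg_cst.
  apply: cvgB; apply: cvgM => //; first exact: cvgD.
    apply: cvgV; first by rewrite expf_neq0// subr_eq0 gt_eqF.
    by apply: cvgM; exact: cvgB.
  by apply: cvgV => //; rewrite gt_eqF// (lt_trans ltr01).
- have hi : 1 / q <= hplus_ratio (1 + k).
    have inv_k : 1 <= (k ^+ 2)^-1 by rewrite invf_ge1 ?exprn_gt0// exprn_ile1// ltW.
    have inv_q : q^-1 <= (k ^+ 2)^-1.
      by rewrite lef_pV2 ?posrE ?exprn_gt0//; nra.
    have inv_k1 : (1 + k)^-1 <= 1 by rewrite invf_le1 ?addr_gt0// lerDl ltW.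
    have : 0 <= k / k ^+ 2 by rewrite divr_ge0 ?sqr_ge0// ltW.
    rewrite /hplus_ratio !mul1r (_ : 1 + k - 1 = k); last by ring.
    by rewrite (_ : (1 + k + 1) / k ^+ 2 = 2 * (k ^+ 2)^-1 + k / k ^+ 2); [lra|ring].
  have lo : hplus_ratio (1 + l) <= 1 / q.
    have l0 : 0 < l by lra.
    have -> : hplus_ratio (1 + l) = 2 * (l ^+ 2)^-1 + (l * (1 + l))^-1.
      by rewrite /hplus_ratio; field; rewrite !gt_eqF// addr_gt0.
    have : (l * (1 + l))^-1 <= (l ^+ 2)^-1.
      by rewrite lef_pV2 ?posrE ?mulr_gt0 ?addr_gt0//; nra.
    have : 3 * (l ^+ 2)^-1 <= 1 / q.
      by rewrite ler_pdivlMr// mulrAC ler_pdivrMr ?exprn_gt0//; nra.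
    by lra.
  by rewrite ge_min le_max hi lo orbT.
rewrite in_itv/= => /andP[hp0 _] hpE.
have hp1 : 1 < hp by rewrite (lt_le_trans _ hp0)// ltrDl.
exists hp; split=> [|x [x1 xE]]; first by split.
have [lt|lt|//] := ltgtP hp x.
- by have := gt_hplus_ratio hp1 lt; rewrite hpE xE ltxx.
- by have := gt_hplus_ratio x1 lt; rewrite hpE xE ltxx.
Qed.

Lemma exists_hminus q : 0 < q -> exists! hm, zero_hminus q hm.
Proof.
move=> q0; have q1 : 0 < 1 + q by rewrite addr_gt0.
(* the ratio at 1 - k is 1 / q + (2 + 2 q) / q^2 *)
pose k := q / (1 + q).
have k0 : 0 < k by rewrite divr_gt0.
have k1 : k < 1 by rewrite ltr_pdivrMr// mul1r ltrDr.
have hminus0 : hminus_ratio 0 = 0.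
  by rewrite /hminus_ratio add0r subr0 expr1n divr1 subrr.
have [|||hm] := @IVT R hminus_ratio 0 (1 - k) (1 / q).
- by rewrite subr_ge0 ltW.
- apply: continuous_in_subspaceT => x; rewrite inE/= in_itv/= => /andP[_ xk].
  have id : y @[y --> x] --> x by exact: cvg_id.
  have cst (v : R) : v @[_ --> x] --> v by exact: cvg_cst.
  apply: cvgB => //; apply: cvgM; first exact: cvgD.
  apply: cvgV; first by rewrite expf_neq0// subr_eq0 gt_eqF//; lra.
  by apply: cvgM; exact: cvgB.
- have hi : 1 / q <= hminus_ratio (1 - k).
    have -> : hminus_ratio (1 - k) = q^-1 + (2 + 2 * q) / q ^+ 2.
      rewrite /hminus_ratio /k; field.
      by rewrite !gt_eqF.
    rewrite mul1r lerDl divr_ge0 ?sqr_ge0//.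
    by rewrite addr_ge0// mulr_ge0// ltW.
  have q_ge0 : 0 <= 1 / q by rewrite divr_ge0// ltW.
  by rewrite hminus0 ge_min le_max hi q_ge0 orbT.
rewrite in_itv/= => /andP[]; rewrite le_eqVlt => /orP[/eqP <- _|hm0 hmk hmE].
  by rewrite hminus0 => /esym/eqP; rewrite gt_eqF// divr_gt0.
have hm1 : hm < 1 by lra.
exists hm; split=> [|x [/andP[x0 x1] xE]]; first by split => //; rewrite hm0.
have [lt|lt|//] := ltgtP hm x.
- by have := lt_hminus_ratio (ltW hm0) lt x1; rewrite hmE xE ltxx.
- by have := lt_hminus_ratio (ltW x0) lt hm1; rewrite hmE xE ltxx.
Qed.

Lemma cap_mass_gt1_between q h hm hp : 0 < q -> 0 < h ->
  zero_hplus q hp -> zero_hminus q hm -> hm < h < hp ->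
  exists2 c, 0 < c & 1 < cap_mass q h c.
Proof.
move=> q0 h0 [hp1 hpE] [/andP[hm0 hm1] hmE] /andP[mh hp_].
apply: cap_mass_gt1 => // h1; first by rewrite hpE; exact: gt_hplus_ratio.
by rewrite hmE; exact: (lt_hminus_ratio (ltW hm0)).
Qed.

End CriticalHeights.

(** * The support of the extremal measure *)

Unset Implicit Arguments.

Theorem theorem2p5 (R : realType) (q : R) (q_gt0 : 0 < q) :
  (exists! hp : R, zero_hplus q hp) /\
  (exists! hm : R, zero_hminus q hm) /\
  forall (h hm hp : R) (mu : probability (R3 R) R),
    0 < h ->
    zero_hplus q hp -> zero_hminus q hm ->
    hm < h < hp ->
    extremal (field_of_charge q h) mu ->
    exists alpha0 : R,
      unique (fun alpha : R => 0 < alpha < pi /\ cap_equation q h alpha) alpha0 /\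
      msupport mu = south_cap alpha0.
Proof.
split; first exact: exists_hplus.
split; first exact: exists_hminus.
move=> h hm hp mu h0 hpE hmE hmhp extr.
have [c0 c00 m1] := cap_mass_gt1_between q_gt0 h0 hpE hmE hmhp.
have [c uc] := cap_mass_eq1 q_gt0 h0 c00 m1.
have ualpha := cap_equation_unique q_gt0 h0 uc.
exists (pi - 2 * atan c); split => //.
have [[cpos mc] _] := uc; have [[alpha0 _] _] := ualpha.
have [eta [etaS etaC ge_a eq_a etaU]] :=
  equilibrium_measure q_gt0 h0 cpos (cap_levelE q h0 c) mc.
have pot := extremal_power_potential (@measurable_field R q h)
  (fun x => field_ge0 h x q_gt0) extr etaS etaC ge_a eq_a.
rewrite south_capE// cos_piB_atan -(msupport_cap_below etaC etaU).
have muS := extr.1.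
by apply/seteqP; split; apply: msupport_power_potential.
Qed.
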